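(* Let $\mu$ be a nonnegative Radon measure on $\mathbb R^d$. The following relations hold for $\mu$-almost every $x\in\mathbb R^d$: (i) $V_\mu(x)=T_\mu(x)$; (ii) $S_\mu(x)\subset T_\mu(x)$, with possibly a strict inclusion (i.e. there are measures $\mu$ for which the inclusion is strict on a set of positive $\mu$-measure); (iii) if $\mu$ is finite with compact support, then $T_\mu^{(p)}(x)\subset S_\mu(x)$ for every $p\in(1,+\infty)$, while $T_\mu^{(p)}(x)$ is non-decreasing (for inclusion) with respect to $p\in(1,+\infty)$.
   Context: $\mathcal D(\mathbb R^d)$ is the space of smooth compactly supported functions; $\operatorname{Lip}_1(\mathbb R^d)$ the real $1$-Lipschitz functions. $\mathcal M(\mathbb R^d;\mathbb R^d)$ is the space of finite $\mathbb R^d$-valued Borel measures. Let $\mathcal M_{0,1}(\mathbb R^d)$ be the finite signed Borel measures $f$ with $\int df=0$ and $\int|x|\,d|f|<\infty$, with norm $\|f\|_{\mathrm{KR}}=\sup\{\int u\,df: u\in\operatorname{Lip}_1(\mathbb R^d)\}$. The Arens-Eells space $\mathrm{AE}(\mathbb R^d)$ is the completion of $\mathcal M_{0,1}(\mathbb R^d)$ for this norm, identified with a subspace of distributions: $f\in\mathcal D'(\mathbb R^d)$ belongs to $\mathrm{AE}(\mathbb R^d)$ iff $\langle f,\varphi_n\rangle\to0$ for every sequence $(\varphi_n)\subset\mathcal D(\mathbb R^d)$ with $\sup_n\|\nabla\varphi_n\|_\infty<\infty$ and $\varphi_n\to c$ pointwise for some constant $c\in\mathbb R$. Normal $1$-currents: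 $\mathbf N_1(\mathbb R^d):=\{\lambda\in\mathcal M(\mathbb R^d;\mathbb R^d): -\operatorname{div}\lambda\in\mathcal M_{0,1}(\mathbb R^d)\}$. To a linear subspace $\mathcal W$ of $(L^1_\mu(\mathbb R^d))^d$ one associates the bundle $W_\mu(x):=\mu\text{-}\mathrm{ess}\bigcup\{\sigma:\sigma\in\mathcal W\}$, the smallest (up to $\mu$-null sets) closed-valued $\mu$-measurable multifunction with $\sigma(x)\in W_\mu(x)$ $\mu$-a.e. for every $\sigma\in\mathcal W$; concretely $W_\mu(x)=\overline{\{\sigma_n(x):n\in\mathbb N\}}$ for any countable $L^1_\mu$-dense subset $\{\sigma_n\}$ of $\mathcal W$. Its values are linear subspaces. The bundles $T_\mu$, $S_\mu$, $V_\mu$, $T_\mu^{(p)}$ are those associated respectively with: - $\mathcal T_\mu:=\{\sigma\in(L^1_\mu)^d: -\operatorname{div}(\sigma\mu)\in\mathrm{AE}(\mathbb R^d)\}$ (the MK tangent bundle); - $\mathcal S_\mu:=\{\sigma\in(L^1_\mu)^d:\sigma\mu\in\mathbf N_1(\mathbb R^d)\}$; - $\mathcal V_\mu:=\{\frac{d\lambda}{d\mu}:\lambda\in\mathbf N_1(\mathbb R^d)\}$, where $\frac{d\lambda}{d\mu}$ is the density of the $\mu$-absolutely continuous part of $\lambda$; - $\mathcal T_\mu^{(p)}:=\{\sigma\in(L^{p'}_\mu)^d: -\operatorname{div}(\sigma\mu)\in L^{p'}_\mu\}$, $1<p<\infty$, $p'=\frac p{p-1}$ (meaning $-\operatorname{div}(\sigma\mu)=g\mu$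 with $g\in L^{p'}_\mu$). *)

(* Defs.v *)
From HB Require Import structures.
From mathcomp Require Import all_boot all_order all_algebra.
From mathcomp Require Import all_classical all_reals all_analysis.

Set Implicit Arguments.
Unset Strict Implicit.
Unset Printing Implicit Defensive.

Import Order.TTheory GRing.Theory Num.Theory.
Import numFieldNormedType.Exports.

Local Open Scope classical_set_scope.
Local Open Scope ring_scope.

(* R^d with its Borel sigma-algebra; the carrier is convertible to 'rV[R]_d. *)
Notation borel R d := (g_sigma_algebraType (@open 'rV[R]_d)).

Section Defs.
Context {R : realType} {d : nat}.
Implicit Types (phi : 'rV[R]_d -> R) (sigma : 'rV[R]_d -> 'rV[R]_d)
  (mu : {measure set (borel R d) -> \bar R})
  (f : {charge set (borel R d) -> \bar R})
  (lambda : 'I_d -> {charge set (borel R d) -> \bar R}).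

(* The norm of the library on 'rV[R]_d is the sup norm. *)
Definition enorm (x : 'rV[R]_d) : R := Num.sqrt (\sum_(i < d) x 0 i ^+ 2).

Definition partial (i : 'I_d) phi : 'rV[R]_d -> R :=
  fun x => 'D_(delta_mx 0 i) phi x.

Definition gradient phi : 'rV[R]_d -> 'rV[R]_d :=
  fun x => \row_i partial i phi x.

Definition iter_partial (s : seq 'I_d) phi : 'rV[R]_d -> R :=
  foldr partial phi s.

Definition smooth phi : Prop :=
  forall (s : seq 'I_d) (x : 'rV[R]_d), differentiable (iter_partial s phi) x.

Definition fsupport phi : set 'rV[R]_d := closure [set x | phi x != 0].

Definition test_function phi : Prop := smooth phi /\ compact (fsupport phi).

(* Functionals are total on R-valued functions; only their values on test
   functions matter. *)
Definition distribution (L : ('rV[R]_d -> R) -> R) : Prop :=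
  (forall (a : R) phi psi, test_function phi -> test_function psi ->
     L (fun x => a * phi x + psi x) = a * L phi + L psi) /\
  (forall K : set 'rV[R]_d, compact K -> exists (C : R) (N : nat),
     forall phi (M : R), test_function phi -> fsupport phi `<=` K ->
       (forall s : seq 'I_d, (size s <= N)%N ->
          forall x, `|iter_partial s phi x| <= M) ->
       `|L phi| <= C * M).

(* The completion of M01 for the Kantorovich-Rubinstein norm, identified with a
   space of distributions through its characterization by sequences of
   equi-Lipschitz test functions. *)
Definition arens_eells (L : ('rV[R]_d -> R) -> R) : Prop :=
  distribution L /\
  forall (phi : nat -> 'rV[R]_d -> R) (c : R),
    (forall n, test_function (phi n)) ->
    (exists M : R, forall n x, enorm (gradient (phi n) x) <= M) ->
    (forall x, phi n x @[n --> \oo] --> c) ->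
    L (phi n) @[n --> \oo] --> (0 : R).

(* A chosen Hahn decomposition; the Jordan parts do not depend on the choice. *)
Lemma hahn_exists f : exists PN : set (borel R d) * set (borel R d),
  hahn_decomposition f PN.1 PN.2.
Proof. by have [P [N PN]] := Hahn_decomposition f; exists (P, N). Qed.

Definition hahnP f := projT2 (cid (hahn_exists f)).

Definition total_variation f := charge_variation (hahnP f).

Definition charge_integral f phi : R :=
  \int[jordan_pos (hahnP f)]_x phi x - \int[jordan_neg (hahnP f)]_x phi x.

(* Charges are finite on measurable sets by definition, so f is a finite signed
   Borel measure. *)
Definition M01 f : Prop :=
  f [set: borel R d] = 0%E /\
  (\int[total_variation f]_x (enorm x)%:E < +oo)%E.

(* <- div lambda, phi> = int grad phi . d lambda *)
Definition neg_div lambda phi : R :=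
  \sum_(i < d) charge_integral (lambda i) (partial i phi).

Definition normal_current lambda : Prop :=
  exists2 f, M01 f &
    forall phi, test_function phi -> neg_div lambda phi = charge_integral f phi.

(* <- div (sigma mu), phi> *)
Definition neg_div_density mu sigma phi : R :=
  \int[mu]_x (\sum_(i < d) sigma x 0 i * partial i phi x).

Definition L1vec mu sigma : Prop :=
  forall i : 'I_d, mu.-integrable [set: borel R d] (fun x => (sigma x 0 i)%:E).

Definition radon mu : Prop :=
  forall K : set 'rV[R]_d, compact K -> (mu K < +oo)%E.

Definition msupport mu : set 'rV[R]_d :=
  [set x | forall U : set 'rV[R]_d, open U -> U x -> (0 < mu U)%E].

Definition ac_with_density mu sigma lambda : Prop :=
  forall (i : 'I_d) (A : set (borel R d)), measurable A ->
    lambda i A = (\int[mu]_(x in A) (sigma x 0 i)%:E)%E.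

Definition singular mu f : Prop :=
  exists N : set (borel R d), [/\ measurable N, mu N = 0%E &
    forall A, measurable A -> A `<=` ~` N -> f A = 0%E].

(* sigma is the density of the mu-absolutely continuous part of lambda in its
   Lebesgue decomposition. *)
Definition is_ac_density mu lambda sigma : Prop :=
  L1vec mu sigma /\
  exists2 lambda_s : 'I_d -> {charge set (borel R d) -> \bar R},
    forall i, singular mu (lambda_s i) &
    forall (i : 'I_d) (A : set (borel R d)), measurable A ->
      lambda i A = (\int[mu]_(x in A) (sigma x 0 i)%:E + lambda_s i A)%E.

Definition calT mu : set ('rV[R]_d -> 'rV[R]_d) :=
  [set sigma : 'rV[R]_d -> 'rV[R]_d | L1vec mu sigma /\ arens_eells (neg_div_density mu sigma)].

Definition calS mu : set ('rV[R]_d -> 'rV[R]_d) :=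
  [set sigma : 'rV[R]_d -> 'rV[R]_d | L1vec mu sigma /\
    exists2 lambda, ac_with_density mu sigma lambda & normal_current lambda].

Definition calV mu : set ('rV[R]_d -> 'rV[R]_d) :=
  [set sigma : 'rV[R]_d -> 'rV[R]_d | exists2 lambda, normal_current lambda &
    is_ac_density mu lambda sigma].

Definition conj_exp (p : R) : R := p / (p - 1).

Definition calTp (p : R) mu : set ('rV[R]_d -> 'rV[R]_d) :=
  [set sigma : 'rV[R]_d -> 'rV[R]_d |
    (forall i : 'I_d,
       (fun x : borel R d => sigma x 0 i) \in Lfun mu (conj_exp p)%:E) /\
    exists2 g : borel R d -> R, g \in Lfun mu (conj_exp p)%:E &
      forall phi, test_function phi ->
        neg_div_density mu sigma phi = \int[mu]_x (g x * phi x)].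

(* Measurability with respect to the completion of mu. *)
Definition mu_measurable mu (A : set (borel R d)) : Prop :=
  exists2 B : set (borel R d), measurable B &
    mu.-negligible ((A `\` B) `|` (B `\` A)).

Definition measurable_multifun mu (W : 'rV[R]_d -> set 'rV[R]_d) : Prop :=
  forall U : set 'rV[R]_d, open U -> mu_measurable mu [set x | W x `&` U !=set0].

Definition closed_selectable mu (calW : set ('rV[R]_d -> 'rV[R]_d))
    (W : 'rV[R]_d -> set 'rV[R]_d) : Prop :=
  [/\ forall x, closed (W x), measurable_multifun mu W &
      forall sigma, calW sigma -> {ae mu, forall x, W x (sigma x)}].

Definition is_ess_union mu (calW : set ('rV[R]_d -> 'rV[R]_d))
    (W : 'rV[R]_d -> set 'rV[R]_d) : Prop :=
  closed_selectable mu calW W /\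
  forall W', closed_selectable mu calW W' -> {ae mu, forall x, W x `<=` W' x}.

(* A chosen representative of the mu-essential union, which is unique up to
   mu-null sets, and exists when mu is sigma-finite and the elements of calW
   are measurable. *)
Definition ess_union mu (calW : set ('rV[R]_d -> 'rV[R]_d)) :
    'rV[R]_d -> set 'rV[R]_d :=
  xget (fun=> setT) [set W | is_ess_union mu calW W].

Definition bundleT mu := ess_union mu (calT mu).
Definition bundleS mu := ess_union mu (calS mu).
Definition bundleV mu := ess_union mu (calV mu).
Definition bundleTp (p : R) mu := ess_union mu (calTp p mu).

End Defs.

(* Main.v *)
Require Import Defs.
From HB Require Import structures.
From mathcomp Require Import all_boot all_order all_algebra.
From mathcomp Require Import all_classical all_reals all_analysis.
From mathcomp Require Import measurable_realfun ring lra.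
Set Implicit Arguments.
Unset Strict Implicit.
Unset Printing Implicit Defensive.
Import Order.TTheory GRing.Theory Num.Theory.
Import numFieldNormedType.Exports.
Local Open Scope classical_set_scope.
Local Open Scope ring_scope.

(** The comparison of bundles reduces to a comparison of the families of fields
that generate them. The essential union of a family exists and is the least
measurable closed-valued multifunction selecting all of its members
([ess_union_exists]), so it is monotone in the family ([ess_union_mono]); and a
bundle whose fibres are closed also selects almost everywhere limits of fields
that it selects.

V is contained in T. Let [lambda] be a normal current and [phi n] equi-Lipschitz
test functions tending pointwise to a constant [c]. For a fixed test function
[psi], the integral of [psi * grad (phi n)] against [lambda] is the difference
of the pairing of [- div lambda] with [psi * (phi n - c)] and of the integral of
[(phi n - c) * grad psi] against [lambda]. Both tend to 0 by dominated
convergence, since [phi n - c] is bounded on the support of [psi]. The gradients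
being bounded and test functions being dense in L1 of the total variations, the
indicator of any Borel set may replace [psi] ([normal_current_closable]). For
the complement of a [mu]-null set that carries the singular part of [lambda],
this says that the density of the absolutely continuous part has its divergence
in the Arens-Eells space ([calV_sub_calT]). A field generating S generates V
with singular part 0, so S is contained in T as well.

T is contained in V. Let [L] be [- div (sigma mu)], an element of the Arens-Eells
space. For every [e > 0] there is [C] such that
[`|L phi| <= e * sup |grad phi| + C * sup |phi|], as otherwise a normalized
sequence of counterexamples would be equi-Lipschitz and tend to 0 uniformly
while [`|L phi| = 1] ([arens_eells_bound]). The Hahn-Banach and Riesz theorems
turn this bound into a representation [L = g0 nu - div (g nu)] in which the L1
norm of every component of [g] is at most [e] ([arens_eells_representation]).
Hence [sigma mu - g nu], multiplied by a cut-off function [chi], is a normal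
current, and the density of its absolutely continuous part is [chi sigma - w]
with [w] of L1 norm at most [e] ([truncated_current_density]). With [e] in a
summable sequence and [chi] tending to 1, these elements of [calV mu] converge to
[sigma] almost everywhere ([calT_approx]).

If [mu] is finite with compact support and [- div (sigma mu) = g mu] with
[sigma] and [g] in a space Lp, then both are integrable, and the only condition
left for [sigma mu] to be a normal current is that [g mu] has total mass 0. It
follows by testing against a function equal to 1 near the support
([normal_current_bounded], [calTp_sub_calS]). Conjugate exponents decrease and
the spaces Lp of a finite measure are nested, whence the monotonicity in [p].

The inclusion of S in T is strict for the image [cantor_line] on a coordinate
axis of Lebesgue measure on a fat Cantor set. The unit segment is a normal
current whose absolutely continuous part has the constant density [e_0], so
[e_0] lies in T ([direction_calV]). In contrast a field [sigma] generating S has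
component [sigma_0 = 0]: there are smooth functions [a] of the coordinate [x_0],
uniformly small but with derivative 1 on the Cantor set, because the set avoids
a neighbourhood of every rational. Testing the divergence, a measure, against
[a * psi] forces the integral of [sigma_0 * psi] to vanish for every test
function [psi] ([calS_pairing], [calS_transverse]). *)

(** * Smooth cut-off functions *)

Section FlatExp.
Context {R : realType}.

(** The powers of [t^-1] are there for stability: the derivative of such a
    function is a combination of functions of the same family. At [n = 0] it is
    the classical smooth function vanishing exactly for [t <= 0]. *)
Definition flat_exp (n : nat) (t : R) : R :=
  if 0 < t then t ^- n * expR (- t^-1) else 0.

Lemma flat_exp_le0 n t : t <= 0 -> flat_exp n t = 0.
Proof. by move=> t0; rewrite /flat_exp ltNge t0. Qed.

Lemma flat_exp_gt0 n t : 0 < t -> 0 < flat_exp n t.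
Proof.
by move=> t0; rewrite /flat_exp t0 mulr_gt0// ?expR_gt0// invr_gt0 exprn_gt0.
Qed.

Lemma flat_exp_ge0 n t : 0 <= flat_exp n t.
Proof.
by case: (ltP 0 t) => [/(flat_exp_gt0 n)/ltW//|/(flat_exp_le0 n) ->].
Qed.

(** The exponential series beats every power: at [u = t^-1] its term of
    degree [n.+1] gives [u ^+ n.+1 <= n.+1`! * expR u]. *)
Lemma flat_exp_le n t : flat_exp n t <= (n.+1)`!%:R * `|t|.
Proof.
have [t0|t0] := ltP 0 t; last by rewrite flat_exp_le0// mulr_ge0.
rewrite /flat_exp t0 gtr0_norm// expRN ler_pdivrMr ?expR_gt0//.
have f0 : 0 < (n.+1)`!%:R :> R by rewrite ltr0n fact_gt0.
have h : t^-1 ^+ n.+1 <= (n.+1)`!%:R * expR t^-1.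
  rewrite mulrC -ler_pdivrMr//; apply: le_trans (expR_ge1Dxn n _).
    by rewrite lerDr.
  by rewrite invr_ge0 ltW.
rewrite mulrAC; apply: le_trans (_ : t^-1 ^+ n.+1 * t <= _).
  by rewrite exprSr -mulrA mulVf ?gt_eqF// mulr1 exprVn.
by rewrite ler_wpM2r// ltW.
Qed.

(** At 0 the difference quotient of [flat_exp n] is [flat_exp n.+1], which
    tends to 0 by [flat_exp_le]. *)
Lemma is_derive_flat_exp n (t : R) :
  is_derive t 1 (flat_exp n) (- (n%:R) * flat_exp n.+1 t + flat_exp n.+2 t).
Proof.
have [t0|t0|->] := ltrgtP t 0.
- rewrite !(flat_exp_le0 _ (ltW t0)) mulr0 addr0.
  have H : is_derive t 1 (cst (0 : R)) (0 : R) by exact: is_derive_cst.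
  apply: near_eq_is_derive H; near=> s; rewrite flat_exp_le0//= ltW//.
  by near: s; exact: lt_nbhsl.
- have tn0 : t != 0 by rewrite gt_eqF.
  have h1 : is_derive t 1 (fun s : R => s^-1) (- t ^- 2).
    have := @is_deriveV R (fun s : R => s) t 1 1 tn0 (is_derive_id t (1:R)).
    by rewrite scaler1.
  have h2 : is_derive t 1 (fun s : R => s ^- n) (- (n%:R) * t ^- n.+1).
    have hn : is_derive (t^-1) 1 (fun y : R => y ^+ n) (n%:R * t^-1 ^+ n.-1).
      apply: DeriveDef; first exact: exprn_derivable.
      by rewrite exp_derive /GRing.scale /= mulr1.
    have -> : (fun s : R => s ^- n) = (fun y : R => y ^+ n) \o (fun s => s^-1).
      by apply/funext => s /=; rewrite exprVn.
    have H0 := is_derive1_comp hn h1.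
    suff -> : - (n%:R) * t ^- n.+1 = n%:R * t^-1 ^+ n.-1 * - t ^- 2 by exact: H0.
    case: n {hn H0} => [|n]; first by rewrite !mulr0n oppr0 !mul0r.
    by rewrite /= -!exprVn mulrN mulNr -mulrA -exprD addn2.
  have h3 : is_derive t 1 (fun s => expR (- s^-1)) (t ^- 2 * expR (- t^-1)).
    have hN : is_derive t 1 (fun s : R => - s^-1) (t ^- 2).
      by rewrite -[t ^- 2]opprK; exact: is_deriveN h1.
    have H0 := @is_derive1_comp R expR (fun s : R => - s^-1) t _ _ (is_derive_expR (- t^-1)) hN.
    by rewrite mulrC; exact: H0.
  have H : is_derive t 1 (fun s => s ^- n * expR (- s^-1))
      (- (n%:R) * flat_exp n.+1 t + flat_exp n.+2 t).
    have H0 := is_deriveM h2 h3.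
    suff -> : - (n%:R) * flat_exp n.+1 t + flat_exp n.+2 t =
      t ^- n *: (t ^- 2 * expR (- t^-1)) + expR (- t^-1) *: (- (n%:R) * t ^- n.+1).
      exact: H0.
    rewrite /flat_exp t0 /GRing.scale /= addrC -!exprVn; congr (_ + _).
      by rewrite mulrA -exprD addn2.
    by rewrite mulrA mulrC.
  apply: near_eq_is_derive H; near=> s; rewrite /flat_exp ifT//.
  by near: s; exact: lt_nbhsr.
- rewrite !flat_exp_le0// mulr0 addr0.
  suff : h^-1 * (flat_exp n h) @[h --> 0^'] --> (0:R).
    move=> h0.
    have e : (fun h : R => h^-1 *: (flat_exp n (h *: (1:R) + 0) - flat_exp n 0)) =
      (fun h => h^-1 * flat_exp n h).
      by apply/funext => h; rewrite /= [flat_exp n 0]flat_exp_le0// subr0 addr0 /GRing.scale/= mulr1.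
    split.
      rewrite /derivable /= ; apply/cvg_ex; exists 0.
      by under eq_fun do rewrite [h in _ *: h]/= ; rewrite e.
    rewrite /derive; under eq_fun do rewrite [h in _ *: h]/=; rewrite e.
    by apply/cvg_lim.
  have -> : (fun h : R => h^-1 * flat_exp n h) = flat_exp n.+1.
    apply/funext => h; rewrite /flat_exp; case: ifP => h0; last by rewrite mulr0.
    by rewrite mulrA exprS invfM.
  apply/cvgr0Pnorm_le => e e0.
  near=> h.
  rewrite ger0_norm ?flat_exp_ge0//.
  apply: (le_trans (flat_exp_le _ _)).
  rewrite -ler_pdivlMl ?ltr0n ?fact_gt0//.
  near: h.
  by apply: dnbhs0_le; rewrite mulr_gt0// invr_gt0 ltr0n fact_gt0.
Unshelve. all: by end_near. Qed.

End FlatExp.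

Section Smooth.
Context {R : realType} {d : nat}.
Implicit Types (f g phi psi : 'rV[R]_d -> R).

(** Partial derivatives of these functions are again of this form, so that
    differentiability of each of them gives smoothness without any computation
    of iterated derivatives. *)
Inductive smooth_closure : ('rV[R]_d -> R) -> Prop :=
| Sm_cst a : smooth_closure (fun=> a)
| Sm_coord i : smooth_closure (fun x => x 0 i)
| Sm_smooth f : smooth f -> smooth_closure f
| Sm_add f g : smooth_closure f -> smooth_closure g ->
    smooth_closure (fun x => f x + g x)
| Sm_mul f g : smooth_closure f -> smooth_closure g ->
    smooth_closure (fun x => f x * g x)
| Sm_inv f : smooth_closure f -> (forall x, f x != 0) ->
    smooth_closure (fun x => (f x)^-1)
| Sm_flat n f : smooth_closure f -> smooth_closure (fun x => flat_exp n (f x)).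

Lemma differentiable_flat_exp n (t : R) : differentiable (flat_exp n : R -> R) t.
Proof. by apply/derivable1_diffP; have [] := is_derive_flat_exp n t. Qed.

Lemma partialE f i x : differentiable f x ->
  partial i f x = 'd f x (delta_mx 0 i).
Proof. by move=> df; rewrite /partial deriveE. Qed.

Lemma partial_cst a i : partial i (fun=> a) = (fun=> 0) :> ('rV[R]_d -> R).
Proof. by apply/funext => x; rewrite /partial derive_cst. Qed.

Lemma partial_coord i j :
  partial i (fun x : 'rV[R]_d => x 0 j) = (fun=> (i == j)%:R).
Proof.
apply/funext => x; rewrite /partial /derive.
apply/cvg_lim => //=.
apply: (@cvg_trans _ ((fun=> (i == j)%:R : R) @ (0 : R)^')); last exact: cvg_cst.
apply: near_eq_cvg; near=> h.
rewrite !mxE eqxx /= addrK /GRing.scale /= eq_sym mulrA mulVf ?mul1r//.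
by near: h; exact: nbhs_dnbhs_neq.
Unshelve. all: by end_near. Qed.

Lemma partialD i f g : (forall x, differentiable f x) ->
  (forall x, differentiable g x) ->
  partial i (fun x => f x + g x) = (fun x => partial i f x + partial i g x).
Proof.
by move=> df dg; apply/funext => x; rewrite /partial deriveD//; exact: diff_derivable.
Qed.

Lemma partialM i f g : (forall x, differentiable f x) ->
  (forall x, differentiable g x) ->
  partial i (fun x => f x * g x) =
  (fun x => f x * partial i g x + g x * partial i f x).
Proof.
by move=> df dg; apply/funext => x; rewrite /partial deriveM//; exact: diff_derivable.
Qed.

Lemma partialV i f : (forall x, differentiable f x) -> (forall x, f x != 0) ->
  partial i (fun x => (f x)^-1) =
  (fun x => (-1) * ((f x)^-1 * (f x)^-1) * partial i f x).
Proof.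
move=> df f0; apply/funext => x; rewrite /partial deriveV//; last exact: diff_derivable.
by rewrite /GRing.scale /= expr2 invfM mulN1r.
Qed.

Lemma partial_flat i n f : (forall x, differentiable f x) ->
  partial i (fun x => flat_exp n (f x)) =
  (fun x => (- (n%:R) * flat_exp n.+1 (f x) + flat_exp n.+2 (f x)) * partial i f x).
Proof.
move=> df; apply/funext => x.
have dE := @differentiable_flat_exp n (f x).
rewrite partialE; last exact: (differentiable_comp (df x) dE).
rewrite (diff_comp (df x) dE) /= -partialE//.
have := @deriveE R _ _ (flat_exp n) (f x) (partial i f x) dE.
move=> <-.
have [dv <-] := is_derive_flat_exp n (f x).
rewrite -derive1E.
have := deriv1E dv => /(congr1 (fun h => h (partial i f x))) /=.
by rewrite deriveE// => ->; rewrite /GRing.scale/= mulrC.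
Qed.

Lemma differentiable_closure f x : smooth_closure f -> differentiable f x.
Proof.
move=> sf; elim: sf x => {f}.
- by move=> a x; exact: differentiable_cst.
- by move=> i x; exact: differentiable_coord.
- by move=> f sf x; exact: (sf [::]).
- by move=> f g _ df _ dg x; exact: differentiableD.
- by move=> f g _ df _ dg x; exact: differentiableM.
- by move=> f _ df f0 x; exact: differentiableV.
- by move=> n f _ df x; apply: (differentiable_comp (df x)); exact: differentiable_flat_exp.
Qed.

Lemma partial_closure f i : smooth_closure f -> smooth_closure (partial i f).
Proof.
elim=> {f}.
- by move=> a; rewrite partial_cst; exact: Sm_cst.
- by move=> j; rewrite partial_coord; exact: Sm_cst.
- move=> f sf; apply: Sm_smooth => s x.
  by have := sf (rcons s i) x; rewrite /iter_partial -cats1 foldr_cat.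
- move=> f g sf Sf sg Sg; rewrite partialD; first exact: Sm_add.
  + by move=> x; exact: differentiable_closure.
  + by move=> x; exact: differentiable_closure.
- move=> f g sf Sf sg Sg; rewrite partialM; first by apply: Sm_add; exact: Sm_mul.
  + by move=> x; exact: differentiable_closure.
  + by move=> x; exact: differentiable_closure.
- move=> f sf Sf f0; rewrite partialV//.
    apply: Sm_mul => //; apply: Sm_mul; first exact: Sm_cst.
    by apply: Sm_mul; exact: Sm_inv.
  by move=> x; exact: differentiable_closure.
- move=> n f sf Sf; rewrite partial_flat.
    apply: Sm_mul => //; apply: Sm_add; last exact: Sm_flat.
    by apply: Sm_mul; [exact: Sm_cst|exact: Sm_flat].
  by move=> x; exact: differentiable_closure.
Qed.

Lemma smooth_closureP f : smooth_closure f -> smooth f.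
Proof.
move=> sf s; suff : smooth_closure (iter_partial s f).
  by move=> h x; exact: differentiable_closure.
by elim: s => // i s IH; exact: partial_closure.
Qed.

Lemma smooth_differentiable f x : smooth f -> differentiable f x.
Proof. by move=> sf; exact: (sf [::]). Qed.

Lemma smooth_partial i f : smooth f -> smooth (partial i f).
Proof. by move=> /Sm_smooth/(partial_closure i)/smooth_closureP. Qed.

Lemma smooth_cst (a : R) : smooth (fun _ : 'rV[R]_d => a).
Proof. exact/smooth_closureP/Sm_cst. Qed.

Lemma smoothD f g : smooth f -> smooth g -> smooth (fun x => f x + g x).
Proof. by move=> sf sg; apply/smooth_closureP/Sm_add; exact: Sm_smooth. Qed.

Lemma smoothM f g : smooth f -> smooth g -> smooth (fun x => f x * g x).
Proof. by move=> sf sg; apply/smooth_closureP/Sm_mul; exact: Sm_smooth. Qed.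

Lemma smooth_prod (I : finType) (F : I -> 'rV[R]_d -> R) :
  (forall i, smooth (F i)) -> smooth (fun x => \prod_i F i x).
Proof.
move=> sF; elim: (index_enum I) => [|i s IH].
  by under eq_fun do rewrite big_nil; exact: smooth_cst.
by under eq_fun do rewrite big_cons; exact: smoothM.
Qed.

Lemma smooth_sum (I : Type) (s : seq I) (F : I -> 'rV[R]_d -> R) :
  (forall i, smooth (F i)) -> smooth (fun x => \sum_(i <- s) F i x).
Proof.
move=> sF; elim: s => [|i s IH].
  by under eq_fun do rewrite big_nil; exact: smooth_cst.
by under eq_fun do rewrite big_cons; exact: smoothD.
Qed.

Lemma smooth_affine (a b : R) i : smooth (fun x : 'rV[R]_d => a * x 0 i + b).
Proof.
apply/smooth_closureP/Sm_add; last exact: Sm_cst.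
by apply: Sm_mul; [exact: Sm_cst|exact: Sm_coord].
Qed.

(** Equal to 0 for [t <= 0] and to 1 for [t >= 1]; the denominator is
    positive as [t] and [1 - t] are not both nonpositive. *)
Definition smooth_step (t : R) : R :=
  flat_exp 0 t / (flat_exp 0 t + flat_exp 0 (1 - t)).

Lemma smooth_step_den (t : R) : 0 < flat_exp 0 t + flat_exp 0 (1 - t).
Proof.
have [t0|t0] := ltP 0 t.
  by rewrite ltr_pwDl ?flat_exp_ge0 ?flat_exp_gt0.
by rewrite ltr_wpDl ?flat_exp_ge0// flat_exp_gt0//; lra.
Qed.

Lemma smooth_step_ge0 t : 0 <= smooth_step t.
Proof. by rewrite divr_ge0 ?flat_exp_ge0// ltW// smooth_step_den. Qed.

Lemma smooth_step_le1 t : smooth_step t <= 1.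
Proof. by rewrite ler_pdivrMr ?smooth_step_den// mul1r lerDl flat_exp_ge0. Qed.

Lemma smooth_step_le0 t : t <= 0 -> smooth_step t = 0.
Proof. by move=> t0; rewrite /smooth_step flat_exp_le0// mul0r. Qed.

Lemma smooth_step_ge1 t : 1 <= t -> smooth_step t = 1.
Proof.
move=> t1; rewrite /smooth_step [flat_exp 0 (1 - t)]flat_exp_le0; last lra.
by rewrite addr0 divff// gt_eqF// flat_exp_gt0//; lra.
Qed.

Lemma smooth_step_smooth f : smooth f -> smooth (fun x => smooth_step (f x)).
Proof.
move=> /Sm_smooth sf; apply/smooth_closureP.
have sf' : smooth_closure (fun x => 1 - f x).
  apply: Sm_add; first exact: Sm_cst.
  have -> : (fun x => - f x) = (fun x => (-1) * f x).
    by apply/funext => x; rewrite mulN1r.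
  by apply: Sm_mul => //; exact: Sm_cst.
apply: Sm_mul; first exact: Sm_flat.
apply: Sm_inv; first by apply: Sm_add; exact: Sm_flat.
by move=> x; rewrite gt_eqF// smooth_step_den.
Qed.

Definition box (a b : 'I_d -> R) : set 'rV[R]_d :=
  [set x | forall i, a i < x 0 i < b i].

(** The slope [k] of the walls is a parameter, so that letting it grow gives
    the indicator of the open box. *)
Definition box_bump (a b : 'I_d -> R) (k : R) (x : 'rV[R]_d) : R :=
  \prod_i (smooth_step (k * x 0 i - k * a i) *
           smooth_step (- k * x 0 i + k * b i)).

Lemma box_bump_smooth a b k : smooth (box_bump a b k).
Proof.
apply: smooth_prod => i; apply: smoothM;
  by apply: smooth_step_smooth; exact: smooth_affine.
Qed.

Lemma box_bump_ge0 a b k x : 0 <= box_bump a b k x.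
Proof. by apply: prodr_ge0 => i _; rewrite mulr_ge0// smooth_step_ge0. Qed.

Lemma box_bump_le1 a b k x : box_bump a b k x <= 1.
Proof.
rewrite /box_bump; elim/big_rec: _ => // i y _ y1.
have [y0|y0] := leP 0 y.
  apply: mulr_ile1 => //; first by rewrite mulr_ge0 ?smooth_step_ge0.
  by apply: mulr_ile1; rewrite ?smooth_step_ge0 ?smooth_step_le1.
apply: (@le_trans _ _ 0); last exact: ler01.
by apply: mulr_ge0_le0; [rewrite mulr_ge0 ?smooth_step_ge0|exact: ltW].
Qed.

Lemma box_bump_out a b k x : 0 < k -> ~ box a b x -> box_bump a b k x = 0.
Proof.
move=> k0 /existsNP[i] /negP; rewrite negb_and -!leNgt => H.
rewrite /box_bump (bigD1 i)//=; apply/eqP; rewrite mulf_eq0 mulf_eq0 -orbA.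
case/orP: H => H; apply/orP.
  by left; rewrite smooth_step_le0// -mulrBr pmulr_rle0// subr_le0.
by right; apply/orP; left; rewrite smooth_step_le0// mulNr addrC -mulrBr pmulr_rle0// subr_le0.
Qed.

Lemma box_bump_in (a b : 'I_d -> R) (k : R) (x : 'rV[R]_d) : 0 < k ->
  (forall i, a i + k^-1 <= x 0 i <= b i - k^-1) -> box_bump a b k x = 1.
Proof.
move=> k0 H; rewrite /box_bump big1// => i _; case/andP: (H i) => h1 h2.
rewrite !smooth_step_ge1 ?mulr1//.
  by rewrite mulNr addrC -mulrBr mulrC -ler_pdivrMr// div1r; lra.
by rewrite -mulrBr mulrC -ler_pdivrMr// div1r; lra.
Qed.

End Smooth.

(** * Test functions and Borel sets of the Euclidean space *)

Section TestFunctions.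
Context {R : realType} {d : nat}.
Implicit Types (f g phi psi : 'rV[R]_d -> R) (x y : 'rV[R]_d).

Lemma coord_le_norm x i : `|x 0 i| <= `|x|.
Proof.
rewrite [leRHS]/Num.norm /= mx_normrE; apply/bigmax_geP; right => /=.
by exists (0, i).
Qed.

Lemma norm_le_coord x (r : R) : 0 <= r -> (forall i, `|x 0 i| <= r) -> `|x| <= r.
Proof.
move=> r0 H; rewrite [leLHS]/Num.norm /= mx_normrE; apply/bigmax_leP; split => //.
by move=> [i j] _ /=; rewrite ord1.
Qed.

Lemma enorm_coord x i : `|x 0 i| <= enorm x.
Proof.
rewrite -sqrtr_sqr ler_sqrt ?sumr_ge0// => [|j _]; last exact: sqr_ge0.
by rewrite (bigD1 i)//= lerDl sumr_ge0// => j _; exact: sqr_ge0.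
Qed.

Lemma enorm_le_norm x : enorm x <= Num.sqrt d%:R * `|x|.
Proof.
rewrite -[`|x|]ger0_norm// -sqrtr_sqr -sqrtrM// ler_sqrt ?mulr_ge0 ?sqr_ge0//.
apply: (@le_trans _ _ (\sum_(i < d) `|x| ^+ 2)).
  apply: ler_sum => i _; rewrite -real_normK ?num_real//.
  by rewrite lerXn2r ?nnegrE// coord_le_norm.
by rewrite sumr_const card_ord mulr_natl.
Qed.

Lemma enorm_ge0 x : 0 <= enorm x.
Proof. exact: sqrtr_ge0. Qed.

Lemma smooth_continuous f : smooth f -> continuous f.
Proof. by move=> sf x; apply: differentiable_continuous; exact: smooth_differentiable. Qed.

(** A quantified form of compact support, easier to propagate through sums and
    products than the support itself. *)
Definition vanishes_off (r : R) f := forall x, r < `|x| -> f x = 0.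

Lemma test_functionI f r : smooth f -> vanishes_off r f -> test_function f.
Proof.
move=> sf vf; split => //; apply: bounded_closed_compact; last exact: closed_closure.
have cl : closed [set x : 'rV[R]_d | `|x| <= r].
  apply: (@closed_comp _ _ (@Num.norm R 'rV[R]_d) [set t : R | t <= r]).
    by move=> x _; exact: norm_continuous.
  exact: closed_le.
have sub : fsupport f `<=` [set x | `|x| <= r].
  move/closure_id : cl => ->; apply: closure_subset => x /= fx0.
  by rewrite leNgt; apply/negP => /vf; exact/eqP.
exists r; split; first exact: num_real.
by move=> M rM x /sub /= xr; exact: (le_trans xr (ltW rM)).
Qed.

Lemma test_vanishes f : test_function f -> exists2 r, 0 <= r & vanishes_off r f.
Proof.
move=> [_ /compact_bounded[M [Mr H]]]; exists (`|M| + 1); first by rewrite addr_ge0.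
move=> x Mx; apply: contrapT => fx0.
have := H (`|M| + 1); rewrite ltr_pwDr// ?ler_norm// => /(_ isT x).
have xs : fsupport f x by apply: subset_closure; apply/eqP.
by move=> /(_ xs) /=; rewrite leNgt Mx.
Qed.

Lemma vanishes_partial r f i : vanishes_off r f -> vanishes_off r (partial i f).
Proof.
move=> vf x rx; rewrite /partial.
rewrite (@near_eq_derive _ _ _ f (cst 0)) ?derive_cst//.
have : nbhs x [set y : 'rV[R]_d | r < `|y|].
  apply: open_nbhs_nbhs; split => //.
  apply: (@open_comp _ _ (@Num.norm R 'rV[R]_d) [set t : R | r < t]).
    by move=> y _; exact: norm_continuous.
  exact: open_gt.
by apply: filterS => y /vf.
Qed.

Lemma test_partial i f : test_function f -> test_function (partial i f).
Proof.
move=> tf; have [r r0 vf] := test_vanishes tf; apply: (@test_functionI _ r).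
  by apply: smooth_partial; case: tf.
exact: vanishes_partial.
Qed.

Lemma test_mul_smooth f g : test_function f -> smooth g ->
  test_function (fun x => g x * f x).
Proof.
move=> tf sg; have [r r0 vf] := test_vanishes tf; apply: (@test_functionI _ r).
  by apply: smoothM => //; case: tf.
by move=> x /vf ->; rewrite mulr0.
Qed.

Lemma test_scale (a : R) f : test_function f -> test_function (fun x => a * f x).
Proof. by move=> tf; apply: test_mul_smooth => //; exact: smooth_cst. Qed.

Lemma testD f g : test_function f -> test_function g ->
  test_function (fun x => f x + g x).
Proof.
move=> tf tg; have [r r0 vf] := test_vanishes tf.
have [s s0 vg] := test_vanishes tg.
apply: (@test_functionI _ (r + s)).
  by apply: smoothD; [case: tf|case: tg].
move=> x rsx; rewrite vf ?vg ?addr0//; apply: le_lt_trans rsx.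
  by rewrite lerDr.
by rewrite lerDl.
Qed.

Lemma testB f g : test_function f -> test_function g ->
  test_function (fun x => f x - g x).
Proof.
move=> tf tg.
have -> : (fun x => f x - g x) = (fun x => f x + (-1) * g x).
  by apply/funext => x; rewrite mulN1r.
by apply: testD => //; exact: test_scale.
Qed.

Lemma test_cst0 : test_function (fun _ : 'rV[R]_d => 0 : R).
Proof. by apply: (@test_functionI _ 0) => //; exact: smooth_cst. Qed.

Lemma test_bounded f : test_function f -> exists M, forall x, `|f x| <= M.
Proof.
move=> tf; have [r r0 vf] := test_vanishes tf.
pose K := [set x : 'rV[R]_d | `|x| <= r].
have cK : compact K.
  apply: bounded_closed_compact.
    exists r; split; first exact: num_real.
    by move=> M rM x /= xr; exact: (le_trans xr (ltW rM)).
  apply: (@closed_comp _ _ (@Num.norm R 'rV[R]_d) [set t : R | t <= r]).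
    by move=> x _; exact: norm_continuous.
  exact: closed_le.
have K0 : K !=set0 by exists 0; rewrite /K/= normr0.
have cf : {within K, continuous (fun x => `|f x|)}.
  apply: continuous_subspaceT => x; apply: continuous_comp.
    by apply: smooth_continuous; case: tf.
  exact: norm_continuous.
have [c _ H] := EVT_max_rV K0 cK cf.
exists `|f c| => x; have [xr|rx] := leP `|x| r; first by apply: H; rewrite inE.
by rewrite vf// normr0.
Qed.

Lemma continuous_borel_measurable f : continuous f ->
  measurable_fun [set: borel R d] (f : borel R d -> R).
Proof.
move=> /continuousP cf; apply: (measurability _ (RGenOpens.measurableE R)).
move=> _ [_ [a [b ->] <-]]; rewrite setTI; apply: sub_sigma_algebra.
exact/cf/interval_open.
Qed.

Lemma open_borel (A : set 'rV[R]_d) : open A -> measurable (A : set (borel R d)).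
Proof. by move=> oA; exact: sub_sigma_algebra. Qed.

Lemma closed_borel (A : set 'rV[R]_d) : closed A -> measurable (A : set (borel R d)).
Proof. by move=> oA; rewrite -[A]setCK; apply: measurableC; apply: open_borel; exact: closed_openC. Qed.

Lemma smooth_measurable f : smooth f ->
  measurable_fun [set: borel R d] (f : borel R d -> R).
Proof. by move=> sf; apply: continuous_borel_measurable; exact: smooth_continuous. Qed.

Lemma test_measurable f : test_function f ->
  measurable_fun [set: borel R d] (f : borel R d -> R).
Proof. by move=> [sf _]; exact: smooth_measurable. Qed.

Lemma coord_measurable i :
  measurable_fun [set: borel R d] ((fun x => x 0 i) : borel R d -> R).
Proof. by apply: continuous_borel_measurable; exact: coord_continuous. Qed.

Lemma enorm_measurable :
  measurable_fun [set: borel R d] (enorm : borel R d -> R).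
Proof.
have ms : measurable_fun [set: R] (@Num.sqrt R).
  by apply: continuous_measurable_fun; exact: sqrt_continuous.
apply: (measurableT_comp ms).
apply: measurable_sum => i; apply: measurable_funX; exact: coord_measurable.
Qed.

Lemma diff_sum_partial f x v : differentiable f x ->
  'd f x v = \sum_i v 0 i * partial i f x.
Proof.
move=> df; rewrite {1}(row_sum_delta v) linear_sum.
by apply: eq_bigr => i _; rewrite linearZ /= partialE.
Qed.

Lemma is_derive_line f y v (t : R) : smooth f ->
  is_derive t 1 (fun s : R => f (y + s *: v)) ('D_v f (y + t *: v)).
Proof.
move=> sf; have df := smooth_differentiable (y + t *: v) sf.
have [D1 D2] := derivableP (@diff_derivable _ _ _ f _ v df).
have E : (fun h : R => h^-1 *: (f (y + (h *: (1 : R) + t) *: v) - f (y + t *: v))) =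
    (fun h : R => h^-1 *: (f (h *: v + (y + t *: v)) - f (y + t *: v))).
  apply/funext => h; congr (_ *: (f _ - _)).
  by rewrite [h *: _]mulr1 scalerDl addrCA.
apply: DeriveDef; first by rewrite /derivable /= E.
by rewrite /derive /= E.
Qed.

(** Mean value theorem on the segment. The constant is not sharp: the
    gradient is bounded coordinatewise and the sup norm is used. *)
Lemma gradient_lipschitz f (M : R) x y : smooth f ->
  (forall i z, `|partial i f z| <= M) -> `|f x - f y| <= d%:R * M * `|x - y|.
Proof.
move=> sf HM.
pose g (t : R) := f (y + t *: (x - y)).
pose dg (t : R) := 'D_(x - y) f (y + t *: (x - y)).
have Hd (t : R) : is_derive t 1 g (dg t) by exact: is_derive_line.
have cg : {within `[0, 1], continuous g}.
  apply: derivable_within_continuous => t _; by have [] := Hd t.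
have [c _] := MVT_segment ler01 (fun t _ => Hd t) cg.
rewrite /g scale1r scale0r addr0 [y + (x - y)]addrC subrK => ->.
rewrite subr0 mulr1 /dg deriveE ?diff_sum_partial; [|exact: smooth_differentiable..].
apply: (le_trans (ler_norm_sum _ _ _)).
apply: (@le_trans _ _ (\sum_(i < d) M * `|x - y|)).
  apply: ler_sum => i _; rewrite normrM mulrC ler_pM//.
  exact: coord_le_norm.
by rewrite sumr_const card_ord -mulrA mulr_natl.
Qed.

(** A cut-off function: 1 on the ball of radius [r], 0 outside the ball of
    radius [r + 1]. *)
Definition plateau (r : R) : 'rV[R]_d -> R :=
  box_bump (fun=> - (r + 1)) (fun=> r + 1) 1.

Lemma plateau_out r : 0 <= r -> vanishes_off (r + 1) (plateau r).
Proof.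
move=> r0 x rx; apply: box_bump_out => // H.
have : `|x| <= r + 1.
  apply: norm_le_coord; first lra.
  by move=> i; have := H i; rewrite ler_norml => /andP[/ltW -> /ltW ->].
by rewrite leNgt rx.
Qed.

Lemma plateau_test r : 0 <= r -> test_function (plateau r).
Proof.
move=> r0; apply: (test_functionI _ (plateau_out r0)); exact: box_bump_smooth.
Qed.

Lemma plateau_in r x : `|x| <= r -> plateau r x = 1.
Proof.
move=> xr; apply: box_bump_in => // i; have := coord_le_norm x i.
rewrite invr1 ler_norml => /andP[h1 h2]; apply/andP; split; lra.
Qed.

Lemma plateau_ge0 r x : 0 <= plateau r x. Proof. exact: box_bump_ge0. Qed.
Lemma plateau_le1 r x : plateau r x <= 1. Proof. exact: box_bump_le1. Qed.

Lemma partial_plateau_in r x i : `|x| < r -> partial i (plateau r) x = 0.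
Proof.
move=> xr; rewrite /partial (@near_eq_derive _ _ _ _ (cst (1 : R))) ?derive_cst//.
have : nbhs x [set y : 'rV[R]_d | `|y| < r].
  apply: open_nbhs_nbhs; split => //.
  apply: (@open_comp _ _ (@Num.norm R 'rV[R]_d) [set t : R | t < r]).
    by move=> y _; exact: norm_continuous.
  exact: open_lt.
by apply: filterS => y /= /ltW; exact: plateau_in.
Qed.

End TestFunctions.

Lemma indic_bound {T : Type} {R : realType} (A : set T) x : `|\1_A x : R| <= 1.
Proof. by rewrite indicE; case: (x \in A); rewrite ?normr1 ?normr0. Qed.

(** * Integrals of real functions *)

Section RealIntegral.
Context d {T : measurableType d} {R : realType} (nu : {measure set T -> \bar R}).
Implicit Types (f g : T -> R).

Definition intR f := nu.-integrable [set: T] (EFin \o f).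

Lemma intR_measurable f : intR f -> measurable_fun [set: T] f.
Proof. by move=> /measurable_int/measurable_EFinP. Qed.

Lemma intR_bounded f M : (nu setT < +oo)%E -> measurable_fun [set: T] f ->
  (forall x, `|f x| <= M) -> intR f.
Proof.
move=> fin mf fM; apply: measurable_bounded_integrable => //.
exists M; split; first exact: num_real.
by move=> N MN x _ /=; exact: le_trans (fM x) (ltW MN).
Qed.

Lemma intRD f g : intR f -> intR g -> intR (fun x => f x + g x).
Proof. by move=> hf hg; exact: (integrableD measurableT hf hg). Qed.

Lemma intRB f g : intR f -> intR g -> intR (fun x => f x - g x).
Proof. by move=> hf hg; exact: (integrableB measurableT hf hg). Qed.

Lemma intRZ a f : intR f -> intR (fun x => a * f x).
Proof. by move=> hf; exact: (integrableZl measurableT a hf). Qed.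

Lemma intR_norm f : intR f -> intR (fun x => `|f x|).
Proof. by move=> hf; exact: integrable_norm. Qed.

Lemma intR_cst0 : intR (fun=> 0).
Proof. exact: integrable0. Qed.

Lemma intR_sum (I : Type) (s : seq I) (F : I -> T -> R) :
  (forall i, intR (F i)) -> intR (fun x => \sum_(i <- s) F i x).
Proof.
move=> hF; elim: s => [|i s IH].
  by under eq_fun do rewrite big_nil; exact: intR_cst0.
by under eq_fun do rewrite big_cons; exact: intRD.
Qed.

Lemma intR_le f g : measurable_fun [set: T] f -> intR g ->
  (forall x, `|f x| <= g x) -> intR f.
Proof.
move=> mf ig fg; apply: (le_integrable measurableT _ _ ig).
  exact/measurable_EFinP.
move=> x _ /=; rewrite lee_fin; apply: (le_trans (fg x)); exact: ler_norm.
Qed.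

Lemma intRM f g M : measurable_fun [set: T] f -> (forall x, `|f x| <= M) ->
  intR g -> intR (fun x => f x * g x).
Proof.
move=> mf fM ig; apply: (@intR_le _ (fun x => M * `|g x|)).
- by apply: measurable_funM => //; exact: intR_measurable.
- exact/intRZ/intR_norm.
- by move=> x; rewrite normrM ler_wpM2r.
Qed.

Lemma intRMr f g M : measurable_fun [set: T] f -> (forall x, `|f x| <= M) ->
  intR g -> intR (fun x => g x * f x).
Proof. by move=> mf fM ig; under eq_fun do rewrite mulrC; exact: intRM fM ig. Qed.

Lemma Rint_sum (I : Type) (s : seq I) (F : I -> T -> R) :
  (forall i, intR (F i)) ->
  \int[nu]_x (\sum_(i <- s) F i x) = \sum_(i <- s) \int[nu]_x F i x.
Proof.
move=> hF; elim: s => [|i s IH].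
  under eq_Rintegral do rewrite big_nil.
  by rewrite big_nil Rintegral_cst// mul0r.
under eq_Rintegral do rewrite big_cons.
by rewrite RintegralD ?IH ?big_cons//; [exact: hF|exact: intR_sum].
Qed.

Lemma Rint_le f g : intR f -> intR g -> (forall x, f x <= g x) ->
  \int[nu]_x f x <= \int[nu]_x g x.
Proof. by move=> hf hg fg; exact: le_Rintegral. Qed.

Lemma Rint_norm_le f g : measurable_fun [set: T] f -> intR g ->
  (forall x, `|f x| <= g x) -> `|\int[nu]_x f x| <= \int[nu]_x g x.
Proof.
move=> mf ig fg; have hf := intR_le mf ig fg.
apply: (le_trans (le_normr_Rintegral _ _)) => //.
by apply: Rint_le => //; exact: intR_norm.
Qed.

Lemma Rint_dominated (f_ : nat -> T -> R) f g :
  (forall n, measurable_fun [set: T] (f_ n)) -> intR g ->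
  (forall n x, `|f_ n x| <= g x) -> (forall x, f_ n x @[n --> \oo] --> f x) ->
  intR f /\ \int[nu]_x f_ n x @[n --> \oo] --> \int[nu]_x f x.
Proof.
move=> mf ig fg cf.
have mF : measurable_fun [set: T] f.
  exact: (@measurable_fun_cvg _ _ _ _ f_).
have cF x : [set: T] x -> (EFin \o f_ n) x @[n --> \oo] --> (EFin \o f) x.
  by move=> _; apply: cvg_EFin; [exact: nearW|exact: cf].
have [h1 _ h3] := @dominated_convergence _ _ _ nu setT measurableT
  (fun n => EFin \o f_ n) (EFin \o f) (EFin \o g)
  (fun n => (measurable_EFinP _ _).2 (mf n)) ((measurable_EFinP _ _).2 mF)
  (aeW _ cF) ig
  (aeW _ (fun x n _ => fg n x)).
split=> //; apply: fine_cvg; rewrite fineK//.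
exact: integrable_fin_num.
Qed.

Lemma Rint_ae_eq f g : measurable_fun [set: T] f -> measurable_fun [set: T] g ->
  {ae nu, forall x, f x = g x} -> \int[nu]_x f x = \int[nu]_x g x.
Proof.
move=> mf mg fg; congr fine; apply: ae_eq_integral => //.
- exact/measurable_EFinP.
- exact/measurable_EFinP.
- by apply: filterS fg => x /= -> .
Qed.

Lemma Rint_indicM (A : set T) f : measurable A ->
  \int[nu]_x (\1_A x * f x) = \int[nu]_(x in A) f x.
Proof.
move=> mA; rewrite [RHS]Rintegral_mkcond; apply: eq_Rintegral => x _.
by rewrite patchE indicE; case: ifP => _; rewrite ?mul1r ?mul0r.
Qed.

Lemma Rint_indic (A : set T) : measurable A -> \int[nu]_x (\1_A x) = fine (nu A).
Proof.
move=> mA; transitivity (\int[nu]_x (\1_A x * 1)).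
  by apply: eq_Rintegral => x _; rewrite mulr1.
by rewrite Rint_indicM// Rintegral_cst// mul1r.
Qed.

End RealIntegral.

(** * Open boxes *)

Section Boxes.
Context {R : realType} {d : nat}.

Lemma box_open (a b : 'I_d -> R) : open (box a b).
Proof.
rewrite openE => x xb; rewrite /interior.
apply: (@filter_forall _ _ (fun i (y : 'rV[R]_d) => a i < y 0 i < b i) (nbhs x)) => i.
have : open ((fun x : 'rV[R]_d => x 0 i) @^-1` `]a i, b i[).
  apply: (@open_comp _ _ (fun x : 'rV[R]_d => x 0 i)); last exact: interval_open.
  by move=> y _; exact: coord_continuous.
rewrite openE => /(_ x); rewrite /interior /= in_itv /= => /(_ (xb i)).
by apply: filterS => y /=; rewrite in_itv.
Qed.

Lemma box_setI (a b a' b' : 'I_d -> R) : box a b `&` box a' b' =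
  box (fun i => Num.max (a i) (a' i)) (fun i => Num.min (b i) (b' i)).
Proof.
apply/seteqP; split => x /=.
  move=> [h h'] i; have := h i; have := h' i.
  by rewrite gt_max lt_min => /andP[-> ->] /andP[-> ->].
move=> h; split => i; have := h i; rewrite gt_max lt_min;
  by case/andP => /andP[h1 h2] /andP[h3 h4]; apply/andP.
Qed.

Definition rat_cube (p : 'rV[rat]_d * nat) : set 'rV[R]_d :=
  box (fun i => ratr (p.1 0 i) - p.2.+1%:R^-1) (fun i => ratr (p.1 0 i) + p.2.+1%:R^-1).

(** A rational point close to [x] is the centre of a cube of side comparable
    to the distance left. *)
Lemma rat_cube_nbhs (U : set 'rV[R]_d) x : open U -> U x ->
  exists p, rat_cube p x /\ rat_cube p `<=` U.
Proof.
move=> oU Ux.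
have /nbhs_ballP[e /= e0 eU] : nbhs x U by exact: open_nbhs_nbhs.
have [n n2] : exists n, 2 * n.+1%:R^-1 < e :> R.
  have e20 : 0 < e / 2 by rewrite divr_gt0.
  have [n] := ltr_add_invr e20.
  by rewrite add0r ltr_pdivlMr// mulrC; exists n.
have q i : {q : rat | `|x 0 i - ratr q| < n.+1%:R^-1}.
  apply: cid.
  have /rat_in_itvoo[q] : x 0 i - n.+1%:R^-1 < x 0 i + n.+1%:R^-1.
    by rewrite ltrD2l gt0_cp// ?invr_gt0.
  by rewrite in_itv /= => h; exists q; rewrite distrC ltr_distl.
exists (\row_i sval (q i), n); split.
  move=> i /=; rewrite !mxE; case: (q i) => r /= h.
  by rewrite -ltr_distl.
move=> y hy; apply: eU; split => // i j; rewrite ord1 /ball /=.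
have := hy j; rewrite /= !mxE; case: (q j) => r /= h.
rewrite -ltr_distl => h'; apply: lt_trans n2.
rewrite mulr_natl mulr2n; apply: le_lt_trans (ltrD h h').
by rewrite [`|y 0 j - _|]distrC; apply: le_trans (ler_normD _ _); rewrite addrA subrK.
Qed.

Lemma open_rat_cubes (U : set 'rV[R]_d) : open U ->
  U = \bigcup_(p in [set p | rat_cube p `<=` U]) rat_cube p.
Proof.
move=> oU; apply/seteqP; split => x.
  by move=> /(rat_cube_nbhs oU)[p [px pU]]; exists p.
by move=> [p /= pU px]; exact: pU.
Qed.

(** Boxes form a pi-system, which makes them the right generators for an
    argument by monotone classes. *)
Lemma borel_boxE : <<s (@open 'rV[R]_d) >> = <<s [set A | exists a b, A = box a b] >>.
Proof.
apply/seteqP; split; last first.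
  apply: smallest_sub; first exact: smallest_sigma_algebra.
  by move=> _ [a [b ->]]; apply: sub_sigma_algebra; exact: box_open.
apply: smallest_sub; first exact: smallest_sigma_algebra.
move=> U oU; rewrite (open_rat_cubes oU) bigcup_mkcond.
apply: (@countable_bigcupT_measurable _ (g_sigma_algebraType [set A | exists a b, A = @box R d a b])).
  exact: countableP.
move=> p; case: ifP => _.
  by apply: sub_sigma_algebra; eexists; eexists; reflexivity.
exact: measurable0.
Qed.

Lemma plateau_cvg1 (x : 'rV[R]_d) : plateau k%:R x @[k --> \oo] --> (1 : R).
Proof.
apply: (@cvg_trans _ ((fun=> 1 : R) @ \oo)); last exact: cvg_cst.
apply: near_eq_cvg; near=> k; rewrite plateau_in//.
by near: k; exact: nbhs_infty_ger.
Unshelve. all: by end_near. Qed.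

Lemma box_bump_cvg (a b : 'I_d -> R) (x : 'rV[R]_d) :
  box_bump a b k.+1%:R x @[k --> \oo] --> (\1_(box a b) x : R).
Proof.
have [xb|xb] := pselect (box a b x); last first.
  rewrite indicE memNset//.
  by under eq_cvg do rewrite box_bump_out//; exact: cvg_cst.
rewrite indicE mem_set//.
apply: (@cvg_trans _ ((fun=> 1 : R) @ \oo)); last exact: cvg_cst.
apply: near_eq_cvg.
suff : \forall k \near \oo, forall i, a i + k.+1%:R^-1 <= x 0 i <= b i - k.+1%:R^-1.
  by apply: filterS => k H; apply/esym; exact: box_bump_in.
apply: filter_forall => i; have /andP[h1 h2] := xb i.
have [h1' h2'] : 0 < x 0 i - a i /\ 0 < b i - x 0 i by rewrite !subr_gt0.
near=> k; apply/andP; split.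
  rewrite -lerBrDl ltW//; near: k; exact: near_infty_natSinv_lt (PosNum h1').
rewrite lerBrDr -lerBrDl ltW//; near: k; exact: near_infty_natSinv_lt (PosNum h2').
Unshelve. all: by end_near. Qed.

Lemma box_bump_test (a b : 'I_d -> R) (k : R) : 0 < k -> test_function (box_bump a b k).
Proof.
move=> k0; apply: (@test_functionI _ _ _ (\sum_i (`|a i| + `|b i|))).
  exact: box_bump_smooth.
move=> x rx; apply: box_bump_out => // H.
have : `|x| <= \sum_i (`|a i| + `|b i|).
  apply: norm_le_coord; first by apply: sumr_ge0 => i _; rewrite addr_ge0.
  move=> i; rewrite (bigD1 i)//=; apply: (@le_trans _ _ (`|a i| + `|b i|)).
    have /andP[h1 h2] := H i; have := ler_norm (- a i); have := ler_norm (b i).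
    have := normr_ge0 (a i); have := normr_ge0 (b i).
    by rewrite normrN => *; rewrite ler_norml; apply/andP; split; lra.
  by rewrite lerDl sumr_ge0// => j _; rewrite addr_ge0.
by rewrite leNgt rx.
Qed.

End Boxes.

(** * Density of test functions *)

Section Density.
Context {R : realType} {d : nat}.
Context {I : finType} (nu : I -> {measure set (borel R d) -> \bar R}).
Hypothesis nu_fin : forall i, (nu i [set: borel R d] < +oo)%E.
Implicit Types (f g : borel R d -> R).

Let test_approx f := (forall i, intR (nu i) f) /\
  forall e : R, 0 < e -> exists2 psi : 'rV[R]_d -> R, test_function psi &
    forall i, \int[nu i]_x `|f x - psi x| < e.

Let intR_test i (psi : 'rV[R]_d -> R) : test_function psi -> intR (nu i) psi.
Proof.
move=> tp; have [M HM] := test_bounded tp.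
exact: (intR_bounded (nu_fin i) (test_measurable tp) HM).
Qed.

Let test_approx_test (psi : 'rV[R]_d -> R) : test_function psi -> test_approx psi.
Proof.
move=> tp; split; first by move=> i; exact: intR_test.
move=> e e0; exists psi => // i.
under eq_Rintegral do rewrite subrr normr0.
by rewrite Rintegral_cst// mul0r.
Qed.

Let L1_triangle i f g h : intR (nu i) f -> intR (nu i) g -> intR (nu i) h ->
  \int[nu i]_x `|f x - h x| <= \int[nu i]_x `|f x - g x| + \int[nu i]_x `|g x - h x|.
Proof.
move=> hf hg hh.
have h1 : intR (nu i) (fun x => `|f x - g x|) by apply/intR_norm/intRB.
have h2 : intR (nu i) (fun x => `|g x - h x|) by apply/intR_norm/intRB.
rewrite -RintegralD//; apply: Rint_le.
- exact/intR_norm/intRB.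
- exact: intRD.
- by move=> x; rewrite -[f x - h x](subrKA (g x)) ler_normD.
Qed.

Let test_approxB f g : test_approx f -> test_approx g ->
  test_approx (fun x => f x - g x).
Proof.
move=> [hf Hf] [hg Hg]; split; first by move=> i; exact: intRB.
move=> e e0; have e20 : 0 < e / 2 by rewrite divr_gt0.
have [p tp hp] := Hf _ e20; have [q tq hq] := Hg _ e20.
exists (fun x => p x - q x); first exact: testB.
move=> i; have ip := intR_test i tp; have iq := intR_test i tq.
have {}hf := hf i; have {}hg := hg i.
have h1 : intR (nu i) (fun x => `|f x - p x|) by apply/intR_norm/intRB.
have h2 : intR (nu i) (fun x => `|g x - q x|) by apply/intR_norm/intRB.
rewrite [ltRHS]splitr; apply: le_lt_trans (ltrD (hp i) (hq i)).
rewrite -RintegralD//; apply: Rint_le.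
- by apply/intR_norm/intRB; exact: intRB.
- exact: intRD.
- move=> x; rewrite (_ : _ - _ = (f x - p x) - (g x - q x)); last by ring.
  exact: ler_normB.
Qed.

Let test_approx_dominated (f_ : nat -> borel R d -> R) f :
  (forall n, test_approx (f_ n)) -> (forall n x, `|f_ n x| <= 1) ->
  (forall x, f_ n x @[n --> \oo] --> f x) -> test_approx f.
Proof.
move=> Hf f1 cf.
have i1 i : intR (nu i) (fun=> 1 : R).
  by apply: (@intR_bounded _ _ _ _ _ 1) => // x; rewrite normr1.
have mf i n := intR_measurable ((Hf n).1 i).
have hf i : intR (nu i) f by have [] := Rint_dominated (mf i) (i1 i) f1 cf.
split => // e e0.
have e20 : 0 < e / 2 by rewrite divr_gt0.
have fx1 x : `|f x| <= 1.
  apply: (ler_cvg_to (cvg_norm (cf x)) (cvg_cst (1 : R))).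
  by apply: nearW => n; exact: f1.
have : \forall n \near \oo, forall i, \int[nu i]_x `|f x - f_ n x| < e / 2.
  apply: filter_forall => i.
  have [||||_ ] := @Rint_dominated _ _ _ (nu i) (fun n x => `|f x - f_ n x|) (fun=> 0) (fun=> 2).
  - move=> n; apply: measurableT_comp => //; apply: measurable_funB; last exact: (mf i).
    exact: intR_measurable (hf i).
  - by apply: (@intR_bounded _ _ _ _ _ 2) => // x; rewrite ger0_norm.
  - move=> n x; rewrite normr_id; apply: (le_trans (ler_normB _ _)).
    by rewrite -[2]/(1 + 1)%:R natrD lerD.
  - move=> x; rewrite -(normr0 R); apply: cvg_norm; rewrite -(subrr (f x)).
    by apply: cvgB => //; exact: cvg_cst.
  rewrite Rintegral_cst// mul0r => /cvgr0Pnorm_lt /(_ _ e20).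
  by apply: filterS => n; apply: le_lt_trans; exact: ler_norm.
move=> [N _ /(_ N (leqnn N)) /= HN].
have [_ /(_ _ e20)[p tp hp]] := Hf N.
exists p => // i; rewrite [ltRHS]splitr.
apply: le_lt_trans (L1_triangle (hf i) ((Hf N).1 i) (intR_test i tp)) _.
exact: ltrD.
Qed.

(** Monotone class argument: the sets with an approximable indicator contain
    boxes, whose indicators are limits of bumps, and are stable under proper
    differences and increasing unions. *)
Let test_approx_indic : forall A : set (borel R d), measurable A ->
  test_approx (\1_A : borel R d -> R).
Proof.
move=> A mA; rewrite /measurable /= borel_boxE in mA.
pose H := [set A : set (borel R d) | test_approx (\1_A : borel R d -> R)].
apply: (@lambda_system_subset _ _ _ setT H _ _ _ _ mA) => //.
- move=> _ _ [a [b ->]] [a' [b' ->]].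
  by rewrite box_setI; eexists; eexists; reflexivity.
- split => //.
  + apply: (@test_approx_dominated (fun k => plateau k%:R)).
    * by move=> n; apply/test_approx_test/plateau_test.
    * by move=> n x; rewrite ger0_norm ?plateau_ge0 ?plateau_le1.
    * by move=> x; rewrite indicT; exact: plateau_cvg1.
  + move=> B C CB HB HC; rewrite /H /=.
    have -> : \1_(B `\` C) = (fun x : borel R d => \1_B x - \1_C x : R).
      apply/funext => x; rewrite !indicE in_setD.
      have [xC|xC] := boolP (x \in C); last by rewrite subr0 andbT.
      by rewrite andbF (_ : x \in B) ?subrr//; apply/mem_set/CB/set_mem.
    exact: test_approxB.
  + move=> F ndF HF; rewrite /H /=.
    apply: (@test_approx_dominated (fun n => \1_(F n))) => //.
      by move=> n x; exact: indic_bound.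
    move=> x; have [[N _ FN]|nx] := pselect ((\bigcup_n F n) x).
      rewrite [\1_(\bigcup_n F n) x]indicE mem_set; last by exists N.
      apply: (@cvg_trans _ ((fun=> 1 : R) @ \oo)); last exact: cvg_cst.
      apply: near_eq_cvg; near=> n; rewrite indicE mem_set//.
      have : F N `<=` F n by apply/subsetPset/ndF; near: n; exact: nbhs_infty_ge.
      exact.
    rewrite [\1_(\bigcup_n F n) x]indicE memNset//.
    rewrite (_ : (fun n => \1_(F n) x) = (fun=> 0 : R)); first exact: cvg_cst.
    by apply/funext => n; rewrite indicE memNset// => Fx; apply: nx; exists n.
- move=> _ [a [b ->]]; apply: (@test_approx_dominated (fun k => box_bump a b k.+1%:R)).
  + move=> n; apply: test_approx_test.
    exact: box_bump_test.
  + by move=> n x; rewrite ger0_norm ?box_bump_ge0 ?box_bump_le1.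
  + exact: box_bump_cvg.
Unshelve. all: by end_near. Qed.

(** One test function serves finitely many measures at the same time, as needed
    for all the components of a current. *)
Lemma indic_test_dense (A : set (borel R d)) (e : R) : measurable A -> 0 < e ->
  exists2 psi : 'rV[R]_d -> R, test_function psi &
    forall i, \int[nu i]_x `|\1_A x - psi x| < e.
Proof. by move=> /test_approx_indic[_ h] /h. Qed.

End Density.

(** * Charges: densities, total variation, integrals *)

Section FiniteCopy.
Context d {T : measurableType d} {R : realType} (nu : {measure set T -> \bar R}).
Hypothesis fin : (nu setT < +oo)%E.

(** The finiteness proof is an argument, so that this constant can carry the
    structure of finite measure that a bare measure lacks. *)
Definition finite_copy & (nu setT < +oo)%E : set T -> \bar R := nu.

Let copy0 : finite_copy fin set0 = 0%E. Proof. exact: measure0. Qed.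
Let copy_ge0 A : (0 <= finite_copy fin A)%E. Proof. exact: measure_ge0. Qed.
Let copy_sigma : semi_sigma_additive (finite_copy fin).
Proof. exact: measure_semi_sigma_additive. Qed.

HB.instance Definition _ := isMeasure.Build _ T R (finite_copy fin)
  copy0 copy_ge0 copy_sigma.

Let copy_fin : fin_num_fun (finite_copy fin).
Proof.
move=> A mA; rewrite ge0_fin_numE//; apply: le_lt_trans fin.
by apply: le_measure; rewrite ?inE.
Qed.

HB.instance Definition _ := @Measure_isFinite.Build _ T R (finite_copy fin) copy_fin.

Lemma pack_finite :
  exists nu' : {finite_measure set T -> \bar R}, nu = nu' :> {measure set T -> \bar R}.
Proof. by exists (finite_copy fin); exact: eq_measure. Qed.
End FiniteCopy.

Section SigmaFiniteCopy.
Context d {T : measurableType d} {R : realType} (nu : {measure set T -> \bar R}).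
Hypothesis sf : sigma_finite [set: T] nu.

(** As [finite_copy], for sigma-finiteness. *)
Definition sigma_finite_copy & sigma_finite [set: T] nu : set T -> \bar R := nu.

Let copy0 : sigma_finite_copy sf set0 = 0%E. Proof. exact: measure0. Qed.
Let copy_ge0 A : (0 <= sigma_finite_copy sf A)%E. Proof. exact: measure_ge0. Qed.
Let copy_sigma : semi_sigma_additive (sigma_finite_copy sf).
Proof. exact: measure_semi_sigma_additive. Qed.

HB.instance Definition _ := isMeasure.Build _ T R (sigma_finite_copy sf)
  copy0 copy_ge0 copy_sigma.
HB.instance Definition _ := @Measure_isSigmaFinite.Build _ T R (sigma_finite_copy sf) sf.

Lemma pack_sigma_finite :
  exists nu' : {sigma_finite_measure set T -> \bar R}, nu = nu' :> {measure set T -> \bar R}.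
Proof. by exists (sigma_finite_copy sf); exact: eq_measure. Qed.
End SigmaFiniteCopy.

Section MeasureDensity.
Context dT {T : measurableType dT} {R : realType}.
Implicit Types (m nu : {measure set T -> \bar R}).

(** [g] is a Radon-Nikodym derivative of [m] by uniqueness, so this is the
    change of variables for Radon-Nikodym derivatives. *)
Lemma Rint_measure_density m nu (g phi : T -> R) (M : R) :
  (m setT < +oo)%E -> sigma_finite setT nu -> intR nu g ->
  (forall A, measurable A -> m A = (\int[nu]_(x in A) (g x)%:E)%E) ->
  measurable_fun setT phi -> (forall x, `|phi x| <= M) ->
  \int[m]_x phi x = \int[nu]_x (phi x * g x).
Proof.
move=> mfin sf; move: (mfin) => /pack_finite[m' em].
move: sf => /pack_sigma_finite[nu' enu]; subst m nu => ig mE mphi phiM.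
have dom : m' `<< nu'.
  apply/null_content_dominatesP => A mA A0; rewrite mE//.
  by apply: null_set_integral => //; apply/measurable_EFinP/measurable_funTS/intR_measurable/ig.
have ip : m'.-integrable setT (EFin \o phi).
  by apply: (@intR_bounded _ _ _ _ _ M).
rewrite /Rintegral -(Radon_Nikodym_change_of_variables dom measurableT ip).
congr fine; apply: ae_eq_integral => //.
- by apply: emeasurable_funM => //; apply/measurable_EFinP.
- by apply/measurable_EFinP/measurable_funM => //; exact: intR_measurable ig.
- have : ae_eq nu' setT (Radon_Nikodym (charge_of_finite_measure m') nu') (EFin \o g).
    have rni := Radon_Nikodym_integrable (dom : charge_of_finite_measure m' `<< nu').
    apply: integral_ae_eq => //.
    + by apply/measurable_EFinP; exact: intR_measurable ig.
    + move=> E _ mE0; rewrite -Radon_Nikodym_integral//.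
      by rewrite -mE.
  by apply: filterS => x /= -> //; rewrite EFinM.
Qed.

End MeasureDensity.

Section Charges.
Context {R : realType} {d : nat}.
Implicit Types (f : {charge set (borel R d) -> \bar R}).
Implicit Types (nu m : {measure set (borel R d) -> \bar R}).
Local Notation T := (borel R d).
(** A copy that carries the structure of measure. *)
Definition tv f : {measure set T -> \bar R} := Defs.total_variation f.

Lemma hahnP_measurable f : measurable (projT1 (cid (hahn_exists f))).1 /\
  measurable (projT1 (cid (hahn_exists f))).2.
Proof. by case: (hahnP f) => [[mP _] [mN _] _ _]. Qed.

Let jposE f A : measurable A ->
  jordan_pos (hahnP f) A = f (A `&` (projT1 (cid (hahn_exists f))).1).
Proof. by move=> mA; rewrite jordan_posE cjordan_posE /crestr0 mem_set. Qed.

Let jnegE f A : measurable A ->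
  jordan_neg (hahnP f) A = (- f (A `&` (projT1 (cid (hahn_exists f))).2))%E.
Proof. by move=> mA; rewrite jordan_negE cjordan_negE /crestr0 mem_set. Qed.

Lemma total_variation_fin f : (tv f setT < +oo)%E.
Proof.
by rewrite /tv /Defs.total_variation /charge_variation /= lte_add_pinfty// -ge0_fin_numE// fin_num_measure.
Qed.

Let tvE f B : measurable B -> tv f B =
  (f (B `&` (projT1 (cid (hahn_exists f))).1) -
   f (B `&` (projT1 (cid (hahn_exists f))).2))%E.
Proof. by move=> mB; exact: (congr2 adde (jposE f mB) (jnegE f mB)). Qed.

Let jpos_fin f : (jordan_pos (hahnP f) setT < +oo)%E.
Proof. by rewrite -ge0_fin_numE// fin_num_measure. Qed.

Let jneg_fin f : (jordan_neg (hahnP f) setT < +oo)%E.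
Proof. by rewrite -ge0_fin_numE// fin_num_measure. Qed.

(** On a Hahn decomposition [(P, N)] of [f], the Jordan parts have densities
    [\1_P * g] and [- \1_N * g]. *)
Lemma charge_integral_density f nu (g phi : T -> R) (M : R) :
  sigma_finite setT nu -> intR nu g ->
  (forall A, measurable A -> f A = (\int[nu]_(x in A) (g x)%:E)%E) ->
  measurable_fun setT phi -> (forall x, `|phi x| <= M) ->
  charge_integral f phi = \int[nu]_x (g x * phi x).
Proof.
move=> sf ig fE mphi phiM.
have [mP mN] := hahnP_measurable f.
have [_ _ PN PN0] := hahnP f.
set P := (projT1 _).1 in mP PN PN0; set N := (projT1 _).2 in mN PN PN0.
have igP : intR nu (fun x => \1_P x * g x).
  by apply: (@intRM _ _ _ _ _ _ 1) => //; exact: indic_bound.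
have igN : intR nu (fun x => \1_N x * - g x).
  apply: (@intRM _ _ _ _ _ _ 1) => //; first exact: indic_bound.
  by have := intRZ (-1) ig; under eq_fun do rewrite mulN1r.
have intE (A B : set T) (h : T -> R) : measurable A -> measurable B ->
    (\int[nu]_(x in A `&` B) (h x)%:E = \int[nu]_(x in A) (\1_B x * h x)%:E)%E.
  move=> mA mB; rewrite integral_mkcondr; apply: eq_integral => x _.
  by rewrite patchE indicE; case: ifP => _; rewrite ?mul1r ?mul0r.
rewrite /charge_integral.
rewrite (@Rint_measure_density _ _ _ (jordan_pos (hahnP f)) nu (fun x => \1_P x * g x) _ M)//; last 2 first.
  exact: jpos_fin.
  by move=> A mA; apply: (etrans (jposE f mA)); rewrite fE ?intE//; exact: measurableI.
rewrite (@Rint_measure_density _ _ _ (jordan_neg (hahnP f)) nu (fun x => \1_N x * - g x) _ M)//; last 2 first.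
  exact: jneg_fin.
  move=> A mA; apply: (etrans (jnegE f mA)).
  rewrite fE ?intE//; last exact: measurableI.
  rewrite -mulN1e -integralZl//.
    by apply: eq_integral => x _; rewrite -EFinM mulN1r mulrN.
  apply: (integrableS measurableT) => //.
  by apply: (@intRM _ _ _ _ _ _ 1) => //; exact: indic_bound.
rewrite -RintegralB//.
- apply: eq_Rintegral => x _; rewrite !indicE.
  have : (P `|` N) x by rewrite PN.
  have [xP|xP] := boolP (x \in P); have [xN|xN] := boolP (x \in N).
  + have : (P `&` N) x by split; exact/set_mem.
    by rewrite PN0.
  + by rewrite !mul0r mulr0 subr0 mul1r mulrC.
  + by rewrite !mul0r mulr0 sub0r mul1r mulrN opprK mulrC.
  + by case; move/mem_set => h; [rewrite h in xP|rewrite h in xN].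
- by apply: (@intRM _ _ _ _ _ _ M).
- by apply: (@intRM _ _ _ _ _ _ M).
Qed.

(** The polar decomposition of a charge: [k] is 1 on the positive set and -1 on
    the negative one. *)
Lemma charge_polar f : exists k : T -> R,
  [/\ measurable_fun setT k, forall x, `|k x| <= 1 &
   forall A, measurable A -> f A = (\int[tv f]_(x in A) (k x)%:E)%E].
Proof.
have [mP mN] := hahnP_measurable f.
have [_ _ PN PN0] := hahnP f.
set P := (projT1 _).1 in mP PN PN0; set N := (projT1 _).2 in mN PN PN0.
exists (fun x => \1_P x - \1_N x); split.
- by apply: measurable_funB.
- move=> x; rewrite !indicE.
  by case: (x \in P); case: (x \in N); rewrite ?subrr ?subr0 ?sub0r ?normrN ?normr0 ?normr1.
- move=> A mA; under eq_integral do rewrite EFinB.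
  have iB B : measurable B -> (tv f).-integrable A (fun x => (\1_B x)%:E).
    move=> mB; apply: (integrableS measurableT) => //.
    apply: (@intR_bounded _ _ _ _ _ 1) => //; first exact: total_variation_fin.
    exact: indic_bound.
  rewrite integralB//; [|exact: iB..].
  rewrite !integral_indic//.
  rewrite !tvE; [|exact: measurableI..].
  rewrite -/P -/N.
  have e1 : P `&` A `&` N = set0 by rewrite setIAC PN0 set0I.
  have e2 : N `&` A `&` P = set0 by rewrite setIAC [N `&` P]setIC PN0 set0I.
  rewrite e1 e2 !charge0 sube0 sub0e oppeK setIAC setIid [N `&` A `&` N]setIAC setIid.
  rewrite -chargeU//; [|exact: measurableI|exact: measurableI|].
    by rewrite -setIUl PN setTI.
  by rewrite setIACA PN0 set0I.
Qed.

Lemma charge_integral_polar f : exists k : T -> R,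
  [/\ measurable_fun setT k, forall x, `|k x| <= 1,
   forall A, measurable A -> f A = (\int[tv f]_(x in A) (k x)%:E)%E &
   forall (phi : T -> R) M, measurable_fun setT phi -> (forall x, `|phi x| <= M) ->
     charge_integral f phi = \int[tv f]_x (k x * phi x)].
Proof.
have [k [mk k1 fE]] := charge_polar f; exists k; split => // phi M mphi phiM.
apply: (@charge_integral_density _ _ _ _ M) => //.
- by apply: fin_num_fun_sigma_finite; [rewrite measure0|move=> A mA; exact: fin_num_measure].
- exact: (intR_bounded (total_variation_fin f) mk k1).
Qed.

Lemma charge_integral_le f (phi : T -> R) M : measurable_fun setT phi ->
  (forall x, `|phi x| <= M) ->
  `|charge_integral f phi| <= M * fine (tv f setT).
Proof.
move=> mphi phiM; have [k [mk k1 _ kE]] := charge_integral_polar f.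
rewrite (kE _ M)//.
rewrite -Rintegral_cst//; apply: Rint_norm_le.
- exact: measurable_funM.
- apply: (@intR_bounded _ _ _ _ _ `|M|) => //; exact: total_variation_fin.
- by move=> x; rewrite normrM -[leRHS]mul1r ler_pM.
Qed.

(** The total variation of [B] is a difference of values of [f] at two subsets
    of [B], those cut out by a Hahn decomposition. *)
Lemma tv_null f (B : set T) : measurable B ->
  (forall A, measurable A -> A `<=` B -> f A = 0%E) -> tv f B = 0%E.
Proof.
move=> mB fB; have [mP mN] := hahnP_measurable f.
rewrite tvE// !fB ?sube0//; exact: measurableI.
Qed.

Definition far (r : R) : set T := [set x : 'rV[R]_d | r < `|x|].

Lemma far_measurable r : measurable (far r).
Proof.
apply: open_borel; apply: (@open_comp _ _ (@Num.norm R 'rV[R]_d) [set t : R | r < t]).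
  by move=> x _; exact: norm_continuous.
exact: open_gt.
Qed.

(** The first moment is finite because the norm is bounded where the total
    variation lives. *)
Lemma M01_bounded f (r : R) : f setT = 0%E ->
  (forall A, measurable A -> A `<=` far r -> f A = 0%E) -> M01 f.
Proof.
move=> f0 fr; split => //.
have tB := tv_null (far_measurable r) fr.
apply: (@le_lt_trans _ _ (\int[tv f]_x (Num.sqrt d%:R * `|r|)%:E)%E).
  apply: ae_ge0_le_integral => //.
  - by move=> x _; rewrite lee_fin enorm_ge0.
  - by apply/measurable_EFinP; exact: enorm_measurable.
  - exists (far r); split => //; first exact: far_measurable.
    move=> x /= h; rewrite /far /= ltNge; apply/negP => xr; apply: h => _.
    rewrite lee_fin; apply: (le_trans (enorm_le_norm x)).
    have {}xr := le_trans xr (ler_norm r).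
    by rewrite ler_wpM2l// sqrtr_ge0.
rewrite integral_cst//= lte_mul_pinfty//; last exact: total_variation_fin.
Qed.

End Charges.

(** * Existence of essential unions *)

Section Exhaustion.
Context d {T : measurableType d} {R : realType}.

Lemma null_bigcup (mu : {measure set T -> \bar R}) (F : nat -> set T) :
  (forall n, measurable (F n)) -> (forall n, mu (F n) = 0%E) ->
  mu (\bigcup_n F n) = 0%E.
Proof.
move=> mF F0; apply/negligibleP; first exact: bigcupT_measurable.
by apply: negligible_bigcup => n; apply/negligibleP; [exact: mF|exact: F0].
Qed.

(** Take a countable union of members whose measure is the supremum over all
    such unions: a member leaving some mass outside would increase it. *)
Lemma finite_exhaustion (nu : {measure set T -> \bar R}) (C : set (set T)) :
  (nu setT < +oo)%E -> (forall A, C A -> measurable A) -> C !=set0 ->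
  exists2 A : nat -> set T, forall n, C (A n) &
    forall B, C B -> nu (B `\` \bigcup_n A n) = 0%E.
Proof.
move=> fin mC [A0 CA0].
have finA A : measurable A -> nu A \is a fin_num.
  move=> mA; rewrite ge0_fin_numE//; apply: le_lt_trans fin.
  by apply: le_measure; rewrite ?inE.
pose S := [set r : R | exists2 A : nat -> set T, forall n, C (A n) &
  r = fine (nu (\bigcup_n A n))].
have mU (A : nat -> set T) : (forall n, C (A n)) -> measurable (\bigcup_n A n).
  by move=> CA; apply: bigcupT_measurable => n; exact: mC.
have S0 : S !=set0 by exists (fine (nu (\bigcup_(n : nat) A0))), (fun=> A0).
have Sub : has_ubound S.
  exists (fine (nu setT)) => _ [A CA ->].
  rewrite fine_le ?finA//; last by apply: le_measure; rewrite ?inE//; exact: mU.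
  exact: mU.
have hS : has_sup S by [].
have /choice[A HA] : forall k : nat, exists A : nat -> set T, (forall n, C (A n)) /\
    sup S - k.+1%:R^-1 < fine (nu (\bigcup_n A n)).
  move=> k; have k0 : 0 < k.+1%:R^-1 :> R by rewrite invr_gt0.
  by have [_ [A CA ->] h] := sup_adherent k0 hS; exists A.
pose p (n : nat) : nat * nat := odflt (0, 0)%N (unpickle n).
pose D n := A (p n).1 (p n).2.
have CD n : C (D n) by exact: (HA _).1.
exists D => // B CB.
(* adding [B] in front of the sequence competes for the supremum *)
pose D' n := if n is n'.+1 then D n' else B.
have CD' n : C (D' n) by case: n => [|n] //=.
have AD k : \bigcup_n A k n `<=` \bigcup_n D n.
  move=> x [n _ Ax]; exists (pickle (k, n)) => //.
  by rewrite /D /p pickleK.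
have e : \bigcup_n D' n = \bigcup_n D n `|` (B `\` \bigcup_n D n).
  apply/seteqP; split => x.
    move=> [[|n] _ /= h]; last by left; exists n.
    by have [h'|h'] := pselect ((\bigcup_n D n) x); [left|right].
  by move=> [[n _ h]|[h _]]; [exists n.+1|exists 0%N].
have mB := mC _ CB; have mD := mU _ CD.
have mBD : measurable (B `\` \bigcup_n D n) by exact: measurableD.
have : fine (nu (\bigcup_n D' n)) <= sup S.
  by apply: ub_le_sup => //; exists D'.
rewrite e measureU//; last by rewrite setDE setICA setICr setI0.
rewrite fineD ?finA// => h.
have supD : sup S <= fine (nu (\bigcup_n D n)).
  apply/ler_addgt0Pr => eps eps0.
  have [k Hk] := ltr_add_invr eps0; rewrite add0r in Hk.
  rewrite -lerBlDr; apply: le_trans (_ : fine (nu (\bigcup_n A k n)) <= _).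
    have /ltW := (HA k).2; apply: le_trans; rewrite lerD2l lerN2; exact: ltW.
  apply: fine_le; rewrite ?finA//; first exact/mU/(HA k).1.
  by apply: le_measure; rewrite ?inE//; exact/mU/(HA k).1.
have : fine (nu (B `\` \bigcup_n D n)) <= 0 by lra.
rewrite -lee_fin fineK ?finA// => h0; apply/eqP; rewrite eq_le h0 /=.
exact: measure_ge0.
Qed.

Lemma sigma_finite_exhaustion (mu : {measure set T -> \bar R}) (C : set (set T)) :
  sigma_finite setT mu -> (forall A, C A -> measurable A) -> C !=set0 ->
  exists2 A : nat -> set T, forall n, C (A n) &
    forall B, C B -> mu (B `\` \bigcup_n A n) = 0%E.
Proof.
move=> [F FT Ffin] mC C0.
have /choice[A HA] : forall k : nat, exists A : nat -> set T, (forall n, C (A n)) /\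
    forall B, C B -> mu ((B `\` \bigcup_n A n) `&` F k) = 0%E.
  move=> k; have [mF Fk] := Ffin k.
  have [|//|//|A CA HA] := @finite_exhaustion (mrestr mu mF) C.
    by change (mu (setT `&` F k) < +oo)%E; rewrite setTI.
  by exists A.
pose p (n : nat) : nat * nat := odflt (0, 0)%N (unpickle n).
pose D n := A (p n).1 (p n).2.
exists D => [n|B CB]; first exact: (HA _).1.
have AD k : \bigcup_n A k n `<=` \bigcup_n D n.
  move=> x [n _ Ax]; exists (pickle (k, n)) => //.
  by rewrite /D /p pickleK.
have mU k : measurable ((B `\` \bigcup_n A k n) `&` F k).
  apply: measurableI; last exact: (Ffin k).1.
  apply: measurableD; first exact: mC.
  by apply: bigcupT_measurable => n; apply/mC/(HA k).1.
apply/eqP; rewrite eq_le measure_ge0 andbT.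
apply: (@le_trans _ _ (mu (\bigcup_k ((B `\` \bigcup_n A k n) `&` F k)))).
  apply: le_measure; rewrite ?inE.
  - apply: measurableD; first exact: mC.
    by apply: bigcupT_measurable => n; apply/mC/(HA _).1.
  - exact: bigcupT_measurable.
  - move=> x [Bx nx]; have : setT x by []. rewrite FT => -[k _ Fx]; exists k => //.
    by split => //; split => // /AD.
rewrite null_bigcup// => k; exact: (HA k).2.
Qed.

End Exhaustion.

Section EssentialUnion.
Context {R : realType} {d : nat}.
Implicit Types (mu : {measure set (borel R d) -> \bar R}).
Implicit Types (sigma : 'rV[R]_d -> 'rV[R]_d).
Local Notation T := (borel R d).

Lemma radon_sigma_finite mu : radon mu -> sigma_finite setT mu.
Proof.
move=> rmu; exists (fun n : nat => [set x : 'rV[R]_d | `|x| <= n%:R]).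
  apply/seteqP; split => // x _.
  have [n Hn] : exists n : nat, `|x : 'rV[R]_d| <= n%:R.
    exists (Num.bound `|x : 'rV[R]_d|); apply: ltW.
    by have := archi_boundP (normr_ge0 (x : 'rV[R]_d)).
  by exists n.
move=> n; have cl : closed [set x : 'rV[R]_d | `|x| <= n%:R].
  apply: (@closed_comp _ _ (@Num.norm R 'rV[R]_d) [set t : R | t <= n%:R]).
    by move=> x _; exact: norm_continuous.
  exact: closed_le.
split; first exact: closed_borel.
apply/rmu/bounded_closed_compact => //.
exists n%:R; split; first exact: num_real.
by move=> M nM x /= xn; exact: (le_trans xn (ltW nM)).
Qed.

Definition vec_measurable sigma :=
  forall i : 'I_d, measurable_fun [set: T] (fun x : T => sigma x 0 i).

Lemma vec_measurable_preimage sigma (U : set 'rV[R]_d) : vec_measurable sigma ->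
  open U -> measurable (sigma @^-1` U : set T).
Proof.
move=> ms oU; rewrite (open_rat_cubes oU) preimage_bigcup bigcup_mkcond.
apply: countable_bigcupT_measurable; first exact: countableP.
move=> p; case: ifP => _; last exact: measurable0.
have -> : sigma @^-1` rat_cube p = \bigcap_(i in [set: 'I_d])
    ((fun x : T => sigma x 0 i) @^-1`
     `]ratr (p.1 0 i) - p.2.+1%:R^-1, ratr (p.1 0 i) + p.2.+1%:R^-1[).
  apply/seteqP; split => x /= h.
    by move=> i _ /=; rewrite in_itv /=; exact: h.
  by move=> i; have := h i I; rewrite /= in_itv.
apply: fin_bigcap_measurable => // i _; rewrite -[X in measurable X]setTI.
by apply: ms => //; exact: measurable_itv.
Qed.

(** For each rational cube, a countable subfamily already sends to the cube
    almost every point that some member sends there ([sigma_finite_exhaustion]).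
    The closure of the values of the countably many fields so obtained is the
    essential union: the values of a member having a neighbourhood missed by all of
    them are taken on a null set only. *)
Lemma ess_union_exists mu (calW : set ('rV[R]_d -> 'rV[R]_d)) :
  sigma_finite setT mu -> calW !=set0 ->
  (forall sigma, calW sigma -> vec_measurable sigma) ->
  is_ess_union mu calW (ess_union mu calW).
Proof.
move=> sf [s0 Ws0] mW; rewrite /ess_union; apply: xgetPex.
have /choice[A HA] : forall p : 'rV[rat]_d * nat, exists s : nat -> 'rV[R]_d -> 'rV[R]_d,
    (forall n, calW (s n)) /\ forall sigma, calW sigma ->
     mu ((sigma @^-1` rat_cube p) `\` \bigcup_n (s n @^-1` rat_cube p)) = 0%E.
  move=> p; pose C := [set B : set T | exists2 sigma, calW sigma & B = sigma @^-1` rat_cube p].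
  have [||A CA HA] := @sigma_finite_exhaustion _ _ _ mu C sf.
  - move=> _ [sigma /mW ms ->]; apply: vec_measurable_preimage => //; exact: box_open.
  - by exists (s0 @^-1` rat_cube p), s0.
  have /choice[s Hs] : forall n, exists s, calW s /\ A n = s @^-1` rat_cube p.
    by move=> n; have [s Ws e] := CA n; exists s.
  exists s; split=> [n|sigma Wsigma]; first exact: (Hs n).1.
  have <- : \bigcup_n A n = \bigcup_n (s n @^-1` rat_cube p).
    by apply: eq_bigcup => // n _; exact: (Hs n).2.
  by apply: HA; exists sigma.
pose q (n : nat) : ('rV[rat]_d * nat) * nat := odflt (0, 0%N, 0%N) (unpickle n).
pose s n := A (q n).1 (q n).2.
have Ws n : calW (s n) by exact: (HA _).1.
pose W (x : 'rV[R]_d) := closure (range (fun n => s n x)).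
exists W; split; first split.
- by move=> x; exact: closed_closure.
- move=> U oU.
  have -> : [set x | W x `&` U !=set0] = \bigcup_n (s n @^-1` U).
    apply/seteqP; split => x /=.
      move=> [y [Wy Uy]]; have [_ [[n _ <-] Usn]] := Wy U (open_nbhs_nbhs (conj oU Uy)).
      by exists n.
    move=> [n _ Usn]; exists (s n x); split => //.
    by apply: subset_closure; exists n.
  exists (\bigcup_n (s n @^-1` U)).
    by apply: bigcupT_measurable => n; apply: vec_measurable_preimage => //; exact: mW.
  by rewrite setDv setU0; exact: negligible_set0.
- move=> sigma Wsigma.
  exists (\bigcup_n ((sigma @^-1` rat_cube (q n).1) `\`
       \bigcup_k (A (q n).1 k @^-1` rat_cube (q n).1))); split.
  + apply: bigcupT_measurable => n; apply: measurableD.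
      by apply: vec_measurable_preimage; [exact: mW|exact: box_open].
    apply: bigcupT_measurable => k; apply: vec_measurable_preimage; last exact: box_open.
    by apply: mW; exact: (HA _).1.
  + apply: null_bigcup => n; last exact: (HA _).2.
    apply: measurableD.
      by apply: vec_measurable_preimage; [exact: mW|exact: box_open].
    apply: bigcupT_measurable => k; apply: vec_measurable_preimage; last exact: box_open.
    by apply: mW; exact: (HA _).1.
  + move=> x /= nW; apply: contrapT => nN; apply: nW => O.
    rewrite nbhsE => -[U [oU Us] UO].
    have [p [ps pU]] := rat_cube_nbhs oU Us.
    have [k Hk] : exists k, rat_cube p (A p k x).
      apply: contrapT => nk; apply: nN; exists (pickle (p, 0%N)) => //.
      rewrite /q pickleK /=; split => // -[k _ Hk].
      by apply: nk; exists k.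
    exists (A p k x); split; last exact/UO/pU.
    by exists (pickle (p, k)) => //; rewrite /s /q pickleK.
- move=> W' [clW' _ selW'].
  have H n : {ae mu, forall x, W' x (s n x)} by exact: selW'.
  have : {ae mu, forall x, forall n, W' x (s n x)} by exact: ae_foralln.
  move=> [N [mN N0 HN]]; exists N; split => //; apply: subset_trans HN => x /= h Hx.
  apply: h => y Wy.
  rewrite (closure_id (W' x)).1//; move: Wy; apply: closure_subset.
  by move=> _ [n _ <-].
Qed.

Lemma ess_union_sub mu (calW : set ('rV[R]_d -> 'rV[R]_d)) (W : 'rV[R]_d -> set 'rV[R]_d) :
  sigma_finite setT mu -> calW !=set0 ->
  (forall sigma, calW sigma -> vec_measurable sigma) ->
  closed_selectable mu calW W ->
  {ae mu, forall x, ess_union mu calW x `<=` W x}.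
Proof. by move=> sf W0 mW; have [_] := ess_union_exists sf W0 mW; exact. Qed.

End EssentialUnion.

(** * Extension of functionals dominated by the supremum *)

Section HahnBanach.
Context {R : realType} {X : Type}.
Implicit Types (h k : X -> R) (G : set ((X -> R) * R)).

Definition bounded_real h := exists M : R, forall x, `|h x| <= M.

Lemma bounded_realD a h k : bounded_real h -> bounded_real k ->
  bounded_real (fun x => a * h x + k x).
Proof.
move=> [M hM] [N kN]; exists (`|a| * M + N) => x.
apply: (le_trans (ler_normD _ _)); apply: lerD => //.
by rewrite normrM ler_wpM2l.
Qed.

(** Partial linear functionals are encoded by their graphs, so that the union of
    a chain is again a candidate. The last clause is domination by the supremum,
    expressed through upper bounds [M] to avoid empty suprema. *)
Definition dominated_graph G := [/\ G ((fun=> 0), 0),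
  forall a p q, G p -> G q -> G ((fun x => a * p.1 x + q.1 x), a * p.2 + q.2),
  forall p, G p -> bounded_real p.1 &
  forall p M, G p -> (forall x, p.1 x <= M) -> p.2 <= M].

(** One-dimensional extension: [a] is a value at [h0] separating the lower
    bounds [p.2 - M] from the upper bounds [N - q.2]. *)
Lemma dominated_graph_extend G h0 : dominated_graph G -> bounded_real h0 ->
  exists2 G', dominated_graph G' & G `<=` G' /\ exists r, G' (h0, r).
Proof.
move=> [G0 Glin Gbd Gdom] [M0 bh0].
pose S := [set s : R | exists p (M : R), [/\ G p, forall x, p.1 x - h0 x <= M & s = p.2 - M]].
have key p (M : R) q (N : R) : G p -> G q -> (forall x, p.1 x - h0 x <= M) ->
    (forall x, q.1 x + h0 x <= N) -> p.2 - M <= N - q.2.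
  move=> Gp Gq pM qN; have /= H := Gdom _ (M + N) (Glin 1 p q Gp Gq).
  have : 1 * p.2 + q.2 <= M + N.
    by apply: H => x; have := pM x; have := qN x; lra.
  lra.
have S0 : S !=set0.
  exists (0 - M0), ((fun=> 0), 0), M0; split => // x /=.
  by have := bh0 x; rewrite ler_norml => /andP[]; lra.
have hS : has_sup S.
  split=> //; exists (M0 - 0) => _ [p [M [Gp pM ->]]].
  apply: (key p M ((fun=> 0), 0) M0) => // x /=.
  by have := bh0 x; rewrite ler_norml => /andP[]; lra.
pose a := sup S.
have aL p (M : R) : G p -> (forall x, p.1 x - h0 x <= M) -> p.2 - M <= a.
  by move=> Gp pM; apply: ub_le_sup; [exact: hS.2|exists p, M].
have aR q (N : R) : G q -> (forall x, q.1 x + h0 x <= N) -> a <= N - q.2.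
  move=> Gq qN; apply: ge_sup => // _ [p [M [Gp pM ->]]].
  exact: key.
exists [set u | exists t p, G p /\ u = ((fun x => t * h0 x + p.1 x), t * a + p.2)].
  split.
  - exists 0, ((fun=> 0), 0); split => //.
    by congr pair; [apply/funext => x /=; rewrite mul0r addr0|rewrite mul0r addr0].
  - move=> b _ _ [t [p [Gp ->]]] [s [q [Gq ->]]].
    exists (b * t + s), ((fun x => b * p.1 x + q.1 x), b * p.2 + q.2); split.
      exact: Glin.
    by congr pair; [apply/funext => x /=; ring|rewrite /=; ring].
  - move=> _ [t [p [Gp ->]]] /=; apply: bounded_realD; last exact: Gbd.
    by exists M0.
  - move=> _ M [t [p [Gp ->]]] /= HM.
    have scal c : G ((fun x => c * p.1 x), c * p.2).
      have := Glin c p _ Gp G0; rewrite /= addr0.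
      by rewrite (_ : (fun x => _ + 0) = (fun x => c * p.1 x))//; apply/funext => x; rewrite addr0.
    have [t0|t0|t0] := ltrgtP t 0.
    + have /= := aL _ (- t^-1 * M) (scal (- t^-1)).
      have tn : 0 < - t^-1 by rewrite oppr_gt0 invr_lt0.
      have H : forall x, - t^-1 * p.1 x - h0 x <= - t^-1 * M.
        move=> x; have := HM x; rewrite -(ler_pM2l tn).
        by rewrite mulrDr mulrA mulNr mulVf ?lt_eqF// mulN1r addrC.
      move=> /(_ H); rewrite -mulrBr => H'.
      have : (- t) * (- t^-1 * (p.2 - M)) <= (- t) * a by rewrite ler_pM2l ?oppr_gt0.
      by rewrite mulrA mulrNN mulfV ?lt_eqF// mul1r; lra.
    + have /= := aR _ (t^-1 * M) (scal t^-1).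
      have tn : 0 < t^-1 by rewrite invr_gt0.
      have H : forall x, t^-1 * p.1 x + h0 x <= t^-1 * M.
        move=> x; have := HM x; rewrite -(ler_pM2l tn).
        by rewrite mulrDr mulrA mulVf ?gt_eqF// mul1r addrC.
      move=> /(_ H); rewrite -mulrBr => H'.
      have : t * a <= t * (t^-1 * (M - p.2)) by rewrite ler_pM2l.
      by rewrite mulrA mulfV ?gt_eqF// mul1r; lra.
    + rewrite t0 mul0r add0r; apply: (Gdom p) => // x.
      by have := HM x; rewrite t0 mul0r add0r.
split.
  move=> p Gp; exists 0, p; split => //; rewrite [LHS]surjective_pairing.
  by congr pair; [apply/funext => x /=; rewrite mul0r add0r|rewrite mul0r add0r].
exists a, 1, ((fun=> 0), 0); split => //.
by congr pair; [apply/funext => x /=; rewrite mul1r addr0|rewrite mul1r addr0].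
Qed.

(** Domination by the supremum gives positivity, and extending to all bounded
    functions, continuous or not, makes the indicators of sets available to the
    construction of a measure. *)
Lemma hahn_banach_sup (G0 : set ((X -> R) * R)) : dominated_graph G0 ->
  exists L : (X -> R) -> R,
    [/\ forall a h k, bounded_real h -> bounded_real k ->
          L (fun x => a * h x + k x) = a * L h + L k,
        forall h M, bounded_real h -> (forall x, h x <= M) -> L h <= M &
        forall p, G0 p -> L p.1 = p.2].
Proof.
move=> dG0.
(* [G0] is joined to the sets of the chain, so that the empty chain has a bound *)
have [A [dA maxA]] : exists A, dominated_graph (A `|` G0) /\
    forall B, A `<` B -> ~ dominated_graph (B `|` G0).
  apply: (@Zorn_bigcup _ (fun A => dominated_graph (A `|` G0))) => F FP totF.
  have [F0|/set0P[A0 FA0]] := eqVneq F set0.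
    by rewrite F0 bigcup_set0 set0U.
  have in1 p : ((\bigcup_(A in F) A) `|` G0) p -> exists2 A, F A & (A `|` G0) p.
    by move=> [[A FA Ap]|G0p]; [exists A => //; left|exists A0 => //; right].
  have in2 A p : F A -> (A `|` G0) p -> ((\bigcup_(A in F) A) `|` G0) p.
    by move=> FA [Ap|G0p]; [left; exists A|right].
  split.
  - by right; case: dG0.
  - move=> a p q /in1[A FA Ap] /in1[B FB Bq].
    have [AB|BA] := totF _ _ FA FB.
      apply: (in2 B) => //; have [_ + _ _] := FP _ FB; apply => //.
      by case: Ap => Ap; [left; exact: AB|right].
    apply: (in2 A) => //; have [_ + _ _] := FP _ FA; apply => //.
    by case: Bq => Bq; [left; exact: BA|right].
  - by move=> p /in1[A FA Ap]; have [_ _ + _] := FP _ FA; exact.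
  - by move=> p M /in1[A FA Ap]; have [_ _ _ +] := FP _ FA; apply.
have dom h : bounded_real h -> exists r, (A `|` G0) (h, r).
  move=> bh; have [G' dG' [AG' [r G'r]]] := dominated_graph_extend dA bh.
  have G'E : (A `|` G') `|` G0 = G'.
    apply/seteqP; split => p; last by move=> ?; left; right.
    by case=> [[?|]|?] //; apply: AG'; [left|right].
  have [AG|nAG] := pselect ((A `|` G') `<=` A).
    by exists r; left; apply: AG; right.
  exfalso; apply: (maxA (A `|` G')); last by rewrite G'E.
  by split => // p Ap; left.
have [G00 Glin Gbd Gdom] := dA.
have uniq_r h r s : (A `|` G0) (h, r) -> (A `|` G0) (h, s) -> r = s.
  have le1 r' s' : (A `|` G0) (h, r') -> (A `|` G0) (h, s') -> r' <= s'.
    move=> Gr Gs; have /= H := Gdom _ 0 (Glin (-1) _ _ Gs Gr).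
    have : -1 * s' + r' <= 0 by apply: H => x; lra.
    lra.
  by move=> Gr Gs; apply/eqP; rewrite eq_le !le1.
pose L h := if pselect (bounded_real h) is left b then sval (cid (dom h b)) else 0.
have LG h : bounded_real h -> (A `|` G0) (h, L h).
  by move=> bh; rewrite /L; case: pselect => // b; case: cid.
exists L; split.
- move=> a h k bh bk; apply: (uniq_r (fun x => a * h x + k x)).
    by apply: LG; exact: bounded_realD.
  by have := Glin a (h, L h) (k, L k) (LG _ bh) (LG _ bk).
- by move=> h M bh hM; exact: (Gdom (h, L h) M (LG h bh) hM).
- move=> [h r] G0p /=; apply: (uniq_r h); last by right.
  by apply: LG; apply: (Gbd (h, r)); right.
Qed.

Lemma bounded_lin_sum (Lam : (X -> R) -> R)
    (Lam_lin : forall (a : R) h k, bounded_real h -> bounded_real k ->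
      Lam (fun x => a * h x + k x) = a * Lam h + Lam k)
    (I : Type) (s : seq I) (F : I -> X -> R) : (forall i, bounded_real (F i)) ->
  bounded_real (fun x => \sum_(i <- s) F i x) /\
  Lam (fun x => \sum_(i <- s) F i x) = \sum_(i <- s) Lam (F i).
Proof.
move=> bF; have b0 : bounded_real (fun _ : X => 0 : R) by exists 0 => x; rewrite normr0.
elim: s => [|i s [IH1 IH2]].
  rewrite big_nil; under eq_fun do rewrite big_nil; split => //.
  have := Lam_lin 1 _ _ b0 b0; under eq_fun do rewrite mulr0 addr0.
  lra.
have e : (fun x => \sum_(j <- i :: s) F j x) =
    (fun x => 1 * F i x + \sum_(j <- s) F j x).
  by apply/funext => x; rewrite big_cons mul1r.
rewrite e big_cons; split; first exact: bounded_realD.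
by rewrite Lam_lin// mul1r IH2.
Qed.

End HahnBanach.

(** * Riesz representation on the Euclidean space *)

Section RieszMeasure.
Context {R : realType} {d : nat}.
Local Notation E := 'rV[R]_d.
Variable P : set E -> R.
Hypothesis P0 : P set0 = 0.
Hypothesis P_le : forall A B : set E, A `<=` B -> P A <= P B.
Hypothesis PU : forall A B : set E, A `&` B = set0 -> P (A `|` B) = P A + P B.
Implicit Types (A B K U V X : set E).

Let P_ge0 A : 0 <= P A.
Proof. by rewrite -P0; exact: P_le. Qed.

Let PU_le A B : P (A `|` B) <= P A + P B.
Proof.
have -> : A `|` B = A `|` (B `\` A).
  apply/seteqP; split => x; last by move=> [|[]]; [left|right].
  by move=> [Ax|Bx]; [left|have [Ax|Ax] := pselect (A x); [left|right]].
rewrite PU; first by rewrite lerD2l P_le//; exact: subDsetl.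
by rewrite setDE setICA setICr setI0.
Qed.

Let P_bigU_le (F : nat -> set E) n :
  P (\big[setU/set0]_(i < n) F i) <= \sum_(i < n) P (F i).
Proof.
elim: n => [|n IH]; first by rewrite !big_ord0 P0.
rewrite !big_ord_recr /=; apply: (le_trans (PU_le _ _)); exact: lerD.
Qed.

Definition inner_content U : R := sup [set P K | K in [set K | compact K /\ K `<=` U]].

Let inner_has_sup U : has_sup [set P K | K in [set K | compact K /\ K `<=` U]].
Proof.
split; first by exists (P set0), set0 => //; split => //; exact: compact0.
by exists (P U) => _ [K [_ KU] <-]; exact: P_le.
Qed.

Let inner_ge K U : compact K -> K `<=` U -> P K <= inner_content U.
Proof. by move=> cK KU; apply: ub_le_sup; [exact: (inner_has_sup U).2|exists K]. Qed.

Let inner_le U (c : R) : (forall K, compact K -> K `<=` U -> P K <= c) ->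
  inner_content U <= c.
Proof.
move=> H; apply: ge_sup; first exact: (inner_has_sup U).1.
by move=> _ [K [cK KU] <-]; exact: H.
Qed.

Let inner_adherent U (e : R) : 0 < e ->
  exists K, [/\ compact K, K `<=` U & inner_content U - e < P K].
Proof.
move=> e0; have [_ [K [cK KU] <-] h] := sup_adherent e0 (inner_has_sup U).
by exists K.
Qed.

Let inner_mono U V : U `<=` V -> inner_content U <= inner_content V.
Proof. by move=> UV; apply: inner_le => K cK KU; apply: inner_ge => //; exact: subset_trans UV. Qed.

Let inner_ge0 U : 0 <= inner_content U.
Proof. by rewrite -P0; apply: inner_ge; [exact: compact0|]. Qed.

Let inner_leP U : inner_content U <= P U.
Proof. by apply: inner_le => K _; exact: P_le. Qed.

Let shrink U (e : R) : set E := [set x | forall y, `|x - y| < e -> U y].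

Let shrink_closed U e : 0 < e -> closed (shrink U e).
Proof.
move=> e0.
have -> : shrink U e = \bigcap_(y in ~` U) ~` ball y e.
  apply/seteqP; split => x /= H.
    move=> y Uy /= yx; apply: Uy; apply: H.
    by move: yx; rewrite -ball_normE /ball_ /= distrC.
  move=> y xy; apply: contrapT => /H /=; apply.
  by rewrite -ball_normE /ball_ /= distrC.
by apply: closed_bigI => y _; apply: open_closedC; exact: ball_open.
Qed.

(** Lebesgue numbers: a compact set covered by open sets is covered by finitely
    many of their shrunk versions, which are closed. *)
Let compact_shrink_cover K (F : nat -> set E) : compact K -> (forall n, open (F n)) ->
  K `<=` \bigcup_n F n ->
  exists N : nat, K `<=` \big[setU/set0]_(n < N.+1) shrink (F n) N.+1%:R^-1.
Proof.
move=> cK oF KF.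
pose O (m : nat) := \bigcup_(n in [set n | (n <= m)%N]) (shrink (F n) m.+1%:R^-1)^°.
have oO m : [set: nat] m -> open (O m).
  by move=> _; apply: bigcup_open => n _; exact: open_interior.
have KO : K `<=` cover [set: nat] O.
  move=> x /KF [n _ Fx].
  have /nbhs_ballP[e /= e0 eF] : nbhs x (F n) by exact: open_nbhs_nbhs.
  have e20 : 0 < e / 2 by rewrite divr_gt0.
  have [m0 Hm0] := ltr_add_invr e20; rewrite add0r in Hm0.
  pose m := maxn n m0; exists m => //; exists n; first exact: leq_maxl.
  have mm0 : m.+1%:R^-1 < e / 2.
    apply: le_lt_trans Hm0; rewrite lef_pV2 ?posrE// ler_nat ltnS; exact: leq_maxr.
  rewrite /interior; apply/nbhs_ballP; exists (e / 2) => //= y xy z yz.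
  apply: eF; rewrite -ball_normE /ball_ /= in xy *.
  rewrite -(subrKA y) [ltRHS]splitr; apply: le_lt_trans (ler_normD _ _) _.
  by apply: ltrD => //; exact: lt_trans mm0.
move: cK; rewrite compact_cover => /(_ _ _ _ oO KO)[D' _ KD'].
pose N := \max_(i <- finmap.enum_fset D') i.
exists N => x /KD' [m mD' [n /= nm /interior_subset xs]].
have mN : (m <= N)%N by apply: (@leq_bigmax_seq _ _ xpredT id).
rewrite -(bigcup_mkord N.+1 (fun n => shrink (F n) N.+1%:R^-1)).
exists n => /=; first by rewrite ltnS (leq_trans nm).
move=> y xy; apply: xs; apply: lt_le_trans xy _.
by rewrite lef_pV2 ?posrE// ler_nat ltnS.
Qed.

(** A compact subset of the union splits into finitely many compact pieces, each
    inside one of the open sets. *)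
Let inner_sigma_subadditive (F : nat -> set E) : (forall n, open (F n)) ->
  ((inner_content (\bigcup_n F n))%:E <= \sum_(n <oo) (inner_content (F n))%:E)%E.
Proof.
move=> oF.
have sum_ge0 : (0 <= \sum_(n <oo) (inner_content (F n))%:E)%E.
  by apply: nneseries_ge0 => n _ _; rewrite lee_fin.
have main K : compact K -> K `<=` \bigcup_n F n ->
    ((P K)%:E <= \sum_(n <oo) (inner_content (F n))%:E)%E.
  move=> cK KF; have [N KN] := compact_shrink_cover cK oF KF.
  apply: (@le_trans _ _ (\sum_(n < N.+1) (inner_content (F n))%:E)%E); last first.
    rewrite -(big_mkord xpredT (fun n => (inner_content (F n))%:E)).
    by apply: nneseries_lim_ge => n _ _; rewrite lee_fin.
  rewrite sumEFin lee_fin.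
  pose G n := K `&` shrink (F n) N.+1%:R^-1.
  apply: (@le_trans _ _ (P (\big[setU/set0]_(n < N.+1) G n))).
    apply: P_le => x Kx; move: (KN x Kx); rewrite -(bigcup_mkord N.+1 (fun n => shrink (F n) N.+1%:R^-1)) => -[n nN sx].
    by rewrite -(bigcup_mkord N.+1 G); exists n.
  apply: (le_trans (P_bigU_le _ _)); apply: ler_sum => n _.
  apply: inner_ge.
    by apply: compact_closedI => //; apply: shrink_closed.
  by move=> x [_ sx]; apply: sx; rewrite subrr normr0 invr_gt0.
move: sum_ge0 main; case: (\sum_(n <oo) _)%E => [s| |] // s0 main.
  by rewrite lee_fin; apply: inner_le => K cK KF; rewrite -lee_fin; exact: main.
by rewrite leey.
Qed.

Definition outer_content A : \bar R :=
  ereal_inf [set (inner_content U)%:E | U in [set U | open U /\ A `<=` U]].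

Let outer_le A U : open U -> A `<=` U -> (outer_content A <= (inner_content U)%:E)%E.
Proof. by move=> oU AU; apply: ereal_inf_lbound; exists U. Qed.

Let outer_ge0 A : (0 <= outer_content A)%E.
Proof. by apply: le_ereal_inf_tmp => _ [U _ <-]; rewrite lee_fin. Qed.

Let outer_mono A B : A `<=` B -> (outer_content A <= outer_content B)%E.
Proof.
move=> AB; apply: le_ereal_inf_tmp => _ [U [oU BU] <-].
by apply: outer_le => //; exact: subset_trans BU.
Qed.

Let outer0 : outer_content set0 = 0%E.
Proof.
apply/eqP; rewrite eq_le outer_ge0 andbT.
apply: (le_trans (outer_le open0 (@subset_refl _ _))).
by rewrite lee_fin -P0 inner_leP.
Qed.

Let outer_fin A : outer_content A \is a fin_num.
Proof.
rewrite ge0_fin_numE//; apply: (le_lt_trans (outer_le openT (@subsetT _ A))).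
exact: ltry.
Qed.

Let outer_open U : open U -> outer_content U = (inner_content U)%:E.
Proof.
move=> oU; apply/eqP; rewrite eq_le outer_le//=.
by apply: le_ereal_inf_tmp => _ [V [oV UV] <-]; rewrite lee_fin inner_mono.
Qed.

Let outer_adherent A (e : R) : 0 < e ->
  exists U, [/\ open U, A `<=` U & ((inner_content U)%:E <= outer_content A + e%:E)%E].
Proof.
move=> e0.
have [_ [U [oU AU] <-] h] := lb_ereal_inf_adherent e0 (outer_fin A).
by exists U; split => //; exact: ltW.
Qed.

Let outer_sigma_subadditive : sigma_subadditive outer_content.
Proof.
move=> F; apply/lee_addgt0Pr => e e0.
have e2 n : 0 < e / (2 ^ n.+1)%:R by rewrite divr_gt0// ltr0n expn_gt0.
have /choice[U HU] : forall n, exists U, [/\ open U, F n `<=` U &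
    ((inner_content U)%:E <= outer_content (F n) + (e / (2 ^ n.+1)%:R)%:E)%E].
  by move=> n; exact: outer_adherent.
apply: (@le_trans _ _ (\sum_(n <oo) (outer_content (F n) + (e / (2 ^ n.+1)%:R)%:E))%E); last first.
  exact: (epsilon_trick xpredT (fun n => outer_ge0 (F n)) (ltW e0)).
apply: (@le_trans _ _ (inner_content (\bigcup_n U n))%:E).
  apply: outer_le; first by apply: bigcup_open => n _; have [] := HU n.
  by apply: subset_bigcup => n _; have [] := HU n.
apply: le_trans (inner_sigma_subadditive _) _; first by move=> n; have [] := HU n.
apply: lee_nneseries => n _; first by rewrite lee_fin.
by have [] := HU n.
Qed.

HB.instance Definition _ := isOuterMeasure.Build R E outer_content
  outer0 outer_ge0 outer_mono outer_sigma_subadditive.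

(** Given [U] containing [X], a compact [K] almost exhausts [U `&` V] and a
    compact [L] almost exhausts [U `\` K]; they are disjoint, so finite
    additivity bounds the sum of their contents by that of [U]. *)
Let open_caratheodory V : open V -> outer_content.-caratheodory V.
Proof.
move=> oV; apply: le_caratheodory_measurable => X.
apply: le_ereal_inf_tmp => _ [U [oU XU] <-].
apply/lee_addgt0Pr => e e0.
have e20 : 0 < e / 2 by rewrite divr_gt0.
have [K [cK KUV hK]] := inner_adherent (U `&` V) e20.
have oUK : open (U `\` K).
  apply: openI => //; apply: closed_openC; exact: compact_closed.
have [L [cL LUK hL]] := inner_adherent (U `\` K) e20.
apply: (@le_trans _ _ ((inner_content (U `&` V))%:E + (inner_content (U `\` K))%:E)%E).
  apply: leeD; apply: outer_le => //; first exact: openI.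
    exact: setSI.
  by move=> x [Xx Vx]; split; [exact: XU|move=> /KUV[]].
rewrite -!EFinD lee_fin.
have : P (K `|` L) <= inner_content U.
  apply: inner_ge; first exact: compactU.
  by move=> x [/KUV[]|/LUK[]].
rewrite PU; first lra.
by apply/seteqP; split => // x [Kx /LUK[]].
Qed.

Let borel_caratheodory (A : set (borel R d)) : measurable A -> outer_content.-caratheodory A.
Proof.
have : sigma_algebra setT (outer_content.-caratheodory).
  split.
  - exact: caratheodory_measurable_set0.
  - by move=> B mB; rewrite setTD; exact: caratheodory_measurable_setC.
  - by move=> F mF; exact: caratheodory_measurable_bigcup.
by move=> sa; apply: smallest_sub => //; exact: open_caratheodory.
Qed.

(** The measure generated by a finitely additive content [P] on all subsets:
    [P] is made inner regular on open sets, then outer regular on all sets. The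
    properties of [P] are arguments so that the constant carries the structure
    of a measure. *)
Definition content_measure & P set0 = 0
    & (forall A B : set E, A `<=` B -> P A <= P B)
    & (forall A B : set E, A `&` B = set0 -> P (A `|` B) = P A + P B) :
  set (borel R d) -> \bar R := outer_content.

Local Notation cm := (content_measure P0 P_le PU).

Let cm0 : cm set0 = 0%E. Proof. exact: outer0. Qed.
Let cm_ge0 A : (0 <= cm A)%E. Proof. exact: outer_ge0. Qed.
Let cm_sigma : semi_sigma_additive cm.
Proof.
move=> F mF tF mUF.
apply: (@caratheodory_measure_sigma_additive R E outer_content F) => //.
- by move=> n; exact: borel_caratheodory.
- exact: borel_caratheodory.
Qed.

HB.instance Definition _ := isMeasure.Build _ (borel R d) R cm
  cm0 cm_ge0 cm_sigma.

Lemma content_measure_open U : open U -> (cm U <= (P U)%:E)%E.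
Proof. by move=> oU; rewrite /content_measure outer_open// lee_fin. Qed.

Lemma content_measure_compact K : compact K -> ((P K)%:E <= cm K)%E.
Proof.
move=> cK; apply: le_ereal_inf_tmp => _ [U [oU KU] <-].
by rewrite lee_fin inner_ge.
Qed.

End RieszMeasure.

Section Riesz.
Context {R : realType} {d : nat}.
Local Notation E := 'rV[R]_d.
Variable L : (E -> R) -> R.
Hypothesis L_lin : forall a h k, bounded_real h -> bounded_real k ->
  L (fun x => a * h x + k x) = a * L h + L k.
Hypothesis L_pos : forall h, bounded_real h -> (forall x, 0 <= h x) -> 0 <= L h.
Implicit Types (g h : E -> R) (A B K U : set E).

Let bounded_cst (c : R) : bounded_real (fun _ : E => c).
Proof. by exists `|c|. Qed.

Let L0 : L (fun=> 0) = 0.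
Proof.
have := L_lin 1 (bounded_cst 0) (bounded_cst 0).
rewrite (_ : (fun x : E => 1 * 0 + 0) = (fun=> 0)); last first.
  by apply/funext => x; rewrite mulr0 addr0.
lra.
Qed.

Let L_le h k : bounded_real h -> bounded_real k -> (forall x, h x <= k x) -> L h <= L k.
Proof.
move=> bh bk hk; have := L_lin (-1) bh bk.
have : 0 <= L (fun x => -1 * h x + k x).
  apply: L_pos; first exact: bounded_realD.
  by move=> x; rewrite mulN1r addrC subr_ge0.
by move=> + H; rewrite H; lra.
Qed.

Let bounded_indic A : bounded_real (\1_A : E -> R).
Proof. by exists 1 => x; exact: indic_bound. Qed.

Let P A : R := L (\1_A).

Let P0 : P set0 = 0.
Proof. by rewrite /P indic0. Qed.

Let P_le A B : A `<=` B -> P A <= P B.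
Proof.
move=> AB; apply: L_le => // x; rewrite !indicE ler_nat.
by have [/set_mem/AB/mem_set ->//|//] := boolP (x \in A).
Qed.

Let PU A B : A `&` B = set0 -> P (A `|` B) = P A + P B.
Proof.
move=> AB; rewrite /P -[X in X + _]mul1r -L_lin//.
congr L; apply/funext => x.
rewrite !indicE in_setU mul1r.
have [xA|xA] := boolP (x \in A); have [xB|xB] := boolP (x \in B); rewrite ?addr0 ?add0r//.
have : (A `&` B) x by split; exact/set_mem.
by rewrite AB.
Qed.

Let bounded_sum (n : nat) (F : nat -> E -> R) : (forall i, bounded_real (F i)) ->
  bounded_real (fun x => \sum_(i < n) F i x).
Proof.
by move=> bF; have [] := bounded_lin_sum L_lin (index_enum 'I_n) (fun i => bF i).
Qed.

Let L_sum (n : nat) (F : nat -> E -> R) : (forall i, bounded_real (F i)) ->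
  L (fun x => \sum_(i < n) F i x) = \sum_(i < n) L (F i).
Proof.
by move=> bF; have [] := bounded_lin_sum L_lin (index_enum 'I_n) (fun i => bF i).
Qed.

Let L_scale c h : bounded_real h -> L (fun x => c * h x) = c * L h.
Proof.
move=> bh; have := L_lin c bh (bounded_cst 0); rewrite L0 addr0 => <-.
by congr L; apply/funext => x; rewrite addr0.
Qed.

Definition riesz_measure : {measure set (borel R d) -> \bar R} :=
  content_measure P0 P_le PU.

Lemma riesz_measure_total : (riesz_measure setT <= (L (fun=> 1%R))%:E)%E.
Proof.
have := content_measure_open P0 P_le PU openT.
by rewrite /P indicT.
Qed.

Let nu_fin : (riesz_measure setT < +oo)%E.
Proof. by apply: le_lt_trans riesz_measure_total _; exact: ltry. Qed.

Let nuE A : measurable (A : set (borel R d)) -> (riesz_measure A = (fine (riesz_measure A))%:E)%E.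
Proof.
move=> mA; rewrite fineK// ge0_fin_numE//; apply: le_lt_trans nu_fin.
by apply: le_measure; rewrite ?inE.
Qed.

Let i_ind (A : set (borel R d)) : measurable A ->
  intR riesz_measure (\1_A : borel R d -> R).
Proof.
by move=> mA; apply: (intR_bounded nu_fin _ (indic_bound A)); exact: measurable_indic.
Qed.

Let count_lt (y : R) n : Num.min y n%:R <= \sum_(k < n) (k%:R < y)%R%:R.
Proof.
elim: n => [|n IH]; first by rewrite big_ord0 ge_min lexx orbT.
rewrite big_ord_recr /=; case: (ltP n%:R y) => h.
  apply: (@le_trans _ _ (Num.min y n%:R + 1)); last by rewrite lerD2r.
  by rewrite (min_idPr (ltW h)) -natr1 ge_min lexx orbT.
rewrite addr0; apply: le_trans IH; rewrite (min_idPl h) ge_min lexx//.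
Qed.

Let count_le (y : R) n : 0 <= y -> \sum_(k < n) (k.+1%:R <= y)%R%:R <= y.
Proof.
move=> y0; suff : \sum_(k < n) (k.+1%:R <= y)%R%:R <= Num.min y n%:R.
  by move=> /le_trans; apply; rewrite ge_min lexx.
elim: n => [|n IH]; first by rewrite big_ord0 le_min y0 lexx.
rewrite big_ord_recr /=; case: (leP n.+1%:R y) => h.
  rewrite -[n.+1%:R]natr1 lerD2r; apply: le_trans IH _.
  by rewrite ge_min lexx orbT.
by rewrite addr0; apply: le_trans IH _; rewrite ge_min lexx.
Qed.

Let count_lt1 (y : R) n : y <= n%:R -> y - 1 <= \sum_(k < n) (k.+1%:R < y)%R%:R.
Proof.
move=> yn; have := count_lt y n.+1.
rewrite big_ord_recl /= (min_idPl _); last by apply: le_trans yn _; rewrite ler_nat.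
have : (0 < y)%R%:R <= 1 :> R by case: (0 < y)%R.
rewrite /bump /=; under eq_bigr do rewrite add1n; lra.
Qed.

(** Layer cake: [n.+1 * g] lies between the sums of the indicators of the compact
    sets [K n k] and of the open sets [U n k]. The measure of a compact set is
    at least its content and that of an open set at most its content; as
    [U n k.+1 `<=` K n k], comparing the layers shifted by one gives equality up
    to an error [L 1 / n.+1]. *)
Let riesz_ge0 g r : continuous g -> (forall x, 0 <= g x) -> bounded_real g ->
  vanishes_off r g -> L g = \int[riesz_measure]_x g x.
Proof.
move=> cg g0 bg vg; have [M gM] := bg.
have ig : intR riesz_measure g.
  by apply: (intR_bounded nu_fin _ gM); exact: continuous_borel_measurable.
have [m Mm] : exists m : nat, M <= m%:R.
  exists (Num.bound `|M|); apply: ltW; apply: le_lt_trans (ler_norm _) _.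
  by apply: archi_boundP.
pose K (n k : nat) : set E := [set x | k.+1%:R <= n.+1%:R * g x].
pose U (n k : nat) : set E := [set x | k%:R < n.+1%:R * g x].
have cng n : continuous (fun x => n.+1%:R * g x).
  by move=> x; exact: (cvgM (cvg_cst _) (cg x)).
have oU n (k : nat) : open (U n k).
  apply: (@open_comp _ _ (fun x : E => n.+1%:R * g x) [set t : R | k%:R < t]).
    by move=> x _; exact: cng.
  exact: open_gt.
have clK n (k : nat) : closed (K n k).
  apply: (@closed_comp _ _ (fun x : E => n.+1%:R * g x) [set t : R | k.+1%:R <= t]).
    by move=> x _; exact: cng.
  exact: closed_ge.
have cK n (k : nat) : compact (K n k).
  apply: bounded_closed_compact => //.
  exists r; split; first exact: num_real.
  move=> s rs x /= Kx; rewrite leNgt; apply/negP => sx.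
  by move: Kx; rewrite /K /= vg ?mulr0 ?lern0//; exact: lt_trans sx.
have inU n (k : nat) x : (x \in U n k) = (k%:R < n.+1%:R * g x).
  by apply/idP/idP => [/set_mem//|h]; exact/mem_set.
have inK n (k : nat) x : (x \in K n k) = (k.+1%:R <= n.+1%:R * g x).
  by apply/idP/idP => [/set_mem//|h]; exact/mem_set.
have UK n (k : nat) : U n k.+1 `<=` K n k by move=> x /ltW.
have nuK n (k : nat) : P (K n k) <= fine (riesz_measure (K n k)).
  rewrite -lee_fin -nuE; last exact: closed_borel.
  exact: content_measure_compact.
have nuU n (k : nat) : fine (riesz_measure (U n k)) <= P (U n k).
  rewrite -lee_fin -nuE; last exact: open_borel.
  exact: content_measure_open.
have int_sum n (F : nat -> set E) : (forall k, measurable (F k : set (borel R d))) ->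
    \int[riesz_measure]_x (\sum_(k < n) \1_(F k) x) = \sum_(k < n) fine (riesz_measure (F k)).
  move=> mF; rewrite Rint_sum.
    by apply: eq_bigr => k _; rewrite Rint_indic.
  by move=> k; exact: i_ind.
have i_sum n (F : nat -> set E) : (forall k, measurable (F k : set (borel R d))) ->
    intR riesz_measure (fun x => \sum_(k < n) \1_(F k) x).
  by move=> mF; apply: intR_sum => k; exact: i_ind.
have yb n x : n.+1%:R * g x <= (n.+1 * m)%:R.
  rewrite natrM ler_pM2l//; apply: le_trans Mm; apply: le_trans (gM x); exact: ler_norm.
have ubL n : n.+1%:R * L g <= P setT + n.+1%:R * \int[riesz_measure]_x g x.
  rewrite -L_scale// -RintegralZl//.
  apply: (@le_trans _ _ (L (fun x => \sum_(k < (n.+1 * m).+1) \1_(U n k) x))).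
    apply: L_le.
    - by have := bounded_realD n.+1%:R bg (bounded_cst 0); under eq_fun do rewrite addr0.
    - exact: (@bounded_sum _ (fun k => \1_(U n k)) (fun k => bounded_indic _)).
    - move=> x; have := count_lt (n.+1%:R * g x) (n.+1 * m).+1.
      rewrite (min_idPl _); last by apply: le_trans (yb n x) _; rewrite ler_nat.
      move=> /le_trans; apply; apply: ler_sum => k _.
      by rewrite indicE inU.
  rewrite (@L_sum _ (fun k => \1_(U n k)) (fun k => bounded_indic _)) big_ord_recl; apply: lerD; first exact: P_le.
  apply: (@le_trans _ _ (\sum_(k < n.+1 * m) fine (riesz_measure (K n k)))).
    apply: ler_sum => k _; rewrite lift0; exact: le_trans (P_le (@UK n k)) (nuK n k).
  rewrite -(int_sum _ (K n)); last by move=> k; exact: closed_borel.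
  apply: Rint_le.
  - by apply: (i_sum _ (K n)) => k; exact: closed_borel.
  - exact: intRZ.
  - move=> x; have ny : 0 <= n.+1%:R * g x by rewrite mulr_ge0.
    apply: le_trans (count_le (n.+1 * m) ny); apply: ler_sum => k _.
    by rewrite indicE inK.
have lbL n : n.+1%:R * \int[riesz_measure]_x g x - P setT <= n.+1%:R * L g.
  apply: (@le_trans _ _ (L (fun x => \sum_(k < n.+1 * m) \1_(K n k) x))); last first.
    rewrite -L_scale//; apply: L_le.
    - exact: (@bounded_sum _ (fun k => \1_(K n k)) (fun k => bounded_indic _)).
    - by have := bounded_realD n.+1%:R bg (bounded_cst 0); under eq_fun do rewrite addr0.
    - move=> x; have ny : 0 <= n.+1%:R * g x by rewrite mulr_ge0.
      apply: le_trans (count_le (n.+1 * m) ny); apply: ler_sum => k _.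
      by rewrite indicE inK.
  rewrite (@L_sum _ (fun k => \1_(K n k)) (fun k => bounded_indic _)).
  apply: (@le_trans _ _ (\sum_(k < n.+1 * m) fine (riesz_measure (U n k.+1)))); last first.
    by apply: ler_sum => k _; exact: le_trans (nuU n k.+1) (P_le (@UK n k)).
  rewrite -(int_sum _ (fun k => U n k.+1)); last by move=> k; exact: open_borel.
  apply: (@le_trans _ _ (n.+1%:R * \int[riesz_measure]_x g x - \int[riesz_measure]_x 1)).
    rewrite lerD2l lerN2 Rintegral_cst// mul1r -lee_fin -nuE//.
    by apply: le_trans riesz_measure_total _; rewrite /P indicT.
  rewrite -RintegralZl// -RintegralB//; last 2 first.
  - exact: (intRZ n.+1%:R ig).
  - by apply: (@intR_bounded _ _ _ _ _ 1) => // x; rewrite normr1.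
  apply: Rint_le.
  - apply: intRB; first exact: intRZ.
    by apply: (@intR_bounded _ _ _ _ _ 1) => // x; rewrite normr1.
  - by apply: (i_sum _ (fun k => U n k.+1)) => k; exact: open_borel.
  - move=> x; apply: le_trans (count_lt1 (yb n x)) _; apply: ler_sum => k _.
    by rewrite indicE inU.
have Pc : 0 <= P setT by rewrite -P0; exact: P_le.
have close : forall e, 0 < e -> `|L g - \int[riesz_measure]_x g x| <= e.
  move=> e e0; have eP : 0 < e / (P setT + 1) by rewrite divr_gt0// ltr_wpDl.
  have [n] := ltr_add_invr eP; rewrite add0r ltr_pdivlMr ?ltr_wpDl// => Hn.
  have hn : n.+1%:R^-1 * P setT <= e.
    by apply: le_trans (ltW Hn); rewrite ler_wpM2l// lerDl.
  rewrite -(ler_pM2l (_ : 0 < n.+1%:R))// -[n.+1%:R in leLHS]ger0_norm// -normrM mulrBr.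
  have hn' : P setT <= n.+1%:R * e by rewrite -ler_pdivrMl.
  have := ubL n; have := lbL n; rewrite ler_norml => *; apply/andP; split; lra.
apply/eqP; rewrite -subr_eq0 -normr_le0; apply/ler_addgt0Pr => e e0.
by rewrite add0r; exact: close.
Qed.

(** The functional need not be represented by the measure on all bounded
    functions: mass escaping to infinity is lost, whence the restriction to
    functions that vanish off a ball. *)
Lemma riesz g r : continuous g -> bounded_real g -> vanishes_off r g ->
  L g = \int[riesz_measure]_x g x.
Proof.
move=> cg bg vg; have [M gM] := bg.
pose gp x : R := 2^-1 * (`|g x| + g x); pose gn x : R := 2^-1 * (`|g x| - g x).
have cn : continuous (fun x => `|g x|).
  by move=> x; apply: continuous_comp; [exact: cg|exact: norm_continuous].
have cp : continuous gp by move=> x; exact: (cvgM (cvg_cst _) (cvgD (cn x) (cg x))).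
have cm : continuous gn by move=> x; exact: (cvgM (cvg_cst _) (cvgB (cn x) (cg x))).
have gp0 x : 0 <= gp x.
  by rewrite mulr_ge0// -lerBlDr sub0r -normrN ler_norm.
have gn0 x : 0 <= gn x by rewrite mulr_ge0// subr_ge0 ler_norm.
have bp : bounded_real gp.
  exists M => x; rewrite ger0_norm// /gp; have := gM x; have := ler_norm (g x); lra.
have bm : bounded_real gn.
  exists M => x; rewrite ger0_norm// /gn; have := gM x; have := ler_norm (- g x).
  rewrite normrN; lra.
have vp : vanishes_off r gp by move=> x /vg; rewrite /gp => ->; rewrite normr0 addr0 mulr0.
have vm : vanishes_off r gn by move=> x /vg; rewrite /gn => ->; rewrite normr0 subr0 mulr0.
have gE : g = (fun x => -1 * gn x + gp x).
  by apply/funext => x; rewrite /gn /gp; lra.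
rewrite gE L_lin// (riesz_ge0 cp gp0 bp vp) (riesz_ge0 cm gn0 bm vm).
have [Mp gpM] := bp; have [Mm gmM] := bm.
have ip : intR riesz_measure gp.
  by apply: (intR_bounded nu_fin _ gpM); exact: continuous_borel_measurable.
have im : intR riesz_measure gn.
  by apply: (intR_bounded nu_fin _ gmM); exact: continuous_borel_measurable.
by rewrite (RintegralD measurableT (intRZ (-1) im) ip) (RintegralZl _ measurableT im).
Qed.

End Riesz.

(** * Dominating measures and the Lebesgue decomposition *)

Section Domination.
Context {R : realType} {d : nat}.
Local Notation T := (borel R d).
Implicit Types (f : {charge set T -> \bar R}) (m nu mu : {measure set T -> \bar R}).

Lemma finite_sigma_finite nu : (nu setT < +oo)%E -> sigma_finite setT nu.
Proof. by move=> /pack_finite[nu' ->]; exact: sigma_finiteT. Qed.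

Lemma dominating_measure (I : finType) (m : I -> {measure set T -> \bar R}) :
  (forall i, (m i setT < +oo)%E) ->
  exists2 nu : {measure set T -> \bar R}, (nu setT < +oo)%E &
    forall i A, (m i A <= nu A)%E.
Proof.
move=> mfin.
suff [nu nufin H] : exists2 nu : {measure set T -> \bar R}, (nu setT < +oo)%E &
    forall i, i \in enum I -> forall A, (m i A <= nu A)%E.
  by exists nu => // i; apply: H; rewrite mem_enum.
elim: (enum I) => [|j s [nu nufin IH]].
  by exists mzero => //; rewrite /mzero ltry.
have addE A : measure_add (m j) nu A = (m j A + nu A)%E by exact: measure_addE.
exists (measure_add (m j) nu).
  by have := lte_add_pinfty (mfin j) nufin; rewrite -addE.
move=> i; rewrite inE => /orP[/eqP ->|iS] A.
  by have := leeDl (m j A) (measure_ge0 nu A); rewrite -addE.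
suff : (m i A <= m j A + nu A)%E by rewrite -addE.
by apply: le_trans (IH _ iS A) _; rewrite leeDr.
Qed.

Lemma charge_density f nu : sigma_finite setT nu ->
  (forall A, measurable A -> nu A = 0%E -> f A = 0%E) ->
  exists2 g : T -> R, intR nu g &
    forall A, measurable A -> f A = (\int[nu]_(x in A) (g x)%:E)%E.
Proof.
move=> /pack_sigma_finite[nu' ->] dom.
have dom' : f `<< nu' by apply/null_content_dominatesP => A mA A0; exact: dom.
have gE x : Radon_Nikodym f nu' x = (fine (Radon_Nikodym f nu' x))%:E.
  by rewrite fineK//; exact: Radon_Nikodym_fin_num.
exists (fine \o Radon_Nikodym f nu').
  rewrite /intR (_ : EFin \o _ = Radon_Nikodym f nu'); first exact: Radon_Nikodym_integrable.
  by apply/funext => x /=; rewrite -gE.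
move=> A mA; rewrite (Radon_Nikodym_integral dom' mA).
by apply: eq_integral => x _ /=; rewrite -gE.
Qed.

Lemma tv_dominates f A : measurable A -> tv f A = 0%E -> f A = 0%E.
Proof.
move=> mA A0; apply/eqP; rewrite -abse_eq0 eq_le abse_ge0 andbT -A0.
exact: abse_charge_variation.
Qed.

Lemma Rint_setE nu (g : T -> R) A : measurable A -> intR nu g ->
  ((\int[nu]_x (\1_A x * g x))%:E = \int[nu]_(x in A) (g x)%:E)%E.
Proof.
move=> mA ig; rewrite Rint_indicM// /Rintegral fineK//.
by apply: integrable_fin_num => //; exact: (integrableS measurableT).
Qed.

Lemma intR_indicM nu (g : T -> R) A : measurable A -> intR nu g ->
  intR nu (fun x => \1_A x * g x).
Proof.
move=> mA ig; apply: (intRM (M := 1)) => //; exact: indic_bound.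
Qed.

(** All the charges have densities with respect to a common finite measure, for
    which linearity is that of the integral. Jordan decompositions are not
    additive, so the formula is not immediate from the definition. *)
Lemma charge_integral_linear f f1 f2 (a : R) (phi : T -> R) (M : R) :
  (forall A, measurable A -> f A = (f1 A + a%:E * f2 A)%E) ->
  measurable_fun setT phi -> (forall x, `|phi x| <= M) ->
  charge_integral f phi = charge_integral f1 phi + a * charge_integral f2 phi.
Proof.
move=> fE mphi phiM.
have [nu nufin nu_dom] := @dominating_measure bool
  (fun b => if b then tv f1 else tv f2)
  (fun b => if b return ((if b then tv f1 else tv f2) setT < +oo)%E
            then total_variation_fin f1 else total_variation_fin f2).
have sf := finite_sigma_finite nufin.
have dom b A : measurable A -> nu A = 0%E -> (if b then f1 else f2) A = 0%E.
  move=> mA A0; have : (if b then tv f1 else tv f2) A = 0%E.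
    by apply/eqP; rewrite eq_le measure_ge0 andbT -A0; exact: (nu_dom b).
  by case: b => h; exact: tv_dominates.
have [g1 ig1 f1E] := charge_density sf (dom true).
have [g2 ig2 f2E] := charge_density sf (dom false).
have ig : intR nu (fun x => g1 x + a * g2 x) by apply: intRD => //; exact: intRZ.
have fgE A : measurable A -> f A = (\int[nu]_(x in A) (g1 x + a * g2 x)%:E)%E.
  move=> mA; rewrite fE// f1E// f2E//.
  under [RHS]eq_integral do rewrite EFinD EFinM.
  rewrite integralD//.
  - by rewrite integralZl//; exact: (integrableS measurableT).
  - exact: (integrableS measurableT).
  - by apply: (integrableS measurableT) => //; exact: (intRZ a ig2).
rewrite (charge_integral_density sf ig fgE mphi phiM).
rewrite (charge_integral_density sf ig1 f1E mphi phiM).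
rewrite (charge_integral_density sf ig2 f2E mphi phiM).
rewrite -RintegralZl//; last exact: (intRMr mphi phiM ig2).
rewrite -RintegralD//.
- by apply: eq_Rintegral => x _; rewrite mulrDl mulrA.
- exact: (intRMr mphi phiM ig1).
- exact: (intRZ a (intRMr mphi phiM ig2)).
Qed.

Lemma charge_integral_induced nu (g : T -> R) (ig : intR nu g) (phi : T -> R) (M : R) :
  sigma_finite setT nu -> measurable_fun setT phi -> (forall x, `|phi x| <= M) ->
  charge_integral (induced_charge ig) phi = \int[nu]_x (g x * phi x).
Proof. by move=> sf mphi phiM; exact: (charge_integral_density sf ig _ mphi phiM). Qed.

Lemma Rint_density_unique nu nu' (g g' : T -> R) (phi : T -> R) (M : R) :
  sigma_finite setT nu -> sigma_finite setT nu' -> intR nu g -> intR nu' g' ->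
  (forall A, measurable A ->
    (\int[nu]_(x in A) (g x)%:E = \int[nu']_(x in A) (g' x)%:E)%E) ->
  measurable_fun setT phi -> (forall x, `|phi x| <= M) ->
  \int[nu]_x (g x * phi x) = \int[nu']_x (g' x * phi x).
Proof.
move=> sf sf' ig ig' gg' mphi phiM.
rewrite -(charge_integral_induced ig sf mphi phiM).
exact: (charge_integral_density sf' ig').
Qed.

(** [N] is a countable union of [mu]-null sets of maximal [nu]-measure; it
    carries the [mu]-singular part of [nu]. *)
Lemma lebesgue_decomposition_set mu nu : (nu setT < +oo)%E ->
  exists N, [/\ measurable N, mu N = 0%E &
    forall A, measurable A -> mu A = 0%E -> nu (A `\` N) = 0%E].
Proof.
move=> nufin; pose C := [set A : set T | measurable A /\ mu A = 0%E].
have [|A CA HA] := @finite_exhaustion _ _ _ nu C nufin (fun A h => h.1).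
  by exists set0; split => //; exact: measure0.
exists (\bigcup_n A n); split.
- by apply: bigcupT_measurable => n; exact: (CA n).1.
- by apply: null_bigcup => n; [exact: (CA n).1|exact: (CA n).2].
- by move=> B mB B0; apply: HA.
Qed.

(** L1 norms become integrals of [g] over sets, which are what a density is
    known by. *)
Lemma Rint_norm_split nu (g : T -> R) : intR nu g ->
  exists A, measurable A /\
   \int[nu]_x `|g x| = \int[nu]_x (\1_A x * g x) - \int[nu]_x (\1_(~` A) x * g x).
Proof.
move=> ig; exists [set x | 0 <= g x].
have mA : measurable [set x | 0 <= g x].
  have := intR_measurable ig; move=> /(_ measurableT `[0, +oo[%classic).
  rewrite setTI (_ : g @^-1` _ = [set x | 0 <= g x]); first by apply; exact: measurable_itv.
  by apply/seteqP; split => x /=; rewrite in_itv /= andbT.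
split => //; rewrite -RintegralB//.
- apply: eq_Rintegral => x _; rewrite !indicE in_setC.
  have -> : (x \in [set x | 0 <= g x]) = (0 <= g x).
    by apply/idP/idP => [/set_mem//|h]; exact/mem_set.
  by case: ger0P => h /=; rewrite ?mul1r ?mul0r ?subr0 ?sub0r.
- exact: intR_indicM.
- by apply: intR_indicM => //; exact: measurableC.
Qed.

Lemma measure_density m nu : (m setT < +oo)%E -> (nu setT < +oo)%E ->
  (forall A, (m A <= nu A)%E) ->
  exists h : T -> R, [/\ intR nu h, \int[nu]_x `|h x| <= fine (m setT) &
    forall (phi : T -> R) (M : R), measurable_fun setT phi -> (forall x, `|phi x| <= M) ->
      \int[m]_x phi x = \int[nu]_x (h x * phi x)].
Proof.
move=> mfin nufin mnu; have sf := finite_sigma_finite nufin.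
have [m' em] := pack_finite mfin.
have dm A : measurable A -> nu A = 0%E -> charge_of_finite_measure m' A = 0%E.
  move=> mA A0; apply/eqP; rewrite eq_le; apply/andP; split.
    by rewrite -A0; have := mnu A; rewrite em.
  exact: (measure_ge0 m').
have [h ih hE] := @charge_density (charge_of_finite_measure m') nu sf dm.
have mE A : measurable A -> m A = (\int[nu]_(x in A) (h x)%:E)%E.
  by move=> mA; rewrite -hE// em.
exists h; split => //.
- have [A [mA ->]] := Rint_norm_split ih.
  have mfA B : measurable B -> \int[nu]_x (\1_B x * h x) = fine (m B).
    by move=> mB; rewrite mE// -Rint_setE.
  rewrite !mfA//; last exact: measurableC.
  have : fine (m A) <= fine (m setT).
    rewrite em fine_le ?fin_num_measure//; by apply: le_measure; rewrite ?inE.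
  have : 0 <= fine (m (~` A)) by rewrite fine_ge0.
  lra.
- move=> phi M mphi phiM; rewrite (Rint_measure_density mfin sf ih mE mphi phiM).
  by apply: eq_Rintegral => x _; rewrite mulrC.
Qed.

End Domination.

(** * Densities of normal currents have Arens-Eells divergence *)

Section Closability.
Context {R : realType} {d : nat}.
Local Notation T := (borel R d).
Implicit Types (f : {charge set T -> \bar R}) (mu nu : {measure set T -> \bar R}).
Implicit Types (lambda : 'I_d -> {charge set T -> \bar R}).
Implicit Types (sigma : 'rV[R]_d -> 'rV[R]_d) (phi psi : 'rV[R]_d -> R).

Lemma cvg_sum0 (I : Type) (s : seq I) (u : I -> nat -> R) :
  (forall i, u i n @[n --> \oo] --> (0 : R)) ->
  \sum_(i <- s) u i n @[n --> \oo] --> (0 : R).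
Proof.
move=> u0; elim: s => [|i s IH].
  by under eq_fun do rewrite big_nil; exact: cvg_cst.
under eq_fun do rewrite big_cons.
by have := cvgD (u0 i) IH; rewrite addr0; exact.
Qed.

(** Convergence at the origin bounds the values there; the Lipschitz constant
    propagates the bound. *)
Lemma equilipschitz_bound (phi : nat -> 'rV[R]_d -> R) (c M : R) :
  (forall n, smooth (phi n)) -> (forall n i x, `|partial i (phi n) x| <= M) ->
  phi n 0 @[n --> \oo] --> c ->
  exists2 K, 0 <= K & forall n x, `|phi n x - c| <= K + d%:R * M * `|x|.
Proof.
move=> sphi gM phi0.
have [K0 [_ HK]] : exists K0 : R, K0 \is Num.real /\
    forall K, K0 < K -> forall n, `|phi n 0| <= K.
  have /cvg_seq_bounded[K0 [K0r H]] : cvgn (fun n => phi n 0) by apply/cvg_ex; exists c.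
  by exists K0; split => // K K0K n; exact: (H K K0K n).
pose K := `|K0| + 1.
have KK : K0 < K by rewrite ltr_pwDr// ler_norm.
exists (K + `|c|); first by rewrite !addr_ge0.
move=> n x; rewrite (_ : phi n x - c = (phi n x - phi n 0) + (phi n 0 - c)); last by ring.
apply: (le_trans (ler_normD _ _)); rewrite addrC; apply: lerD.
  by apply: (le_trans (ler_normB _ _)); rewrite lerD2r; exact: HK.
by have := gradient_lipschitz x 0 (sphi n) (gM n); rewrite subr0.
Qed.

Lemma Rint_cvg0 nu (k : T -> R) (h : nat -> T -> R) (C : R) :
  (nu setT < +oo)%E -> measurable_fun setT k -> (forall x, `|k x| <= 1) ->
  (forall n, measurable_fun setT (h n)) -> (forall n x, `|h n x| <= C) ->
  (forall x, h n x @[n --> \oo] --> (0 : R)) ->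
  \int[nu]_x (k x * h n x) @[n --> \oo] --> (0 : R).
Proof.
move=> nufin mk k1 mh hC h0.
have [||||_] := @Rint_dominated _ _ _ nu (fun n x => k x * h n x) (fun=> 0) (fun=> C).
- by move=> n; exact: measurable_funM.
- by apply: (@intR_bounded _ _ _ _ _ `|C|).
- by move=> n x; rewrite normrM -[leRHS]mul1r ler_pM.
- by move=> x; rewrite -(mulr0 (k x)); apply: cvgM => //; exact: cvg_cst.
by rewrite Rintegral_cst// mul0r.
Qed.

Section NormalCurrent.
Variables (lambda : 'I_d -> {charge set T -> \bar R}) (f : {charge set T -> \bar R}).
Hypothesis lambdaf : forall phi, test_function phi ->
  neg_div lambda phi = charge_integral f phi.
Variable k : 'I_d -> T -> R.
Hypothesis mk : forall i, measurable_fun setT (k i).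
Hypothesis k1 : forall i x, `|k i x| <= 1.
Hypothesis kE : forall i (phi : T -> R) (M : R), measurable_fun setT phi ->
  (forall x, `|phi x| <= M) ->
  charge_integral (lambda i) phi = \int[tv (lambda i)]_x (k i x * phi x).
Variables (phi : nat -> 'rV[R]_d -> R) (c M : R).
Hypothesis tphi : forall n, test_function (phi n).
Hypothesis gradM : forall n i x, `|partial i (phi n) x| <= M.
Hypothesis cphi : forall x, phi n x @[n --> \oo] --> c.

(** The Leibniz rule writes the integral of [psi * grad (phi n)] as the pairing
    of [- div lambda = f] with [(phi n - c) * psi] minus the integral of
    [(phi n - c) * grad psi]. Both integrands are uniformly bounded and tend
    pointwise to 0. *)
Let test_localized psi : test_function psi ->
  \sum_i \int[tv (lambda i)]_x (k i x * (psi x * partial i (phi n) x))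
    @[n --> \oo] --> (0 : R).
Proof.
move=> tpsi; have [r r0 vpsi] := test_vanishes tpsi.
have [K K0 bnd] := equilipschitz_bound (fun n => (tphi n).1) gradM (cphi 0).
pose w n x := phi n x - c.
have sw n : smooth (w n) by apply: smoothD; [exact: (tphi n).1|exact: smooth_cst].
have dphi n y : differentiable (phi n) y by exact: smooth_differentiable (tphi n).1.
have dc y : differentiable (fun _ : 'rV[R]_d => - c) y by exact: differentiable_cst.
have pw n i : partial i (w n) = partial i (phi n).
  rewrite /w (partialD i (dphi n) dc) partial_cst.
  by apply/funext => x; rewrite addr0.
have tpw n : test_function (fun x => w n x * psi x) by apply: test_mul_smooth.
have ppw n i x : partial i (fun x => w n x * psi x) x =
    w n x * partial i psi x + psi x * partial i (phi n) x.
  rewrite partialM ?pw//.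
    by move=> y; exact: smooth_differentiable.
  by move=> y; apply: smooth_differentiable; case: tpsi.
have w0 x : w n x @[n --> \oo] --> (0 : R).
  by rewrite -(subrr c); apply: cvgB; [exact: cphi|exact: cvg_cst].
have M0 : 0 <= d%:R * M.
  have [d0|d0] := posnP d; first by rewrite d0 mul0r.
  by rewrite mulr_ge0//; apply: le_trans (gradM 0%N (Ordinal d0) 0).
have loc g : test_function g -> vanishes_off r g ->
    exists C, forall n x, `|w n x * g x| <= C.
  move=> tg vg; have [B gB] := test_bounded tg; exists ((K + d%:R * M * r) * B) => n x.
  have B0 : 0 <= B by exact: le_trans (gB 0).
  have [xr|rx] := leP `|x| r; last first.
    by rewrite vg// mulr0 normr0 mulr_ge0// addr_ge0// mulr_ge0.
  rewrite normrM ler_pM//; apply: (le_trans (bnd n x)).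
  by rewrite lerD2l ler_wpM2l.
have wg0 g x : w n x * g x @[n --> \oo] --> (0 : R).
  by rewrite -(mul0r (g x)); apply: cvgM; [exact: w0|exact: cvg_cst].
have [Cf HCf] := loc _ tpsi vpsi.
have lim1 : charge_integral f (fun x => w n x * psi x) @[n --> \oo] --> (0 : R).
  have [kf [mkf kf1 _ kfE]] := charge_integral_polar f.
  have mw n : measurable_fun setT (fun x : T => w n x * psi x).
    exact: test_measurable (tpw n).
  rewrite (_ : (fun n => _) = fun n => \int[tv f]_x (kf x * (w n x * psi x))); last first.
    by apply/funext => n; rewrite (kfE _ Cf).
  by apply: (Rint_cvg0 (C := Cf)) => //; exact: total_variation_fin.
have lim2 : \sum_i \int[tv (lambda i)]_x (k i x * (w n x * partial i psi x))
    @[n --> \oo] --> (0 : R).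
  apply: cvg_sum0 => i.
  have [C HC] := loc _ (test_partial i tpsi) (vanishes_partial i vpsi).
  apply: (Rint_cvg0 (C := C)) => //; first exact: total_variation_fin.
  by move=> n; apply: smooth_measurable; apply: smoothM => //; exact: (test_partial i tpsi).1.
rewrite (_ : (fun n => _) = fun n => charge_integral f (fun x => w n x * psi x) -
   \sum_i \int[tv (lambda i)]_x (k i x * (w n x * partial i psi x))).
  by have := cvgB lim1 lim2; rewrite subr0; exact.
apply/funext => n; apply/eqP; rewrite eq_sym subr_eq; apply/eqP.
rewrite -lambdaf// /neg_div -big_split /=; apply: eq_bigr => i _.
have [B HB] := test_bounded (test_partial i (tpw n)).
have mpw : measurable_fun [set: T] (partial i (fun x => w n x * psi x)).
  exact: test_measurable (test_partial i (tpw n)).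
rewrite (@kE i (partial i (fun x => w n x * psi x)) B mpw HB).
have [C HC] := loc _ (test_partial i tpsi) (vanishes_partial i vpsi).
have [Bp psiB] := test_bounded tpsi.
have i1 : intR (tv (lambda i)) (fun x => k i x * (psi x * partial i (phi n) x)).
  apply: (@intR_bounded _ _ _ _ _ (Bp * M)); first exact: total_variation_fin.
    apply: measurable_funM => //; apply: measurable_funM; first exact: test_measurable.
    exact: test_measurable (test_partial i (tphi n)).
  by move=> x; rewrite normrM -[leRHS]mul1r ler_pM// normrM ler_pM.
have i2 : intR (tv (lambda i)) (fun x => k i x * (w n x * partial i psi x)).
  apply: (@intR_bounded _ _ _ _ _ C); first exact: total_variation_fin.
    apply: measurable_funM => //.
    by apply: smooth_measurable; apply: smoothM => //; exact: (test_partial i tpsi).1.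
  by move=> x; rewrite normrM -[leRHS]mul1r ler_pM.
rewrite -(RintegralD measurableT i1 i2).
by apply: eq_Rintegral => x _; rewrite ppw; ring.
Qed.

(** A normal current is closable on every Borel set, not just globally: replace
    the indicator by a test function close to it in L1 of all the total
    variations, at a cost controlled by the bound on gradients. *)
Lemma normal_current_closable (A : set T) : measurable A ->
  \sum_i \int[tv (lambda i)]_x (k i x * (\1_A x * partial i (phi n) x))
    @[n --> \oo] --> (0 : R).
Proof.
move=> mA; apply/cvgr0Pnorm_le => e e0.
(* [M'] and [d.+1] replace [M] and [d], which may be 0, in the choice of the precision *)
pose M' := `|M| + 1; have M'0 : 0 < M' by rewrite ltr_wpDl.
have D0 : 0 < d.+1%:R * M' by rewrite mulr_gt0.
have e20 : 0 < e / 2 by rewrite divr_gt0.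
have e3 : 0 < (e / 2) / (d.+1%:R * M') by rewrite divr_gt0.
have [psi tpsi Hpsi] := indic_test_dense (fun i => total_variation_fin (lambda i)) mA e3.
have [Bp psiB] := test_bounded tpsi.
have := test_localized tpsi => /cvgr0Pnorm_le /(_ _ e20).
apply: filterS => n Hn.
have mpn i : measurable_fun [set: T] (partial i (phi n)).
  exact: test_measurable (test_partial i (tphi n)).
have i1 i : intR (tv (lambda i)) (fun x => k i x * (\1_A x * partial i (phi n) x)).
  apply: (@intR_bounded _ _ _ _ _ M) => //; first exact: total_variation_fin.
    by apply: measurable_funM => //; apply: measurable_funM.
  move=> x; rewrite normrM -[leRHS]mul1r ler_pM// normrM -[leRHS]mul1r ler_pM//.
  exact: indic_bound.
have i2 i : intR (tv (lambda i)) (fun x => k i x * (psi x * partial i (phi n) x)).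
  apply: (@intR_bounded _ _ _ _ _ (Bp * M)) => //; first exact: total_variation_fin.
    by apply: measurable_funM => //; apply: measurable_funM => //; exact: test_measurable.
  by move=> x; rewrite normrM -[leRHS]mul1r ler_pM// normrM ler_pM.
rewrite (_ : \sum_i _ = \sum_i \int[tv (lambda i)]_x (k i x * (psi x * partial i (phi n) x))
  + \sum_i \int[tv (lambda i)]_x ((k i x * partial i (phi n) x) * (\1_A x - psi x))); last first.
  rewrite -big_split /=; apply: eq_bigr => i _.
  have i3 : intR (tv (lambda i)) (fun x => k i x * partial i (phi n) x * (\1_A x - psi x)).
    rewrite (_ : (fun x => _) = (fun x => k i x * (\1_A x * partial i (phi n) x) -
      k i x * (psi x * partial i (phi n) x))); first exact: intRB.
    by apply/funext => x; ring.
  rewrite -(RintegralD measurableT (i2 i) i3).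
  by apply: eq_Rintegral => x _; ring.
apply: (le_trans (ler_normD _ _)); rewrite [leRHS]splitr; apply: lerD => //.
apply: (le_trans (ler_norm_sum _ _ _)).
apply: (@le_trans _ _ (\sum_(i < d) (e / 2) / d.+1%:R)).
  apply: ler_sum => i _.
  apply: (@le_trans _ _ (\int[tv (lambda i)]_x (M' * `|\1_A x - psi x|))).
    apply: Rint_norm_le.
    - apply: measurable_funM; first exact: measurable_funM.
      by apply: measurable_funB => //; exact: test_measurable.
    - apply/intRZ/intR_norm/intRB.
        by apply: (@intR_bounded _ _ _ _ _ 1) => //; [exact: total_variation_fin|exact: indic_bound].
      by apply: (@intR_bounded _ _ _ _ _ Bp) => //; [exact: total_variation_fin|exact: test_measurable].
    - move=> x; rewrite !normrM ler_wpM2r// -[leRHS]mul1r ler_pM//.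
      by apply: (le_trans (gradM n i x)); rewrite (le_trans (ler_norm M))// lerDl.
  rewrite RintegralZl//; last first.
    apply/intR_norm/intRB.
      by apply: (@intR_bounded _ _ _ _ _ 1) => //; [exact: total_variation_fin|exact: indic_bound].
    by apply: (@intR_bounded _ _ _ _ _ Bp) => //; [exact: total_variation_fin|exact: test_measurable].
  rewrite mulrC -ler_pdivlMr//; apply: (le_trans (ltW (Hpsi i))).
  by rewrite invfM mulrA.
rewrite sumr_const card_ord -(mulr_natr _ d) -mulrA ler_piMr//; first exact: ltW.
by rewrite ler_pdivrMl// mulr1 ler_nat.
Qed.

End NormalCurrent.

Lemma gradient_bound (phi : 'rV[R]_d -> R) (M : R) i x :
  enorm (gradient phi x) <= M -> `|partial i phi x| <= M.
Proof.
by apply: le_trans; have := enorm_coord (gradient phi x) i; rewrite mxE.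
Qed.

Lemma L1vec_intR mu sigma : L1vec mu sigma -> forall i, intR mu (fun x : T => sigma x 0 i).
Proof. by []. Qed.

Lemma intR_density_test mu sigma phi i : L1vec mu sigma -> test_function phi ->
  intR mu (fun x : T => sigma x 0 i * phi x).
Proof.
move=> sL tphi; have [B HB] := test_bounded tphi.
apply: (@intRMr _ _ _ mu phi (fun x : T => sigma x 0 i) B) => //; last exact: sL.
exact: test_measurable.
Qed.

Lemma neg_div_densityE mu sigma phi : L1vec mu sigma -> test_function phi ->
  neg_div_density mu sigma phi =
  \sum_i \int[mu]_x (sigma x 0 i * partial i phi x).
Proof.
move=> sL tphi; rewrite /neg_div_density Rint_sum// => i.
exact: (intR_density_test i sL (test_partial i tphi)).
Qed.

(** The order is 1 and the constant does not depend on the compact set, since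
    [sigma] is globally integrable. *)
Lemma neg_div_density_distribution mu sigma : L1vec mu sigma ->
  Defs.distribution (neg_div_density mu sigma).
Proof.
move=> sL.
have ii phi i : test_function phi -> intR mu (fun x : T => sigma x 0 i * partial i phi x).
  move=> tphi; exact: (intR_density_test i sL (test_partial i tphi)).
split.
- move=> a phi psi tphi tpsi.
  have tap := test_scale a tphi.
  rewrite !neg_div_densityE//; last exact: testD.
  rewrite big_distrr /= -big_split /=; apply: eq_bigr => i _.
  have da y : differentiable (fun x => a * phi x) y by apply: smooth_differentiable; case: tap.
  have dp y : differentiable phi y by apply: smooth_differentiable; case: tphi.
  have dq y : differentiable psi y by apply: smooth_differentiable; case: tpsi.
  have dca y : differentiable (fun _ : 'rV[R]_d => a) y by exact: differentiable_cst.
  rewrite -RintegralZl//; last exact: ii.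
  rewrite -RintegralD//; [|exact: (intRZ a (ii _ i tphi))|exact: ii].
  apply: eq_Rintegral => x _; rewrite partialD// (partialM i dca dp) partial_cst; ring.
- move=> K _; exists (\sum_i \int[mu]_x `|sigma x 0 i|), 1%N => phi M tphi _ HM.
  rewrite neg_div_densityE//; apply: (le_trans (ler_norm_sum _ _ _)).
  rewrite mulr_suml; apply: ler_sum => i _.
  rewrite mulrC -RintegralZl//; last exact: (intR_norm (L1vec_intR sL i)).
  apply: Rint_norm_le.
  + apply: measurable_funM; first exact: intR_measurable (L1vec_intR sL i).
    exact: test_measurable (test_partial i tphi).
  + exact: (intRZ M (intR_norm (L1vec_intR sL i))).
  + move=> x; rewrite normrM mulrC ler_wpM2r//.
    exact: (HM [:: i]).
Qed.

(** On the complement [A] of a [mu]-null set carrying all the singular parts,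
    the current is [sigma mu], so [normal_current_closable] on [A] is the claim. *)
Lemma calV_sub_calT mu : sigma_finite setT mu -> calV mu `<=` calT mu.
Proof.
move=> sf sigma [lambda [f _ lambdaf] [sL [lambda_s sing lambdaE]]].
split => //; split; first exact: neg_div_density_distribution.
move=> phi c tphi [M gM] cphi.
have gradM n i x : `|partial i (phi n) x| <= M by exact: gradient_bound.
have /choice[k Hk] := fun i => charge_integral_polar (lambda i).
have mk i : measurable_fun setT (k i) by have [] := Hk i.
have k1 i x : `|k i x| <= 1 by have [_ + _ _] := Hk i; exact.
have lE i A : measurable A -> lambda i A = (\int[tv (lambda i)]_(x in A) (k i x)%:E)%E.
  by have [_ _ + _] := Hk i; exact.
have kE i (g : T -> R) C : measurable_fun setT g -> (forall x, `|g x| <= C) ->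
    charge_integral (lambda i) g = \int[tv (lambda i)]_x (k i x * g x).
  by have [_ _ _] := Hk i; exact.
have /choice[N HN] := sing.
pose A := ~` \bigcup_(i in [set: 'I_d]) N i.
have mN i : measurable (N i) by have [] := HN i.
have mU : measurable (\bigcup_(i in [set: 'I_d]) N i).
  by apply: fin_bigcup_measurable => // i _; exact: mN.
have mA : measurable A by exact: measurableC.
have U0 : mu (\bigcup_(i in [set: 'I_d]) N i) = 0%E.
  (* the indices in ['I_d] are read as natural numbers to use countable unions *)
  have /(@negligible_bigcup _ _ _ mu (fun n => if insub n is Some i then N i else set0)) :
      forall n, mu.-negligible (if insub n is Some i then N i else set0 : set T).
    move=> n; case: insub => [i|]; last exact: negligible_set0.
    by apply/negligibleP => //; have [] := HN i.
  move=> H; apply/negligibleP => //; apply: negligibleS H => x [i _ Nx].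
  by exists (i : nat) => //; rewrite valK.
have setE i B : measurable B ->
    (\int[mu]_(x in B) (sigma x 0 i)%:E = \int[tv (lambda i)]_(x in B) (\1_A x * k i x)%:E)%E.
  move=> mB.
  have BA : B `&` A `<=` ~` N i by move=> x [_ Ax] Nx; apply: Ax; exists i.
  have mBA : measurable (B `&` A) by exact: measurableI.
  transitivity (lambda i (B `&` A)); last first.
    rewrite lE// integral_mkcondr; apply: eq_integral => x _.
    by rewrite patchE indicE; case: ifP => _; rewrite ?mul1r ?mul0r.
  have [_ _ /(_ (B `&` A) mBA BA) l0] := HN i.
  rewrite lambdaE// l0 adde0.
  have -> : B `&` A = B `\` \bigcup_(j in [set: 'I_d]) N j by rewrite setDE.
  apply: (@negligible_integral _ _ _ mu _ _ _ mU mB _ U0).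
  exact: integrableS (sL i).
have -> : (fun n => neg_div_density mu sigma (phi n)) = (fun n =>
    \sum_i \int[tv (lambda i)]_x (k i x * (\1_A x * partial i (phi n) x))).
  apply/funext => n; rewrite neg_div_densityE//; apply: eq_bigr => i _.
  have [B HB] := test_bounded (test_partial i (tphi n)).
  have sft : sigma_finite setT (tv (lambda i)).
    exact: finite_sigma_finite (total_variation_fin _).
  have ik : intR (tv (lambda i)) (fun x => \1_A x * k i x).
    apply: intR_indicM => //.
    exact: (intR_bounded (total_variation_fin _) (mk i) (k1 i)).
  have mp : measurable_fun [set: T] (partial i (phi n)).
    exact: test_measurable (test_partial i (tphi n)).
  rewrite (Rint_density_unique sf sft (sL i) ik (setE i) mp HB).
  by apply: eq_Rintegral => x _; ring.
exact: (normal_current_closable lambdaf mk k1 kE tphi gradM cphi mA).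
Qed.

Lemma calS_sub_calV mu : calS mu `<=` calV mu.
Proof.
move=> sigma [sL [lambda acl nl]]; exists lambda => //; split => //.
exists (fun=> czero).
  by move=> i; exists set0; split => //; exact: measure0.
by move=> i A mA; rewrite acl// adde0.
Qed.

End Closability.

(** * Quantitative form of the Arens-Eells condition *)

Section Representation.
Context {R : realType} {d : nat}.
Local Notation T := (borel R d).
Local Notation E := 'rV[R]_d.
Local Notation dirs := (bool * option 'I_d)%type.
Implicit Types (phi psi : E -> R) (L : (E -> R) -> R).

Lemma distributionZ L (a : R) phi : Defs.distribution L -> test_function phi ->
  L (fun x => a * phi x) = a * L phi.
Proof.
move=> [lin _] tphi.
have L0 : L (fun=> 0) = 0.
  have := lin 1 (fun=> 0) (fun=> 0) test_cst0 test_cst0.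
  under eq_fun do rewrite mulr0 addr0.
  lra.
have := lin a phi (fun=> 0) tphi test_cst0.
by rewrite L0 addr0; under eq_fun do rewrite addr0.
Qed.

(** Suppose that the bound fails for all [C = n.+1] at [phi n]. Divided by
    [`|L (phi n)|], the functions [phi n] have gradients bounded by [e^-1] and tend
    to 0 uniformly, while [L] keeps the absolute value 1 on them. *)
Lemma arens_eells_bound L (e : R) : arens_eells L -> 0 < e ->
  exists2 C : R, 0 <= C & forall phi (A B : R), test_function phi -> 0 <= A ->
    (forall i x, `|partial i phi x| <= A) -> (forall x, `|phi x| <= B) ->
    `|L phi| <= e * A + C * B.
Proof.
move=> [dL cL] e0; apply: contrapT => noC.
have /choice[u Hu] : forall n : nat, exists u : (E -> R) * R * R,
    [/\ test_function u.1.1 /\ 0 <= u.1.2, forall i x, `|partial i u.1.1 x| <= u.1.2,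
      forall x, `|u.1.1 x| <= u.2 & e * u.1.2 + n.+1%:R * u.2 < `|L u.1.1|].
  move=> n; apply: contrapT => no; apply: noC; exists n.+1%:R => // phi A B tphi A0 pA pB.
  by rewrite leNgt; apply/negP => lt; apply: no; exists (phi, A, B); split.
pose phi n := (u n).1.1; pose a n := `|L (phi n)|; pose psi n x := (a n)^-1 * phi n x.
have tphi n : test_function (phi n) by have [[]] := Hu n.
have A0 n : 0 <= (u n).1.2 by have [[]] := Hu n.
have B0 n : 0 <= (u n).2 by have [_ _ /(_ 0) h _] := Hu n; exact: le_trans h.
have a0 n : 0 < a n.
  have [_ _ _] := Hu n; apply: le_lt_trans.
  by rewrite addr_ge0// mulr_ge0// ltW.
have tpsi n : test_function (psi n) by exact: test_scale.
have pE n i x : partial i (psi n) x = (a n)^-1 * partial i (phi n) x.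
  have dp y : differentiable (phi n) y by apply: smooth_differentiable; case: (tphi n).
  have dc y : differentiable (fun _ : E => (a n)^-1) y by exact: differentiable_cst.
  by rewrite /psi (partialM i dc dp) partial_cst; ring.
have gradb n i x : `|partial i (psi n) x| <= e^-1.
  rewrite pE normrM ger0_norm ?invr_ge0 ?(ltW (a0 n))//.
  rewrite ler_pdivrMl// -ler_pdivrMr ?invr_gt0// invrK.
  have [_ /(_ i x) h1 _ h2] := Hu n.
  apply: (@le_trans _ _ ((u n).1.2 * e)); first by rewrite ler_wpM2r// ltW.
  apply: le_trans (ltW h2); rewrite mulrC lerDl mulr_ge0//.
have Lpsi : L (psi n) @[n --> \oo] --> (0 : R).
  apply: cL tpsi _ _.
  - exists (Num.sqrt d%:R * e^-1) => n x; apply: (le_trans (enorm_le_norm _)).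
    rewrite ler_wpM2l// ?sqrtr_ge0//; apply: norm_le_coord; first by rewrite invr_ge0 ltW.
    by move=> i; rewrite mxE.
  - move=> x; apply/cvgr0Pnorm_le => r r0.
    near=> n; rewrite /psi normrM ger0_norm ?invr_ge0 ?(ltW (a0 n))//.
    rewrite ler_pdivrMl//; have [_ _ /(_ x) h1 h2] := Hu n.
    apply: (le_trans h1).
    have h3 : n.+1%:R * (u n).2 <= a n.
      by apply: le_trans (ltW h2); rewrite lerDr mulr_ge0// ltW.
    have n1 : r^-1 <= n.+1%:R.
      near: n; exists (Num.bound r^-1) => // n /= Hn; apply: ltW.
      apply: (lt_le_trans (archi_boundP _)); first by rewrite invr_ge0 ltW.
      by rewrite ler_nat (leq_trans Hn).
    rewrite mulrC -ler_pdivrMl//; apply: le_trans h3.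
    by rewrite ler_wpM2r.
have half0 : (0 : R) < 2^-1 by rewrite invr_gt0.
have [N _ /(_ N (leqnn N)) /=] := (cvgr0Pnorm_le _).1 Lpsi _ half0.
rewrite distributionZ// normrM ger0_norm ?invr_ge0 ?(ltW (a0 N))// mulVf ?gt_eqF//.
by rewrite leNgt; case/negP; lra.
Unshelve. all: by end_near. Qed.

Lemma bounded_slices (J : finType) (h : E * J -> R) :
  (forall j, bounded_real (fun x => h (x, j))) -> bounded_real h.
Proof.
move=> /choice[M HM]; exists (\sum_j M j) => -[x j].
rewrite (bigD1 j)//=; apply: (le_trans (HM j x)); rewrite lerDl.
by apply: sumr_ge0 => k _; exact: le_trans (HM k 0).
Qed.

(** The weighted first jet of [phi] with both signs, as one function on a sum of
    copies of the space: its supremum is the maximum of [e * sup |partial i phi|]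
    and [C * sup |phi|]. The copy [None] holds the function itself, and the
    booleans are the signs, so that a one-sided supremum bounds absolute values. *)
Definition jet (e C : R) phi (z : E * dirs) : R :=
  (-1) ^+ z.2.1 * (if z.2.2 is Some i then e * partial i phi z.1 else C * phi z.1).

Lemma big_dirs (F : dirs -> R) : \sum_j F j =
  \sum_i (F (false, Some i) + F (true, Some i)) + (F (false, None) + F (true, None)).
Proof.
have optE (G : option 'I_d -> R) : \sum_o G o = \sum_i G (Some i) + G None.
  rewrite (bigD1 None)//= addrC; congr (_ + _).
  rewrite (reindex_omap Some id) /=; last by case.
  by apply: eq_bigl => i; rewrite eqxx.
rewrite (eq_bigr (fun p => F (p.1, p.2))); last by case.
rewrite -(pair_bigA _ (fun b o => F (b, o))) /= big_bool /= !optE big_split /=; ring.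
Qed.

Lemma jet_bounded e C phi : test_function phi -> bounded_real (jet e C phi).
Proof.
move=> tphi; apply: bounded_slices => -[b o]; rewrite /jet /=.
have sgn1 (x : R) : `|(-1) ^+ b * x| = `|x| by rewrite normrMsign.
case: o => [i|].
  have [M HM] := test_bounded (test_partial i tphi); exists (`|e| * M) => x.
  by rewrite sgn1 normrM ler_wpM2l.
have [M HM] := test_bounded tphi; exists (`|C| * M) => x.
by rewrite sgn1 normrM ler_wpM2l.
Qed.

Lemma jet_linear e C (a : R) phi psi : test_function phi -> test_function psi ->
  jet e C (fun x => a * phi x + psi x) = fun z => a * jet e C phi z + jet e C psi z.
Proof.
move=> tphi tpsi; have tap := test_scale a tphi.
have da y : differentiable (fun x => a * phi x) y by apply: smooth_differentiable; case: tap.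
have dp y : differentiable phi y by apply: smooth_differentiable; case: tphi.
have dq y : differentiable psi y by apply: smooth_differentiable; case: tpsi.
have dca y : differentiable (fun _ : E => a) y by exact: differentiable_cst.
apply/funext => -[x [b [i|]]]; rewrite /jet /=; last by ring.
rewrite (partialD i da dq) (partialM i dca dp) partial_cst; ring.
Qed.

(** By [arens_eells_bound], [L phi] is at most the supremum of a jet of [phi],
    so it is a value of a positive functional of the jet. The restrictions of this
    functional to the copies of the space are measures of mass at most 1, and [g i]
    is [e / 2] times the difference of two of their densities. *)
Lemma arens_eells_representation L (e : R) : arens_eells L -> 0 < e ->
  exists (nu : {measure set T -> \bar R}) (g : 'I_d -> T -> R) (g0 : T -> R),
  [/\ (nu setT < +oo)%E, forall i, intR nu (g i) /\ \int[nu]_x `|g i x| <= e, intR nu g0 &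
    forall phi, test_function phi ->
      L phi = \sum_i \int[nu]_x (g i x * partial i phi x) + \int[nu]_x (g0 x * phi x)].
Proof.
move=> aeL e0; have [dL _] := aeL.
pose e1 := e / 2; have e10 : 0 < e1 by rewrite divr_gt0.
have e20 : 0 < e1 / 2 by rewrite divr_gt0.
(* each of the two terms of the bound is at most half the supremum of the jet;
   the added 1 makes [C1] positive *)
have [C C0 HC] := arens_eells_bound aeL e20.
pose C1 := 2 * C + 1; have C10 : 0 < C1 by rewrite /C1; lra.
pose J := jet e1 C1.
pose G0 := [set p | exists2 phi, test_function phi & p = (J phi, L phi)].
have dG0 : dominated_graph G0.
  split.
  - exists (fun=> 0); first exact: test_cst0.
    congr (_, _).
      apply/funext => -[x [b [i|]]]; rewrite /J /jet /= ?partial_cst ?mulr0//.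
    by have := distributionZ 0 dL test_cst0; under eq_fun do rewrite mul0r; rewrite mul0r.
  - move=> a _ _ [phi tphi ->] [psi tpsi ->].
    exists (fun x => a * phi x + psi x); first by apply: testD => //; exact: test_scale.
    by rewrite /J jet_linear//= dL.1.
  - by move=> _ [phi tphi ->]; exact: jet_bounded.
  - move=> _ M [phi tphi ->] /= HM.
    have nM x o : `|if o is Some i then e1 * partial i phi x else C1 * phi x| <= M.
      have h1 := HM (x, (false, o)); have h2 := HM (x, (true, o)).
      rewrite /J /jet /= expr0 mul1r expr1 mulN1r in h1 h2.
      by rewrite ler_norml h1 lerNl h2.
    have M0 : 0 <= M by exact: le_trans (nM 0 None).
    have HA i x : `|partial i phi x| <= M / e1.
      by have := nM x (Some i); rewrite normrM gtr0_norm// ler_pdivlMr// mulrC.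
    have HB x : `|phi x| <= M / C1.
      by have := nM x None; rewrite normrM gtr0_norm// ler_pdivlMr// mulrC.
    have M10 : 0 <= M / e1 by rewrite divr_ge0// ltW.
    apply: (le_trans (ler_norm _)); apply: (le_trans (HC _ _ _ tphi M10 HA HB)).
    have -> : e1 / 2 * (M / e1) = M / 2 by field; rewrite gt_eqF.
    have : C * (M / C1) <= M / 2.
      rewrite mulrA ler_pdivrMr// /C1; nra.
    lra.
have [Lam [Lam_lin Lam_le LamE]] := hahn_banach_sup dG0.
pose ext (j : dirs) (h : E -> R) (z : E * dirs) : R := h z.1 * (z.2 == j)%:R.
have bext j h : bounded_real h -> bounded_real (ext j h).
  move=> [M HM]; exists M => z; rewrite /ext normrM.
  by apply: le_trans (HM z.1); rewrite ler_piMr//; case: eqP => _; rewrite ?normr1 ?normr0.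
pose Lj j h := Lam (ext j h).
have Lj_lin j (a : R) h k : bounded_real h -> bounded_real k ->
    Lj j (fun x => a * h x + k x) = a * Lj j h + Lj j k.
  move=> bh bk; rewrite /Lj -Lam_lin//; [|exact: bext|exact: bext].
  by congr Lam; apply/funext => z; rewrite /ext; ring.
have Lj_pos j h : bounded_real h -> (forall x, 0 <= h x) -> 0 <= Lj j h.
  move=> bh h0.
  have b0 : bounded_real (fun _ : E => 0 : R) by exists 0 => x; rewrite normr0.
  have e00 : Lj j (fun=> 0) = 0.
    have := Lj_lin j 1 _ _ b0 b0; under eq_fun do rewrite mulr0 addr0.
    lra.
  have := Lj_lin j (-1) h _ bh b0; rewrite e00 addr0 mulN1r => H.
  rewrite -oppr_le0 -H; apply: Lam_le; first by apply: bext; exact: bounded_realD.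
  move=> z; rewrite /ext addr0 mulN1r mulNr oppr_le0 mulr_ge0//.
pose m j := riesz_measure (Lj_lin j) (Lj_pos j).
have mle j : (m j setT <= 1)%E.
  apply: (le_trans (riesz_measure_total _ _)); rewrite lee_fin; apply: Lam_le.
    by apply: bext; exists 1 => x; rewrite normr1.
  by move=> z; rewrite /ext mul1r lern1; case: eqP.
have mfin j : (m j setT < +oo)%E by apply: le_lt_trans (mle j) _; exact: ltry.
have [nu nufin m_nu] := dominating_measure mfin.
have /choice[h Hh] := fun j => measure_density (mfin j) nufin (m_nu j).
have ih j : intR nu (h j) by have [] := Hh j.
have h1 j : \int[nu]_x `|h j x| <= 1.
  have [_ H _] := Hh j; apply: (le_trans H).
  have mf : m j setT \is a fin_num by rewrite ge0_fin_numE.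
  by rewrite -lee_fin fineK.
exists nu, (fun i x => e1 * (h (false, Some i) x - h (true, Some i) x)),
  (fun x => C1 * (h (false, None) x - h (true, None) x)).
split => //.
- move=> i; split; first by apply: intRZ; exact: intRB.
  apply: (@le_trans _ _ (\int[nu]_x (e1 * (`|h (false, Some i) x| + `|h (true, Some i) x|)))).
    apply: Rint_le.
    + by apply: intR_norm; apply: intRZ; exact: intRB.
    + by apply: intRZ; apply: intRD; exact: intR_norm.
    + by move=> x; rewrite normrM gtr0_norm// ler_wpM2l ?(ltW e10)// ler_normB.
  rewrite RintegralZl//; last by apply: intRD; exact: intR_norm.
  rewrite RintegralD//; [|exact: intR_norm|exact: intR_norm].
  rewrite [leRHS](_ : e = e1 * (1 + 1)); last by rewrite /e1; field.
  by rewrite ler_wpM2l ?(ltW e10)// lerD.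
- by apply: intRZ; exact: intRB.
move=> phi tphi.
have -> : L phi = Lam (J phi) by rewrite (LamE (J phi, L phi))//; exists phi.
have slice j : bounded_real (fun x => J phi (x, j)).
  by have [M HM] := jet_bounded e1 C1 tphi; exists M.
have -> : Lam (J phi) = \sum_j Lj j (fun x => J phi (x, j)).
  have [_ H] := bounded_lin_sum Lam_lin (index_enum dirs) (fun j => bext j _ (slice j)).
  rewrite -[RHS]H; congr Lam; apply/funext => -[x j].
  rewrite (bigD1 j)//= /ext /= eqxx mulr1 big1 ?addr0// => k kj.
  by rewrite eq_sym (negPf kj) mulr0.
have jE j : Lj j (fun x => J phi (x, j)) = \int[nu]_x (h j x * J phi (x, j)).
  have [r r0 vr] := test_vanishes tphi.
  have vJ : vanishes_off r (fun x => J phi (x, j)).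
    move=> x rx; rewrite /J /jet; case: j.2 => [i|] /=; rewrite ?(vanishes_partial i vr)// ?vr//; by rewrite !mulr0.
  have cJ : continuous (fun x => J phi (x, j)).
    rewrite /J /jet; case: (j.2) => [i|] /=; apply: smooth_continuous.
      by apply: smoothM; [exact: smooth_cst|apply: smoothM; [exact: smooth_cst|case: (test_partial i tphi)]].
    by apply: smoothM; [exact: smooth_cst|apply: smoothM; [exact: smooth_cst|case: tphi]].
  rewrite (riesz (Lj_lin j) (Lj_pos j) cJ (slice j) vJ).
  have [M HM] := slice j; have [_ _ H] := Hh j; apply: (H _ M) => //.
  exact: continuous_borel_measurable.
under eq_bigr do rewrite jE.
have pair_int o (c : R) (p : E -> R) : test_function p ->
    \int[nu]_x (h (false, o) x * ((-1) ^+ false * (c * p x))) +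
    \int[nu]_x (h (true, o) x * ((-1) ^+ true * (c * p x))) =
    \int[nu]_x (c * (h (false, o) x - h (true, o) x) * p x).
  move=> tp; have [M HM] := test_bounded tp; have mp := test_measurable tp.
  have ib b : intR nu (fun x => h (b, o) x * ((-1) ^+ b * (c * p x))).
    apply: (@intRMr _ _ _ nu (fun x : T => (-1) ^+ b * (c * p x)) _ (`|c| * M)) => //.
      by apply: measurable_funM => //; exact: measurable_funM.
    by move=> x; rewrite normrMsign normrM ler_wpM2l.
  rewrite -(RintegralD measurableT (ib false) (ib true)).
  by apply: eq_Rintegral => x _; rewrite /=; ring.
rewrite big_dirs; congr (_ + _).
- by apply: eq_bigr => i _; apply: pair_int; exact: test_partial.
- exact: pair_int.
Qed.

End Representation.

(** * Compactly supported currents and truncation *)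

Section Localization.
Context {R : realType} {d : nat}.
Local Notation T := (borel R d).
Implicit Types (f : {charge set T -> \bar R}) (mu nu : {measure set T -> \bar R}).
Implicit Types (lambda : 'I_d -> {charge set T -> \bar R}).
Implicit Types (sigma : 'rV[R]_d -> 'rV[R]_d) (p q phi : 'rV[R]_d -> R).

Lemma charge_integral_local f p q (B : set T) (M : R) : measurable B ->
  (forall A, measurable A -> A `<=` B -> f A = 0%E) ->
  measurable_fun [set: T] p -> measurable_fun [set: T] q ->
  (forall x, `|p x| <= M) -> (forall x, `|q x| <= M) ->
  (forall x, ~ B x -> p x = q x) ->
  charge_integral f p = charge_integral f q.
Proof.
move=> mB fB mp mq pM qM pq.
have [k [mk k1 _ kE]] := charge_integral_polar f.
rewrite (kE p M mp pM) (kE q M mq qM).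
apply: Rint_ae_eq; [exact: measurable_funM..|].
exists B; split; [exact: mB|exact: tv_null|].
move=> x; apply: contra_notP => Bx /=; congr (_ * _); exact: pq.
Qed.

Lemma charge_integral_cst f (c : R) : charge_integral f (fun=> c) = c * fine (f setT).
Proof.
have [k [mk k1 fE kE]] := charge_integral_polar f.
rewrite (kE (fun=> c) `|c|)//.
have ik := intR_bounded (total_variation_fin f) mk k1.
under eq_Rintegral do rewrite mulrC.
by rewrite RintegralZl// fE.
Qed.

(** The total mass of the divergence is 0, because it can be computed on a test
    function that is constant where the current lives. The first moment is finite
    as everything happens in a ball. *)
Lemma normal_current_bounded lambda f (r : R) : 0 <= r ->
  (forall phi, test_function phi -> neg_div lambda phi = charge_integral f phi) ->
  (forall A, measurable A -> A `<=` far r -> f A = 0%E) ->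
  (forall i A, measurable A -> A `<=` far r -> lambda i A = 0%E) ->
  normal_current lambda.
Proof.
move=> r0 lambdaf ff fl; exists f => //; apply: (M01_bounded _ ff).
have r10 : 0 <= r + 1 by rewrite addr_ge0.
have t1 := plateau_test r10 : test_function (@plateau R d (r + 1)).
have e1 : charge_integral f (plateau (r + 1)) = fine (f setT).
  rewrite -[RHS]mul1r -charge_integral_cst.
  apply: (charge_integral_local (far_measurable r) ff (M := 1)) => //.
  - exact: test_measurable.
  - by move=> x; rewrite ger0_norm ?plateau_ge0 ?plateau_le1.
  - by move=> x; rewrite normr1.
  - by move=> x /negP; rewrite -leNgt => xr; rewrite plateau_in// (le_trans xr)// lerDl.
have : neg_div lambda (plateau (r + 1)) = 0.
  rewrite /neg_div big1// => i _; rewrite -[RHS](mul0r (fine (lambda i setT))) -charge_integral_cst.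
  have [M HM] := test_bounded (test_partial i t1).
  apply: (charge_integral_local (far_measurable r) (fl i) (M := M)) => //.
  - exact: test_measurable (test_partial i t1).
  - by move=> x; rewrite normr0; exact: le_trans (HM x).
  - move=> x /negP; rewrite -leNgt => xr; rewrite partial_plateau_in// (le_lt_trans xr)//.
    by rewrite ltrDl.
rewrite lambdaf// e1 => /eqP; rewrite fine_eq0 ?fin_num_measure//.
by move/eqP.
Qed.

Lemma neg_div_cst0 phi : test_function phi ->
  neg_div (fun=> czero : {charge set T -> \bar R}) phi =
  charge_integral (czero : {charge set T -> \bar R}) phi.
Proof.
move=> tphi.
have z (q : 'rV[R]_d -> R) : test_function q -> charge_integral (czero : {charge set T -> \bar R}) q = 0.
  move=> tq; have [M HM] := test_bounded tq.
  rewrite -[RHS](mul0r (fine ((czero : {charge set T -> \bar R}) setT))) -charge_integral_cst.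
  apply: (charge_integral_local measurableT (M := M)) => //.
  - exact: test_measurable.
  - by move=> x; rewrite normr0; exact: le_trans (HM x).
  - by move=> x [].
by rewrite z// /neg_div big1// => i _; apply: z; exact: test_partial.
Qed.

Lemma calS0 mu : calS mu (fun=> 0).
Proof.
split; first by move=> i; under eq_fun do rewrite mxE; exact: integrable0.
exists (fun=> czero).
  by move=> i A mA; under eq_integral do rewrite mxE; rewrite integral0.
exact: (normal_current_bounded (lexx 0) neg_div_cst0).
Qed.

Definition charge_diff f1 f2 : {charge set T -> \bar R} :=
  [the charge T R of cadd f1 (cscale (-1) f2)].

Lemma charge_diffE f1 f2 A : charge_diff f1 f2 A = (f1 A + (-1)%:E * f2 A)%E.
Proof. by []. Qed.

Lemma charge_integral_diff mu nu (a b : T -> R) (ia : intR mu a) (ib : intR nu b)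
    (p : T -> R) (M : R) : sigma_finite setT mu -> sigma_finite setT nu ->
  measurable_fun [set: T] p -> (forall x, `|p x| <= M) ->
  charge_integral (charge_diff (induced_charge ia) (induced_charge ib)) p =
  \int[mu]_x (a x * p x) - \int[nu]_x (b x * p x).
Proof.
move=> sf sf' mp pM.
rewrite (charge_integral_linear (f1 := induced_charge ia) (f2 := induced_charge ib) (a := -1) _ mp pM)//.
by rewrite (charge_integral_induced _ sf mp pM) (charge_integral_induced _ sf' mp pM) mulN1r.
Qed.

Lemma induced_charge_null mu (a : T -> R) (ia : intR mu a) A :
  measurable A -> mu A = 0%E -> induced_charge ia A = 0%E.
Proof.
move=> mA A0; apply: null_set_integral => //.
by apply: measurable_funTS; exact: measurable_int ia.
Qed.

Lemma induced_charge_far mu (a : T -> R) (ia : intR mu a) (B A : set T) :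
  measurable A -> A `<=` B -> (forall x, B x -> a x = 0) -> induced_charge ia A = 0%E.
Proof.
move=> mA AB a0; rewrite /induced_charge; apply: integral0_eq => x /AB/a0 /= ->.
by [].
Qed.

Lemma charge_diff_far mu nu (a b : T -> R) (ia : intR mu a) (ib : intR nu b) (B A : set T) :
  measurable A -> A `<=` B -> (forall x, B x -> a x = 0) -> (forall x, B x -> b x = 0) ->
  charge_diff (induced_charge ia) (induced_charge ib) A = 0%E.
Proof.
move=> mA AB a0 b0.
transitivity (0 + (-1)%:E * 0 : \bar R)%E; last by rewrite mule0 adde0.
exact: (congr2 (fun u v => u + (-1)%:E * v)%E (induced_charge_far ia mA AB a0)
  (induced_charge_far ib mA AB b0)).
Qed.

Section Truncation.
Variables (mu nu : {measure set T -> \bar R}) (sigma : 'rV[R]_d -> 'rV[R]_d).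
Variables (g : 'I_d -> T -> R) (g0 : T -> R) (r : R).
Hypotheses (sf : sigma_finite setT mu) (nufin : (nu setT < +oo)%E) (r0 : 0 <= r).
Hypotheses (sL : L1vec mu sigma) (ig : forall i, intR nu (g i)) (ig0 : intR nu g0).
Hypothesis rep : forall phi, test_function phi -> neg_div_density mu sigma phi =
  \sum_i \int[nu]_x (g i x * partial i phi x) + \int[nu]_x (g0 x * phi x).

Let chi := @plateau R d r.
Let tchi : test_function chi := plateau_test r0.
Let mchi : measurable_fun [set: T] chi := test_measurable tchi.
Let chi1 x : `|chi x| <= 1.
Proof. by rewrite ger0_norm ?plateau_ge0 ?plateau_le1. Qed.
Let sfnu : sigma_finite setT nu := finite_sigma_finite nufin.

Let isg i : intR mu (fun x : T => chi x * sigma x 0 i) := intRM mchi chi1 (sL i).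
Let igc i : intR nu (fun x : T => chi x * g i x) := intRM mchi chi1 (ig i).

(** The current [chi (sigma mu - g nu)]. *)
Definition truncated_current i : {charge set T -> \bar R} :=
  charge_diff (induced_charge (isg i)) (induced_charge (igc i)).

Let iG : intR nu (fun x => g0 x * chi x + \sum_i g i x * partial i chi x).
Proof.
apply: intRD; first exact: (intRMr mchi chi1 ig0).
apply: intR_sum => i; have [M HM] := test_bounded (test_partial i tchi).
exact: (intRMr (test_measurable (test_partial i tchi)) HM (ig i)).
Qed.

Let iS : intR mu (fun x : T => \sum_i sigma x 0 i * partial i chi x).
Proof.
apply: intR_sum => i; exact: (intR_density_test i sL (test_partial i tchi)).
Qed.

(** As [L = - div (sigma mu)] is [g0 nu - div (g nu)], the current
    [sigma mu - g nu] has divergence [- g0 nu], a measure. The cut-off adds to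
    [g0 chi nu] the terms with the derivatives of [chi], which are measures
    too. *)
Lemma truncated_current_normal : normal_current truncated_current.
Proof.
have vchi := plateau_out r0 : vanishes_off (r + 1) chi.
have r10 : 0 <= r + 1 by rewrite addr_ge0.
apply: (@normal_current_bounded _ (charge_diff (induced_charge iG) (induced_charge iS)) _ r10).
- move=> phi tphi; have [M HM] := test_bounded tphi.
  rewrite (charge_integral_diff iG iS sfnu sf (test_measurable tphi) HM).
  have tcp : test_function (fun x => chi x * phi x) by apply: test_mul_smooth => //; case: tchi.
  have pE i x : partial i (fun x => chi x * phi x) x =
      chi x * partial i phi x + phi x * partial i chi x.
    have dc y : differentiable chi y by apply: smooth_differentiable; case: tchi.
    have dp y : differentiable phi y by apply: smooth_differentiable; case: tphi.
    by rewrite (partialM i dc dp).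
  have tpp i := test_partial i tphi; have tpc i := test_partial i tchi.
  have mphi := test_measurable tphi.
  have bnu (h : T -> R) q : intR nu h -> test_function q -> intR nu (fun x => h x * q x).
    by move=> ih tq; have [B HB] := test_bounded tq; exact: (intRMr (test_measurable tq) HB ih).
  have bmu i q : test_function q -> intR mu (fun x : T => sigma x 0 i * q x).
    by move=> tq; exact: intR_density_test.
  have tchip i : test_function (fun x => chi x * partial i phi x).
    by apply: test_mul_smooth => //; case: tchi.
  have tpchi i : test_function (fun x => phi x * partial i chi x).
    by apply: test_mul_smooth => //; case: tphi.
  have := rep tcp; rewrite neg_div_densityE//.
  under eq_bigr => i _.
    under eq_Rintegral do rewrite pE mulrDr.
    rewrite (RintegralD measurableT (bmu i _ (tchip i)) (bmu i _ (tpchi i))).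
    over.
  rewrite big_split /=.
  under [X in _ = X + _]eq_bigr => i _.
    under eq_Rintegral do rewrite pE mulrDr.
    rewrite (RintegralD measurableT (bnu _ _ (ig i) (tchip i)) (bnu _ _ (ig i) (tpchi i))).
    over.
  rewrite big_split /=.
  have -> : \int[nu]_x ((g0 x * chi x + \sum_i g i x * partial i chi x) * phi x) =
     \int[nu]_x (g0 x * (chi x * phi x)) + \sum_i \int[nu]_x (g i x * (phi x * partial i chi x)).
    rewrite -Rint_sum; last by move=> i; exact: bnu.
    rewrite -RintegralD//; [|exact: bnu|by apply: intR_sum => i; exact: bnu].
    apply: eq_Rintegral => x _; rewrite mulrDl mulr_suml; congr (_ + _); first ring.
    by apply: eq_bigr => i _; ring.
  have -> : \int[mu]_x ((\sum_i sigma x 0 i * partial i chi x) * phi x) =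
     \sum_i \int[mu]_x (sigma x 0 i * (phi x * partial i chi x)).
    rewrite -Rint_sum; last by move=> i; exact: bmu.
    apply: eq_Rintegral => x _; rewrite mulr_suml.
    by apply: eq_bigr => i _; ring.
  have -> : neg_div truncated_current phi =
     \sum_i \int[mu]_x (sigma x 0 i * (chi x * partial i phi x)) -
     \sum_i \int[nu]_x (g i x * (chi x * partial i phi x)).
    rewrite -sumrB; apply: eq_bigr => i _.
    have [B HB] := test_bounded (tpp i).
    rewrite (charge_integral_diff (isg i) (igc i) sf sfnu (test_measurable (tpp i)) HB).
    by congr (_ - _); apply: eq_Rintegral => x _; ring.
  have alg (a b c a' b' : R) : a + b = c + a' + b' -> a - c = b' + a' - b by lra.
  exact: alg.
- move=> A mA Ar.
  have vp i x : far (r + 1) x -> partial i chi x = 0 by move=> h; exact: (vanishes_partial i vchi).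
  apply: (charge_diff_far iG iS mA Ar) => x h.
    by rewrite vchi// mulr0 add0r big1// => i _; rewrite vp// mulr0.
  by rewrite big1// => i _; rewrite vp// mulr0.
- by move=> i A mA Ar; apply: (charge_diff_far (isg i) (igc i) mA Ar) => x h; rewrite vchi// mul0r.
Qed.

(** The set [N] of the Lebesgue decomposition carries the singular part of
    [chi g nu]; the remaining part has a density [w], whose L1 norm is at most
    that of [g]. *)
Lemma truncated_current_density : exists w : 'rV[R]_d -> 'rV[R]_d,
  [/\ calV mu (fun x => chi x *: sigma x - w x), L1vec mu w &
     forall i, \int[mu]_x `|w x 0 i| <= \int[nu]_x `|g i x|].
Proof.
have [N [mN N0 HN]] := lebesgue_decomposition_set mu nufin.
have mNC : measurable (~` N) by exact: measurableC.
have ia i : intR nu (fun x => \1_(~` N) x * (chi x * g i x)) := intR_indicM mNC (igc i).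
have iz i : intR nu (fun x => \1_N x * (chi x * g i x)) := intR_indicM mN (igc i).
have dom i A : measurable A -> mu A = 0%E -> induced_charge (ia i) A = 0%E.
  move=> mA /(HN _ mA) AN; rewrite /induced_charge.
  have -> : (\int[nu]_(t in A) (EFin \o (fun x => \1_(~` N) x * (chi x * g i x))%R) t =
    \int[nu]_(t in A `\` N) (chi t * g i t)%:E)%E.
    rewrite setDE integral_mkcondr; apply: eq_integral => x _ /=.
    by rewrite patchE indicE; case: ifP => _; rewrite ?mul1r ?mul0r.
  apply: null_set_integral => //; first exact: measurableD.
  by apply: measurable_funTS; apply/measurable_EFinP/intR_measurable/igc.
have /choice[w Hw] : forall i, exists w : T -> R, intR mu w /\
    forall A, measurable A -> induced_charge (ia i) A = (\int[mu]_(x in A) (w x)%:E)%E.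
  by move=> i; have [w iw wE] := charge_density sf (dom i); exists w.
have iw i : intR mu (w i) by have [] := Hw i.
exists (fun x => \row_i w i x); split.
- exists truncated_current; first exact: truncated_current_normal.
  split.
    move=> i; under eq_fun do rewrite !mxE.
    exact: (intRB (isg i) (iw i)).
  exists (fun i => [the charge T R of cscale (-1) (induced_charge (iz i))]).
    move=> i; exists N; split => // A mA AN.
    have e0 : induced_charge (iz i) A = 0%E.
      by apply: (induced_charge_far _ mA AN) => x nx; rewrite indicE memNset// mul0r.
    exact: (etrans (congr1 (mule (-1)%:E) e0) (mule0 _)).
  move=> i A mA; rewrite charge_diffE.
  under eq_integral do rewrite !mxE EFinB.
  rewrite integralB//; [|exact: integrableS (isg i)|exact: integrableS (iw i)].
  have [_ /(_ A mA) <-] := Hw i.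
  rewrite /cscale /= /induced_charge.
  have -> : (\int[nu]_(t in A) (EFin \o (fun x => chi x * g i x)%R) t =
     \int[nu]_(t in A) (EFin \o (fun x => \1_(~` N) x * (chi x * g i x))%R) t +
     \int[nu]_(t in A) (EFin \o (fun x => \1_N x * (chi x * g i x))%R) t)%E.
    rewrite -integralD//; [|exact: integrableS (ia i)|exact: integrableS (iz i)].
    apply: eq_integral => x _ /=; rewrite -EFinD -mulrDl !indicE in_setC.
    by case: (x \in N); rewrite /= ?add0r ?addr0 mul1r.
  rewrite muleDr//; last first.
    apply: fin_num_adde_defl; apply: integrable_fin_num => //; exact: integrableS (iz i).
  by rewrite mulN1e addeA.
- by move=> i; under eq_fun do rewrite mxE; exact: iw.
- move=> i; under eq_Rintegral do rewrite mxE.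
  have [A [mA ->]] := Rint_norm_split (iw i).
  have wE B : measurable B -> \int[mu]_x (\1_B x * w i x) =
      \int[nu]_x (\1_B x * (\1_(~` N) x * (chi x * g i x))).
    move=> mB; apply: EFin_inj; rewrite (Rint_setE mB (iw i)) (Rint_setE mB (ia i)).
    by have [_ <-] := Hw i.
  rewrite !wE//; last exact: measurableC.
  rewrite -RintegralB//; [|exact: intR_indicM|by apply: intR_indicM => //; exact: measurableC].
  apply: (le_trans (ler_norm _)); apply: Rint_norm_le.
  + apply: measurable_funB; apply: intR_measurable; apply: intR_indicM => //.
    exact: measurableC.
  + exact: intR_norm.
  + move=> x; rewrite -mulrBl normrM mulrA normrM -[leRHS]mul1r mulrA ler_wpM2r//.
    rewrite -[leRHS]mul1r normrM mulrA ler_pM//.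
    rewrite -[leRHS]mul1r ler_pM// ?indic_bound// !indicE in_setC.
    by case: (x \in A); rewrite /= ?subr0 ?sub0r ?normrN normr1.
Qed.

End Truncation.

End Localization.

(** * The bundles V and T coincide *)

Section TangentIsV.
Context {R : realType} {d : nat}.
Local Notation T := (borel R d).
Local Notation E := 'rV[R]_d.
Implicit Types (mu : {measure set T -> \bar R}) (sigma : E -> E).

(** The series of the L1 norms converges, so the series of the functions
    converges absolutely almost everywhere. *)
Lemma ae_cvg0_summable mu (w : nat -> T -> R) :
  (forall n, intR mu (w n)) -> (forall n, \int[mu]_x `|w n x| <= 2^-1 ^+ n.+1) ->
  {ae mu, forall x, w n x @[n --> \oo] --> (0 : R)}.
Proof.
move=> iw w2; pose F x := (\sum_(n <oo) `|w n x|%:E)%E.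
have mw n : measurable_fun [set: T] (fun x => (`|w n x|)%:E).
  by apply/measurable_EFinP; apply: measurableT_comp => //; exact: intR_measurable.
have sum2 n : (\sum_(0 <= k < n) (2^-1 ^+ k.+1 : R)) = 1 - 2^-1 ^+ n.
  elim: n => [|n IH]; first by rewrite big_nil expr0 subrr.
  by rewrite big_nat_recr//= IH exprS; field.
have IF : (\int[mu]_x F x <= 1)%E.
  rewrite /F integral_nneseries//; apply: lime_le.
    by apply: is_cvg_nneseries => n _ _; apply: integral_ge0.
  near=> n; apply: (@le_trans _ _ (\sum_(0 <= k < n) (2^-1 ^+ k.+1)%:E)%E).
    apply: lee_sum => k _; rewrite -[leLHS]fineK ?lee_fin; first exact: w2.
    apply: integrable_fin_num => //; exact: intR_norm.
  by rewrite sumEFin lee_fin sum2 gerBl exprn_ge0.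
have mF : measurable_fun [set: T] F.
  by apply: ge0_emeasurable_sum.
have iF : mu.-integrable [set: T] F.
  apply/integrableP; split => //.
  under eq_integral do rewrite gee0_abs ?nneseries_ge0//.
  by apply: le_lt_trans IF _; exact: ltry.
have := integrable_ae measurableT iF; apply: filterS => x /(_ I) Fx.
have Fx0 : (0 <= F x)%E by exact: nneseries_ge0.
suff : `|w n x| @[n --> \oo] --> (0 : R) by move=> H; apply: norm_cvg0.
apply: cvg_series_cvg_0; apply: nondecreasing_is_cvgn.
  by apply: nondecreasing_series.
exists (fine (F x)) => _ [n _ <-]; rewrite -lee_fin fineK//.
by rewrite /series /= -sumEFin; apply: nneseries_lim_ge.
Unshelve. all: by end_near. Qed.

Lemma ae_combine mu (P Q S : T -> Prop) : (forall x, P x -> Q x -> S x) ->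
  {ae mu, forall x, P x} -> {ae mu, forall x, Q x} -> {ae mu, forall x, S x}.
Proof. by move=> PQS; exact: filterS2. Qed.

Lemma L1vec_measurable mu sigma : L1vec mu sigma -> vec_measurable sigma.
Proof. by move=> sL i; exact: intR_measurable (sL i). Qed.

Lemma calT_measurable mu sigma : calT mu sigma -> vec_measurable sigma.
Proof. by case=> sL _; exact: L1vec_measurable sL. Qed.

Lemma calV_measurable mu sigma : calV mu sigma -> vec_measurable sigma.
Proof. by case=> lambda _ [sL _]; exact: L1vec_measurable sL. Qed.

Lemma bundleV_ess_union mu : sigma_finite setT mu ->
  is_ess_union mu (calV mu) (bundleV mu).
Proof.
move=> sf; apply: ess_union_exists => //; last exact: calV_measurable.
by exists (fun=> 0); apply: calS_sub_calV; exact: calS0.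
Qed.

Lemma bundleT_ess_union mu : sigma_finite setT mu ->
  is_ess_union mu (calT mu) (bundleT mu).
Proof.
move=> sf; apply: ess_union_exists => //; last exact: calT_measurable.
by exists (fun=> 0); apply: calV_sub_calT => //; apply: calS_sub_calV; exact: calS0.
Qed.

Lemma calT_approx mu sigma : sigma_finite setT mu -> calT mu sigma ->
  exists w : nat -> E -> E,
    (forall n, calV mu (fun x => plateau n%:R x *: sigma x - w n x)) /\
    forall i, {ae mu, forall x, w n x 0 i @[n --> \oo] --> (0 : R)}.
Proof.
move=> sf [sL aeL].
have /choice[w Hw] : forall n : nat, exists w : E -> E,
    [/\ calV mu (fun x => plateau n%:R x *: sigma x - w x), L1vec mu w &
      forall i, \int[mu]_x `|w x 0 i| <= 2^-1 ^+ n.+1].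
  move=> n; have e0 : 0 < 2^-1 ^+ n.+1 :> R by rewrite exprn_gt0.
  have [nu [g [g0 [nufin ig ig0 rep]]]] := arens_eells_representation aeL e0.
  have ig' i : intR nu (g i) by case: (ig i).
  have [w [wV wL wg]] := truncated_current_density sf nufin (ler0n R n) sL ig' ig0 rep.
  by exists w; split => // i; apply: (le_trans (wg i)); case: (ig i).
exists w; split; first by move=> n; case: (Hw n).
move=> i; apply: (@ae_cvg0_summable mu (fun n x => w n x 0 i)).
  by move=> n; case: (Hw n) => _ wL _; exact: wL.
by move=> n; case: (Hw n) => _ _; exact.
Qed.

(** The fields given by [calT_approx] are selected by V almost everywhere, and so
    is their limit since the fibres are closed. *)
Lemma calT_selectable mu : sigma_finite setT mu ->
  closed_selectable mu (calT mu) (bundleV mu).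
Proof.
move=> sf; have [[clV mV selV] _] := bundleV_ess_union sf; split => // sigma Tsigma.
have [w [wV w0]] := calT_approx sf Tsigma.
have aeV : {ae mu, forall x, forall n, bundleV mu x (plateau n%:R x *: sigma x - w n x)}.
  by apply: ae_foralln => n; exact: selV (wV n).
have aew : {ae mu, forall x, forall i, w n x 0 i @[n --> \oo] --> (0 : R)}.
  have : forall k : nat, {ae mu, forall x, if insub k is Some i then w n x 0 i @[n --> \oo] --> (0 : R) else True}.
    move=> k; case: insub => [i|]; first exact: w0.
    exact: aeW.
  move=> /ae_foralln; apply: filterS => x H i.
  by have := H (i : nat); rewrite valK.
apply: ae_combine aeV aew => x Vx wx.
apply: (@closed_cvg _ _ \oo _ (fun n : nat => plateau n%:R x *: sigma x - w n x) (bundleV mu x)) => //.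
  by near=> n; exact: Vx.
have wx0 : w n x @[n --> \oo] --> (0 : E).
  apply/cvgr0Pnorm_le => e e0.
  have : \forall n \near \oo, forall i : 'I_d, `|w n x 0 i| <= e.
    by apply: filter_forall => i; move/cvgr0Pnorm_le: (wx i); exact.
  by apply: filterS => n Hn; apply: norm_le_coord => //; exact: ltW.
have px : plateau n%:R x *: sigma x @[n --> \oo] --> sigma x.
  by rewrite -[X in _ --> X]scale1r; apply: cvgZr_tmp; exact: plateau_cvg1.
by have := cvgB px wx0; rewrite subr0; exact.
Unshelve. all: by end_near. Qed.

Lemma closed_selectable_sub mu (calW calW' : set (E -> E)) (W : E -> set E) :
  calW `<=` calW' -> closed_selectable mu calW' W -> closed_selectable mu calW W.
Proof. by move=> sub [cW mW sW]; split => // sigma /sub; exact: sW. Qed.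

Lemma bundleV_eq_bundleT mu : sigma_finite setT mu ->
  {ae mu, forall x, bundleV mu x = bundleT mu x}.
Proof.
move=> sf; have [sV minV] := bundleV_ess_union sf; have [sT minT] := bundleT_ess_union sf.
have := minV _ (closed_selectable_sub (calV_sub_calT sf) sT).
have := minT _ (calT_selectable sf).
by apply: ae_combine => x h1 h2; exact/seteqP.
Qed.

End TangentIsV.

(** * Finite measures with compact support *)

Section CompactSupport.
Context {R : realType} {d : nat}.
Local Notation T := (borel R d).
Local Notation E := 'rV[R]_d.
Implicit Types (mu : {measure set T -> \bar R}) (sigma : E -> E).

Lemma conj_exp_ge1 (p : R) : 1 < p -> 1 <= conj_exp p.
Proof.
by move=> p1; rewrite /conj_exp ler_pdivlMr ?subr_gt0// mul1r gerBl.
Qed.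

Lemma conj_exp_nonincreasing (p q : R) : 1 < p -> p <= q -> conj_exp q <= conj_exp p.
Proof.
move=> p1 pq; rewrite /conj_exp ler_pdivrMr ?subr_gt0//; last exact: lt_le_trans pq.
rewrite mulrAC ler_pdivlMr ?subr_gt0//; nra.
Qed.

(** The complement of the support is the union of the null rational cubes. *)
Lemma msupportC_negligible mu : mu.-negligible (~` msupport mu : set T).
Proof.
pose F (n : nat) : set T :=
  if unpickle n is Some p then if mu (rat_cube p) == 0%E then rat_cube p else set0 else set0.
have F0 n : mu.-negligible (F n).
  rewrite /F; case: unpickle => [p|]; last exact: negligible_set0.
  case: eqP => [p0|_]; last exact: negligible_set0.
  by apply/negligibleP => //; apply: open_borel; exact: box_open.
apply: negligibleS (negligible_bigcup F0) => x.
move=> /existsNP[U /not_implyP[oU /not_implyP[Ux muU]]].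
have [p [px pU]] := rat_cube_nbhs oU Ux; exists (pickle p) => //; rewrite /F pickleK.
have U0 : mu U = 0%E by apply/eqP; rewrite eq_le measure_ge0 andbT leNgt; apply/negP.
have p0 : (mu (rat_cube p) <= 0)%E.
  rewrite -U0; apply: le_measure => //; rewrite inE; apply: open_borel => //.
  exact: box_open.
by rewrite eq_le p0 measure_ge0.
Qed.

Lemma calTp_sub_calS mu (p : R) : (mu setT < +oo)%E -> compact (msupport mu) -> 1 < p ->
  calTp p mu `<=` calS mu.
Proof.
move=> mufin cK p1 sigma [sLp [g gLp gE]].
have muT : mu setT \is a fin_num by rewrite ge0_fin_numE.
have L1 (h : T -> R) : h \in Lfun mu (conj_exp p)%:E -> intR mu h.
  move=> hp; apply/Lfun1_integrable.
  by apply: (Lfun_subset _ _ muT _ hp); rewrite ?lee_fin ?conj_exp_ge1.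
have sL : L1vec mu sigma by move=> i; exact: L1.
have ig := L1 _ gLp.
have [r r0 Kr] : exists2 r : R, 0 <= r & forall x, msupport mu x -> `|x| <= r.
  have [M [Mr H]] := compact_bounded cK.
  exists (`|M| + 1); first by rewrite addr_ge0.
  by move=> x Kx; apply: (H (`|M| + 1)) => //; rewrite ltr_pwDr// ler_norm.
have far0 A : measurable A -> A `<=` far r -> mu A = 0%E.
  move=> mA Ar; apply/eqP; rewrite eq_le measure_ge0 andbT.
  have <- : mu (far r) = 0%E; last first.
    by apply: le_measure; rewrite ?inE//; exact: far_measurable.
  apply/negligibleP; first exact: far_measurable.
  apply: negligibleS (msupportC_negligible mu).
  by move=> x rx Kx; have := Kr x Kx; rewrite leNgt rx.
have sf : sigma_finite setT mu by exact: finite_sigma_finite.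
split => //; exists (fun i => [the charge T R of induced_charge (sL i)]) => //.
apply: (@normal_current_bounded _ _ _ [the charge T R of induced_charge ig] r r0).
- move=> phi tphi; have [M HM] := test_bounded tphi.
  rewrite (charge_integral_induced ig sf (test_measurable tphi) HM) -gE// neg_div_densityE//.
  apply: eq_bigr => i _; have [B HB] := test_bounded (test_partial i tphi).
  by rewrite (charge_integral_induced (sL i) sf (test_measurable (test_partial i tphi)) HB).
- by move=> A mA Ar; apply: induced_charge_null => //; exact: far0.
- by move=> i A mA Ar; apply: induced_charge_null => //; exact: far0.
Qed.

Lemma calTp_nondecreasing mu (p q : R) : (mu setT < +oo)%E -> 1 < p -> p <= q ->
  calTp p mu `<=` calTp q mu.
Proof.
move=> mufin p1 pq sigma [sL [g gL gE]].
have muT : mu setT \is a fin_num by rewrite ge0_fin_numE.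
have q1 : 1 < q by exact: lt_le_trans pq.
have sub (h : T -> R) : h \in Lfun mu (conj_exp p)%:E -> h \in Lfun mu (conj_exp q)%:E.
  apply: (Lfun_subset _ _ muT); rewrite ?lee_fin ?conj_exp_ge1//.
  exact: conj_exp_nonincreasing.
split; first by move=> i; exact: sub.
by exists g => //; exact: sub.
Qed.

Lemma calTp0 mu (p : R) : (mu setT < +oo)%E -> calTp p mu (fun=> 0).
Proof.
move=> mufin.
have z : (fun _ : T => 0 : R) \in Lfun mu (conj_exp p)%:E.
  by have [mu' ->] := pack_finite mufin; exact: (Lfun_cst mu' 0).
split; first by move=> i; under eq_fun do rewrite mxE.
exists (fun=> 0) => // phi tphi; rewrite /neg_div_density.
under eq_Rintegral do under eq_bigr do rewrite mxE mul0r.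
under eq_Rintegral do rewrite big1_eq.
by under [RHS]eq_Rintegral do rewrite mul0r.
Qed.

(** The essential union of the larger family selects the smaller one, hence
    contains its essential union by minimality. *)
Lemma ess_union_mono mu (calW calW' : set (E -> E)) : sigma_finite setT mu ->
  calW !=set0 -> calW `<=` calW' ->
  (forall sigma, calW' sigma -> vec_measurable sigma) ->
  {ae mu, forall x, ess_union mu calW x `<=` ess_union mu calW' x}.
Proof.
move=> sf W0 sub mW'; have W0' : calW' !=set0 by case: W0 => s /sub; exists s.
apply: ess_union_sub => //; first by move=> sigma /sub; exact: mW'.
by apply: closed_selectable_sub sub _; have [] := ess_union_exists sf W0' mW'.
Qed.

Lemma bundleS_sub_bundleT mu : sigma_finite setT mu ->
  {ae mu, forall x, bundleS mu x `<=` bundleT mu x}.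
Proof.
move=> sf; apply: ess_union_mono => //; last exact: calT_measurable.
  by exists (fun=> 0); exact: calS0.
by move=> sigma /calS_sub_calV; exact: calV_sub_calT.
Qed.

Lemma calS_measurable mu sigma : calS mu sigma -> vec_measurable sigma.
Proof. by case=> sL _; exact: L1vec_measurable sL. Qed.

Lemma bundleTp_sub_bundleS mu (p : R) : (mu setT < +oo)%E -> compact (msupport mu) ->
  1 < p -> {ae mu, forall x, bundleTp p mu x `<=` bundleS mu x}.
Proof.
move=> mufin cK p1; apply: ess_union_mono.
- exact: finite_sigma_finite.
- by exists (fun=> 0); exact: calTp0.
- exact: calTp_sub_calS.
- exact: calS_measurable.
Qed.

Lemma bundleTp_mono mu (p q : R) : (mu setT < +oo)%E -> 1 < p -> p <= q ->
  {ae mu, forall x, bundleTp p mu x `<=` bundleTp q mu x}.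
Proof.
move=> mufin p1 pq; apply: ess_union_mono.
- exact: finite_sigma_finite.
- by exists (fun=> 0); exact: calTp0.
- exact: calTp_nondecreasing.
- move=> sigma [sL _] i; have := sL i; rewrite inE => /andP[+ _].
  by rewrite inE.
Qed.

End CompactSupport.

(** * Small functions with slope one *)

Section Sawtooth.
Context {R : realType}.

(** On [k, k+1], for [k < N], this is [s - k] multiplied by a cut-off that is 1
    except near the end points, within [eta] of which it falls to 0. *)
Definition sawtooth (N : nat) (eta s : R) : R :=
  \sum_(k < N) (s - k%:R) *
    (smooth_step (eta^-1 * (s - k%:R)) * smooth_step (eta^-1 * (k.+1%:R - s))).

Lemma sawtooth_term_out (eta s : R) (k : nat) : 0 < eta -> ~~ (k%:R < s < k.+1%:R) ->
  (s - k%:R) * (smooth_step (eta^-1 * (s - k%:R)) * smooth_step (eta^-1 * (k.+1%:R - s))) = 0.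
Proof.
move=> eta0; rewrite negb_and -!leNgt => /orP[h|h].
  rewrite (@smooth_step_le0 _ (eta^-1 * (s - k%:R))) ?mul0r ?mulr0//.
  by rewrite pmulr_rle0 ?invr_gt0// subr_le0.
rewrite (@smooth_step_le0 _ (eta^-1 * (k.+1%:R - s))) ?mulr0//.
by rewrite pmulr_rle0 ?invr_gt0// subr_le0.
Qed.

Lemma sawtooth_single (N : nat) (eta s : R) (j : 'I_N) : 0 < eta -> j%:R < s < j.+1%:R ->
  sawtooth N eta s = (s - j%:R) *
    (smooth_step (eta^-1 * (s - j%:R)) * smooth_step (eta^-1 * (j.+1%:R - s))).
Proof.
move=> eta0 /andP[js sj]; rewrite /sawtooth (bigD1 j)//= big1 ?addr0// => k kj.
apply: sawtooth_term_out => //; apply/negP => /andP[ks sk].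
have h1 := lt_trans ks sj; have h2 := lt_trans js sk.
rewrite ltr_nat ltnS in h1; rewrite ltr_nat ltnS in h2.
by move/eqP: kj; apply; apply/val_inj/eqP; rewrite /= eqn_leq h1 h2.
Qed.

Lemma sawtooth_le1 (N : nat) (eta s : R) : 0 < eta -> `|sawtooth N eta s| <= 1.
Proof.
move=> eta0; have [[j js]|no] := pselect (exists j : 'I_N, j%:R < s < j.+1%:R).
  rewrite (sawtooth_single eta0 js); case/andP: js; rewrite -natr1 => h1 h2.
  rewrite natr1 normrM -[leRHS]mul1r ler_pM//; first by rewrite ger0_norm; lra.
  rewrite normrM !ger0_norm ?smooth_step_ge0//.
  by rewrite -[leRHS]mul1r ler_pM ?smooth_step_ge0 ?smooth_step_le1.
rewrite /sawtooth big1 ?normr0// => k _; apply: sawtooth_term_out => //.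
by apply/negP => h; apply: no; exists k.
Qed.

Lemma sawtooth_linear (N : nat) (eta s : R) (j : 'I_N) : 0 < eta ->
  j%:R + eta <= s <= j.+1%:R - eta -> sawtooth N eta s = s - j%:R.
Proof.
move=> eta0 /andP[h1 h2]; rewrite (@sawtooth_single _ _ _ j)//; last by apply/andP; split; lra.
by rewrite !smooth_step_ge1 ?mulr1// mulrC ler_pdivlMr// mul1r; lra.
Qed.

Lemma sawtooth_smooth d (N : nat) (eta : R) (f : 'rV[R]_d -> R) : smooth f ->
  smooth (fun x => sawtooth N eta (f x)).
Proof.
move=> sf; apply: smooth_sum => k.
have s1 : smooth (fun x => f x - k%:R) by apply: smoothD => //; exact: smooth_cst.
have s2 : smooth (fun x => k.+1%:R - f x).
  apply: smoothD; first exact: smooth_cst.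
  under eq_fun do rewrite -mulN1r; apply: smoothM => //; exact: smooth_cst.
apply: smoothM => //; apply: smoothM; apply: smooth_step_smooth; apply: smoothM => //;
  exact: smooth_cst.
Qed.

(** A function of size [N^-1] of one coordinate, with slope 1 except near the
    multiples of [N^-1]. *)
Definition comb d (i0 : 'I_d) (N : nat) (eta : R) (x : 'rV[R]_d) : R :=
  N%:R^-1 * sawtooth N eta (N%:R * x 0 i0).

Lemma comb_smooth d (i0 : 'I_d) N eta : smooth (comb i0 N eta).
Proof.
apply: smoothM; first exact: smooth_cst.
apply: sawtooth_smooth; have := @smooth_affine R d N%:R 0 i0.
by under eq_fun do rewrite addr0.
Qed.

Lemma comb_le d (i0 : 'I_d) N (eta : R) x : 0 < eta -> `|comb i0 N eta x| <= N%:R^-1.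
Proof.
move=> eta0; rewrite normrM ger0_norm ?invr_ge0// -[leRHS]mulr1 ler_wpM2l ?invr_ge0//.
exact: sawtooth_le1.
Qed.

Lemma partial_comb d (i0 i : 'I_d) N (eta : R) (x : 'rV[R]_d) (j : 'I_N) : 0 < eta ->
  j%:R + eta < N%:R * x 0 i0 < j.+1%:R - eta -> partial i (comb i0 N eta) x = (i == i0)%:R.
Proof.
move=> eta0 /andP[h1 h2].
have N0 : 0 < N%:R :> R by rewrite ltr0n; apply: leq_ltn_trans (ltn_ord j).
rewrite /partial (@near_eq_derive _ _ _ _ (fun y : 'rV[R]_d => y 0 i0 + - (N%:R^-1 * j%:R))).
  have dc y : differentiable (fun z : 'rV[R]_d => z 0 i0) y by exact: differentiable_coord.
  have dk y : differentiable (fun _ : 'rV[R]_d => - (N%:R^-1 * j%:R) : R) y.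
    exact: differentiable_cst.
  have := partialD i dc dk; rewrite partial_coord partial_cst => /(congr1 (fun f => f x)) /=.
  by rewrite addr0.
have o : open [set y : 'rV[R]_d | j%:R + eta < N%:R * y 0 i0 < j.+1%:R - eta].
  have -> : [set y : 'rV[R]_d | j%:R + eta < N%:R * y 0 i0 < j.+1%:R - eta] =
    (fun y : 'rV[R]_d => N%:R * y 0 i0) @^-1` `]j%:R + eta, j.+1%:R - eta[.
    by apply/seteqP; split => y /=; rewrite in_itv.
  apply: open_comp; last exact: interval_open.
  move=> y _; have := smooth_continuous (@smooth_affine R d N%:R 0 i0) (x := y).
  by under eq_fun do rewrite addr0.
have : nbhs x [set y : 'rV[R]_d | j%:R + eta < N%:R * y 0 i0 < j.+1%:R - eta].
  by apply: open_nbhs_nbhs; split => //; apply/andP.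
apply: filterS => y /andP[y1 y2]; rewrite /comb (@sawtooth_linear _ _ _ j)//.
  by rewrite mulrBr mulrA mulVf ?gt_eqF// mul1r.
by rewrite !ltW.
Qed.

End Sawtooth.

(** * A fat Cantor set *)

Section FatCantor.
Context {R : realType}.
Local Notation leb := (@lebesgue_measure R).

(** Small enough for the removed intervals, at most [2 * n.+1] of them of length
    [2 * gap n / n.+1] at stage [n], to have total length at most one half. *)
Definition gap (n : nat) : R := 2^-1 ^+ n.+4.

Lemma gap_gt0 n : 0 < gap n. Proof. by rewrite exprn_gt0. Qed.

Definition tooth (n j : nat) : set R :=
  [set` `[(j%:R - gap n) / n.+1%:R, (j%:R + gap n) / n.+1%:R]].

Definition removed (n : nat) : set R := \big[setU/set0]_(j < n.+2) tooth n j.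

Definition fat_cantor : set R := [set` `[0, 1]] `\` \bigcup_n removed n.

Lemma removed_measurable n : measurable (removed n).
Proof. by apply: bigsetU_measurable => j _; exact: measurable_itv. Qed.

Lemma fat_cantor_measurable : measurable fat_cantor.
Proof.
apply: measurableD; first exact: measurable_itv.
by apply: bigcupT_measurable => n; exact: removed_measurable.
Qed.

(** [j] is the integral part of [n.+1 * t]: the distance of [n.+1 * t] to [j] and
    to [j.+1] exceeds [gap n] since the corresponding intervals are removed. *)
Lemma fat_cantor_gap (t : R) n : fat_cantor t ->
  exists j : 'I_n.+1, j%:R + gap n < n.+1%:R * t < j.+1%:R - gap n.
Proof.
rewrite /fat_cantor /= in_itv /= => -[/andP[t0 t1] nr].
have far j : (j < n.+2)%N -> gap n < `|n.+1%:R * t - j%:R|.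
  move=> jn; rewrite ltNge; apply/negP => le; apply: nr; exists n => //.
  rewrite /removed -bigcup_mkord; exists j => //=.
  rewrite /tooth /= in_itv /= ler_pdivrMr// ler_pdivlMr// [t * _]mulrC.
  by move: le; rewrite ler_norml => /andP[h1 h2]; apply/andP; split; lra.
have s0 : 0 <= n.+1%:R * t by rewrite mulr_ge0.
have [j1 j2] := andP (truncn_itv s0); set j := Num.truncn _ in j1 j2.
have jn : (j < n.+1)%N.
  rewrite -(ltr_nat R); apply: (le_lt_trans j1).
  rewrite lt_neqAle; apply/andP; split; last by rewrite ler_piMr.
  apply/eqP => e; have := far n.+1 (ltnSn _); rewrite e subrr normr0.
  by rewrite ltNge ltW// gap_gt0.
exists (Ordinal jn) => /=.
have := far j (ltnW jn); rewrite ger0_norm ?subr_ge0// => h1.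
have := far j.+1 jn; rewrite ltr0_norm ?subr_lt0// => h2.
by apply/andP; split; lra.
Qed.

Lemma removed_le n : (leb (removed n) <= (2^-1 ^+ n.+2)%:E)%E.
Proof.
apply: (@le_trans _ _ (\sum_(j < n.+2) leb (tooth n j))%E).
  by apply: (Boole_inequality leb) => j _; exact: measurable_itv.
apply: (@le_trans _ _ (\sum_(j < n.+2) (2 * gap n / n.+1%:R)%:E)%E).
  apply: lee_sum => j _; rewrite /tooth lebesgue_measure_itv /=; case: ifP => _.
    rewrite -EFinB lee_fin -mulrBl.
    by rewrite (_ : _ - _ = 2 * gap n)//; ring.
  by rewrite lee_fin divr_ge0// mulr_ge0// ltW// gap_gt0.
rewrite sumEFin lee_fin sumr_const card_ord -(mulr_natr _ n.+2).
have -> : 2^-1 ^+ n.+2 = 4 * gap n by rewrite /gap !exprS; field.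
rewrite mulrAC ler_pdivrMr//.
have : n.+2%:R <= 2 * n.+1%:R :> R by rewrite -!natr1; have := ler0n R n; lra.
have := gap_gt0 n; nra.
Qed.

Lemma fat_cantor_gt0 : (0 < leb fat_cantor)%E.
Proof.
have mU : measurable (\bigcup_n removed n).
  by apply: bigcupT_measurable => n; exact: removed_measurable.
have geo n : (\sum_(0 <= k < n) (2^-1 ^+ k.+2 : R)) = 2^-1 - 2^-1 ^+ n.+1.
  elim: n => [|n IH]; first by rewrite big_nil expr1 subrr.
  by rewrite big_nat_recr//= IH [2^-1 ^+ n.+2]exprS; field.
have hU : (leb (\bigcup_n removed n) <= (2^-1 : R)%:E)%E.
  apply: (@le_trans _ _ (\sum_(n <oo) leb (removed n))%E).
    exact: (generalized_Boole_inequality leb removed_measurable mU).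
  apply: lime_le; first by apply: is_cvg_nneseries.
  near=> n; apply: (@le_trans _ _ (\sum_(0 <= k < n) (2^-1 ^+ k.+2)%:E)%E).
    by apply: lee_sum => k _; exact: removed_le.
  rewrite sumEFin lee_fin.
  by rewrite geo gerBl exprn_ge0.
rewrite lt0e measure_ge0 andbT; apply/eqP => C0.
have : (leb [set` `[0%R, 1%R]] <= leb fat_cantor + leb (\bigcup_n removed n))%E.
  apply: (@le_trans _ _ (leb (fat_cantor `|` \bigcup_n removed n))).
    have m1 : measurable ([set` `[0%R, 1%R]] : set (measurableTypeR R)) by exact: measurable_itv.
    have m2 : measurable (fat_cantor `|` \bigcup_n removed n).
      by apply: measurableU => //; exact: fat_cantor_measurable.
    apply: (le_measure leb (mem_set m1) (mem_set m2)) => t t01.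
    have [|] := pselect ((\bigcup_n removed n) t); first by right.
    by move=> ?; left.
  by apply: (measureU2 leb) => //; exact: fat_cantor_measurable.
rewrite C0 add0e lebesgue_measure_itv /= lte01 sube0 => h.
have := le_trans h hU; rewrite lee_fin; lra.
Unshelve. all: by end_near. Qed.

End FatCantor.

(** * A measure for which S is strictly contained in T *)

Section FatCantorLine.
Context {R : realType} {d : nat} (i0 : 'I_d).
Local Notation T := (borel R d).
Local Notation E := 'rV[R]_d.
Local Notation leb := (@lebesgue_measure R).
Implicit Types (phi psi : E -> R) (sigma : E -> E).

Definition line (t : R) : T := t *: delta_mx 0 i0.

Lemma line_coord (t : R) i : line t 0 i = t * (i == i0)%:R.
Proof. by rewrite !mxE eqxx. Qed.

Lemma line_norm (t : R) : `|line t : E| <= `|t|.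
Proof.
apply: norm_le_coord => // i; rewrite line_coord normrM ler_piMr//.
by case: eqP; rewrite ?normr1 ?normr0.
Qed.

Lemma line_continuous : continuous (line : R -> E).
Proof. by move=> t; apply: cvgZr_tmp; exact: cvg_id. Qed.

Lemma line_measurable : measurable_fun [set: measurableTypeR R] line.
Proof.
apply: (@measurability _ _ (measurableTypeR R) T setT line (@open E)) => // _ [U oU <-].
rewrite setTI; apply: open_measurable.
by move/continuousP: line_continuous; exact.
Qed.

Lemma line_preimage_measurable (A : set T) : measurable A -> measurable (line @^-1` A).
Proof. by move=> mA; rewrite -[X in measurable X]setTI; exact: line_measurable. Qed.

Section Image.
Variable D : set R.

(** The measurability of [D] is an argument so that this constant can carry the
    structure of a measure. *)
Definition line_measure & measurable (D : set (measurableTypeR R)) : set T -> \bar R :=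
  fun A => leb (line @^-1` A `&` D).

Hypothesis mD : measurable (D : set (measurableTypeR R)).

Let line_measure0 : line_measure mD set0 = 0%E.
Proof. by rewrite /line_measure preimage_set0 set0I measure0. Qed.

Let line_measure_ge0 A : (0 <= line_measure mD A)%E.
Proof. exact: measure_ge0. Qed.

Let line_measure_sigma_additive : semi_sigma_additive (line_measure mD).
Proof.
move=> F mF tF mUF; rewrite /line_measure preimage_bigcup setI_bigcupl.
apply: (measure_semi_sigma_additive (s := leb)).
- by move=> n; apply: measurableI => //; exact: line_preimage_measurable.
- apply/trivIsetP => /= i j _ _ ij; rewrite setIACA setIid -preimage_setI.
  by move/trivIsetP : tF => /(_ _ _ _ _ ij) ->//; rewrite preimage_set0 set0I.
- rewrite -setI_bigcupl -preimage_bigcup.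
  by apply: measurableI => //; exact: line_preimage_measurable.
Qed.

HB.instance Definition _ := isMeasure.Build _ _ _ (line_measure mD)
  line_measure0 line_measure_ge0 line_measure_sigma_additive.

Lemma line_measureT : line_measure mD setT = leb D.
Proof. by rewrite /line_measure preimage_setT setTI. Qed.

Lemma line_measure_out (A : set T) : line @^-1` A `&` D `<=` set0 -> line_measure mD A = 0%E.
Proof. by rewrite subset0 /line_measure => ->; rewrite measure0. Qed.

Lemma Rint_line (p : T -> R) (M : R) : (leb D < +oo)%E ->
  measurable_fun [set: T] p -> (forall x, `|p x| <= M) ->
  \int[line_measure mD]_x p x = \int[leb]_(t in D) p (line t).
Proof.
move=> Dfin mp pM.
have mpl : measurable_fun [set: measurableTypeR R] (p \o line).
  exact: (measurableT_comp mp line_measurable).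
have finD : (mrestr leb mD setT < +oo)%E by rewrite /mrestr setTI.
have ipl : intR (mrestr leb mD) (p \o line) := intR_bounded finD mpl (fun t => pM (line t)).
have emp : measurable_fun [set: T] (EFin \o p) by exact/measurable_EFinP.
have -> : \int[line_measure mD]_x p x = \int[mrestr leb mD]_t p (line t).
  by congr fine; exact: (integral_pushforward line_measurable emp ipl measurableT).
have sf : sigma_finite setT leb by exact: sigma_finiteT.
have i1 : intR leb (\1_D : R -> R).
  apply/integrableP; split; first by apply/measurable_EFinP.
  under eq_integral do rewrite gee0_abs ?lee_fin//.
  by rewrite integral_indic// setIT.
rewrite (Rint_measure_density (nu := leb) finD sf i1 _ mpl (fun t => pM (line t))); last first.
  by move=> A mA; rewrite integral_indic// setIC.
under eq_Rintegral do rewrite mulrC.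
by rewrite Rint_indicM.
Qed.

End Image.

Let mC := @fat_cantor_measurable R.
Let mI : measurable ([set` `[0%R, 1%R]] : set (measurableTypeR R)) := measurable_itv _.
Let mG : measurable ([set` `[0%R, 1%R]] `\` fat_cantor : set (measurableTypeR R)) :=
  measurableD mI mC.

Let lebI : leb [set` `[0%R, 1%R]] = 1%E.
Proof. by rewrite lebesgue_measure_itv /= lte01 sube0. Qed.

Definition cantor_line : {measure set T -> \bar R} := line_measure mC.
Let segment : {measure set T -> \bar R} := line_measure mI.
Let gaps : {measure set T -> \bar R} := line_measure mG.

Let segmentE A : measurable A -> segment A = (cantor_line A + gaps A)%E.
Proof.
move=> mA; rewrite /segment /cantor_line /gaps /= /line_measure.
have mLA := line_preimage_measurable mA.
rewrite -(measureU leb); [|exact: measurableI..|].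
  by rewrite -setIUr setDUK// => t [].
by rewrite setIACA setDIK setI0.
Qed.

Let segment_fin : (segment setT < +oo)%E.
Proof. by rewrite [segment setT](line_measureT mI) lebI ltry. Qed.

Lemma cantor_line_fin : (cantor_line setT < +oo)%E.
Proof.
apply: le_lt_trans segment_fin; rewrite segmentE//; exact: leeDl.
Qed.

Let gaps_fin : (gaps setT < +oo)%E.
Proof. apply: le_lt_trans segment_fin; rewrite segmentE//; exact: leeDr. Qed.

Lemma cantor_line_radon : radon cantor_line.
Proof.
move=> K cK; apply: le_lt_trans cantor_line_fin; apply: le_measure; rewrite ?inE//.
by apply: closed_borel; apply: compact_closed => //; exact: norm_hausdorff.
Qed.

Lemma cantor_line_gt0 : (0 < cantor_line setT)%E.
Proof. by rewrite [cantor_line setT](line_measureT mC); exact: fat_cantor_gt0. Qed.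

Let direction : E -> E := fun=> delta_mx 0 i0.

Let int_direction (m : {measure set T -> \bar R}) i : (m setT < +oo)%E ->
  intR m (fun _ : T => (i == i0)%:R : R).
Proof.
move=> mfin; apply: (@intR_bounded _ _ _ _ _ 1) => // x.
by case: eqP; rewrite ?normr1 ?normr0.
Qed.

Lemma segment_FTC phi : test_function phi ->
  \int[segment]_x partial i0 phi x = phi (line 1) - phi (line 0).
Proof.
move=> tphi; have [M HM] := test_bounded (test_partial i0 tphi).
rewrite (Rint_line mI _ (test_measurable (test_partial i0 tphi)) HM); last by rewrite lebI ltry.
have D t : is_derive t (1 : R) (fun s => phi (line s)) (partial i0 phi (line t)).
  have := @is_derive_line R d phi 0 (delta_mx 0 i0) t tphi.1.
  by under eq_fun do rewrite add0r; rewrite add0r.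
have cphi : continuous (fun s => phi (line s)).
  move=> t; apply: differentiable_continuous; apply/derivable1_diffP.
  by case: (D t).
rewrite /Rintegral (@continuous_FTC2 _ _ (fun s => phi (line s)))//.
- apply: continuous_subspaceT => t.
  apply: (@continuous_comp _ _ _ line (partial i0 phi)); first exact: line_continuous.
  by apply: smooth_continuous; case: (test_partial i0 tphi).
- split.
  + by move=> t _; case: (D t).
  + by apply: cvg_at_right_filter; exact: cphi.
  + by apply: cvg_at_left_filter; exact: cphi.
- by move=> t _; rewrite derive1E; case: (D t).
Qed.

(** The unit segment is a current whose divergence is a difference of Dirac
    masses; its part on the Cantor set is [cantor_line] times the direction, and
    the rest lives over the complement of the Cantor set, which is null for
    [cantor_line]. *)
Lemma direction_calV : calV cantor_line direction.
Proof.
have dfin (a : T) : ((\d_a : {measure set T -> \bar R}) setT < +oo)%E.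
  by rewrite /= /dirac indicE ltry.
have d1 (a : T) : intR (\d_a : {measure set T -> \bar R}) (fun=> 1 : R).
  by apply: (@intR_bounded _ _ _ _ _ 1) => // x; rewrite normr1.
pose f := charge_diff (induced_charge (d1 (line 1))) (induced_charge (d1 (line 0))).
pose lambda i := [the charge T R of induced_charge (int_direction i segment_fin)].
have sfd (a : T) : sigma_finite setT (\d_a : {measure set T -> \bar R}).
  exact: finite_sigma_finite.
exists lambda.
  apply: (@normal_current_bounded _ _ lambda f 1) => //.
  - move=> phi tphi; have [M HM] := test_bounded tphi.
    rewrite (charge_integral_diff (d1 _) (d1 _) (sfd _) (sfd _) (test_measurable tphi) HM).
    rewrite /neg_div (bigD1 i0)//= big1 ?addr0; last first.
      move=> i /negPf ii0; have [B HB] := test_bounded (test_partial i tphi).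
      rewrite (charge_integral_induced _ _ (test_measurable (test_partial i tphi)) HB).
        under eq_Rintegral do rewrite ii0 mul0r.
        by rewrite Rintegral_cst// mul0r.
      exact: finite_sigma_finite.
    have [B HB] := test_bounded (test_partial i0 tphi).
    rewrite (charge_integral_induced _ _ (test_measurable (test_partial i0 tphi)) HB); last first.
      exact: finite_sigma_finite.
    under eq_Rintegral do rewrite eqxx mul1r.
    rewrite segment_FTC//.
    have dE (a : T) : \int[(\d_a : {measure set T -> \bar R})]_x (1 * phi x) = phi a.
      under eq_Rintegral do rewrite mul1r.
      rewrite /Rintegral integral_dirac//; last by apply/measurable_EFinP; exact: test_measurable.
      by rewrite diracT mul1e.
    by rewrite !dE.
  - move=> A mA A1.
    have d0 (t : R) : `|t| <= 1 -> induced_charge (d1 (line t)) A = 0%E.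
      move=> t1; apply: induced_charge_null => //.
      rewrite /= /dirac indicE memNset// => /A1; rewrite /far /= ltNge.
      by rewrite (le_trans (line_norm t)).
    transitivity (0 + (-1)%:E * 0 : \bar R)%E; last by rewrite mule0 adde0.
    apply: (congr2 (fun u v => u + (-1)%:E * v)%E); apply: d0.
      by rewrite normr1.
    by rewrite normr0.
  - move=> i A mA A1; apply: induced_charge_null => //.
    apply: line_measure_out => t [/= /A1]; rewrite /far /= ltNge in_itv /= => /negP no /andP[t0 t1].
    by apply: no; rewrite (le_trans (line_norm t))// ger0_norm.
split.
  move=> i; rewrite /direction; under eq_fun do rewrite !mxE eqxx.
  exact: int_direction cantor_line_fin.
exists (fun i => [the charge T R of induced_charge (int_direction i gaps_fin)]).
  move=> i; exists ((fun x : E => x 0 i0) @^-1` (~` fat_cantor)); split.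
  - rewrite -[X in measurable X]setTI; apply: coord_measurable => //.
    exact: measurableC.
  - by apply: line_measure_out => t [/=]; rewrite line_coord eqxx mulr1.
  - move=> A mA AN; apply: induced_charge_null => //.
    apply: line_measure_out => t [/= /AN /= h [_ nC]].
    by apply: h; rewrite line_coord eqxx mulr1.
move=> i A mA; rewrite /lambda /= /induced_charge.
have cE (m : {measure set T -> \bar R}) :
    (\int[m]_(x in A) (EFin \o (fun _ : T => (i == i0)%:R)) x = (i == i0)%:R%:E * m A)%E.
  exact: integral_cst.
rewrite !cE; under eq_integral do rewrite /direction mxE eqxx.
rewrite (_ : (\int[_]_(x in A) _)%E = ((i == i0)%:R%:E * cantor_line A)%E); last exact: integral_cst.
by rewrite segmentE// ge0_muleDr.
Qed.

Lemma cantor_line_ae : {ae cantor_line, forall x : T, fat_cantor ((x : E) 0 i0)}.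
Proof.
exists ((fun x : E => x 0 i0) @^-1` (~` fat_cantor)); split => //.
- rewrite -[X in measurable X]setTI; apply: coord_measurable => //.
  exact: measurableC.
- by apply: line_measure_out => t [/=]; rewrite line_coord eqxx mulr1.
Qed.

Lemma le_inv_natr_eq0 (a K : R) : (forall n : nat, `|a| <= K * n.+1%:R^-1) -> a = 0.
Proof.
move=> aK; apply/eqP; rewrite -normr_le0; apply/ler_addgt0Pr => e e0; rewrite add0r.
have K0 : 0 <= K by have := aK 0%N; rewrite invr1 mulr1; exact: le_trans.
apply: (le_trans (aK (Num.bound (K / e)))).
rewrite ler_pdivrMr// mulrC -ler_pdivrMr//; apply: ltW.
apply: (lt_trans (archi_boundP _)); first by rewrite divr_ge0// ltW.
by rewrite ltr_nat.
Qed.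

(** Test the divergence, a measure [f], against [c * psi] where [c] is a comb of
    size [n.+1^-1]. The terms in which [c] is not differentiated are of order
    [n.+1^-1], and the remaining one is the integral of [sigma_0 * psi], because
    the derivative of [c] along the axis is 1 on the Cantor set. *)
Lemma calS_pairing sigma psi : calS cantor_line sigma -> test_function psi ->
  \int[cantor_line]_x (sigma x 0 i0 * psi x) = 0.
Proof.
move=> [sL [lambda ac [f _ lambdaf]]] tpsi.
have sf : sigma_finite setT cantor_line := finite_sigma_finite cantor_line_fin.
have [B HB] := test_bounded tpsi.
have /choice[B' HB'] := fun i => test_bounded (test_partial i tpsi).
have B0 : 0 <= B := le_trans (normr_ge0 _) (HB 0).
apply: (@le_inv_natr_eq0 _ (B * fine (tv f setT) +
  \sum_i B' i * \int[cantor_line]_x `|sigma x 0 i|)) => n.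
pose c : E -> R := comb i0 n.+1 (gap n).
have sc : smooth c by exact: comb_smooth.
have c1 x : `|c x| <= n.+1%:R^-1 by apply: comb_le; exact: gap_gt0.
have tcp : test_function (fun x => c x * psi x) by exact: test_mul_smooth.
have tcpp i : test_function (fun x => c x * partial i psi x).
  by apply: test_mul_smooth => //; exact: test_partial.
have tpc i : test_function (fun x => partial i c x * psi x).
  by apply: test_mul_smooth => //; exact: smooth_partial.
have pE i x : partial i (fun x => c x * psi x) x = c x * partial i psi x + partial i c x * psi x.
  have dc y : differentiable c y by exact: smooth_differentiable.
  have dp y : differentiable psi y by apply: smooth_differentiable; case: tpsi.
  by rewrite (partialM i dc dp) [psi x * _]mulrC.
have ib i q : test_function q -> intR cantor_line (fun x : T => sigma x 0 i * q x).
  by move=> tq; exact: intR_density_test.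
have lhs : neg_div lambda (fun x => c x * psi x) =
    \sum_i \int[cantor_line]_x (sigma x 0 i * (c x * partial i psi x)) +
    \int[cantor_line]_x (sigma x 0 i0 * psi x).
  have -> : \int[cantor_line]_x (sigma x 0 i0 * psi x) =
      \sum_i \int[cantor_line]_x (sigma x 0 i * (partial i c x * psi x)).
    have aeE i : \int[cantor_line]_x (sigma x 0 i * (partial i c x * psi x)) =
        \int[cantor_line]_x (sigma x 0 i * ((i == i0)%:R * psi x)).
      apply: Rint_ae_eq.
      - exact: intR_measurable (ib i _ (tpc i)).
      - exact: intR_measurable (ib i _ (test_scale _ tpsi)).
      - have := cantor_line_ae; apply: filterS => x /(@fat_cantor_gap _ _ n)[j Hj].
        by rewrite (@partial_comb _ _ _ _ _ _ _ j)//; exact: gap_gt0.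
    under eq_bigr do rewrite aeE.
    rewrite (bigD1 i0)//= big1 ?addr0.
      by apply: eq_Rintegral => x _; rewrite eqxx mul1r.
    move=> i /negPf ii0; under eq_Rintegral do rewrite ii0 mul0r mulr0.
    by rewrite Rintegral_cst// mul0r.
  rewrite -big_split /=; apply: eq_bigr => i _.
  have [M HM] := test_bounded (test_partial i tcp).
  rewrite (charge_integral_density sf (sL i) (ac i) (test_measurable (test_partial i tcp)) HM).
  rewrite -(RintegralD measurableT (ib i _ (tcpp i)) (ib i _ (tpc i))).
  by apply: eq_Rintegral => x _; rewrite pE mulrDr.
have fle : `|charge_integral f (fun x => c x * psi x)| <= n.+1%:R^-1 * B * fine (tv f setT).
  apply: charge_integral_le; first exact: test_measurable.
  by move=> x; rewrite normrM ler_pM.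
have rle : `|\sum_i \int[cantor_line]_x (sigma x 0 i * (c x * partial i psi x))| <=
    n.+1%:R^-1 * \sum_i B' i * \int[cantor_line]_x `|sigma x 0 i|.
  apply: (le_trans (ler_norm_sum _ _ _)); rewrite mulr_sumr; apply: ler_sum => i _.
  rewrite mulrA -RintegralZl//; last exact: (intR_norm (sL i)).
  apply: Rint_norm_le.
  - exact: intR_measurable (ib i _ (tcpp i)).
  - exact: (intRZ _ (intR_norm (sL i))).
  - by move=> x; rewrite normrM mulrC ler_wpM2r// normrM ler_pM.
have := lambdaf _ tcp; rewrite lhs => e.
rewrite (_ : \int[cantor_line]_x _ = charge_integral f (fun x => c x * psi x) -
  \sum_i \int[cantor_line]_x (sigma x 0 i * (c x * partial i psi x))); last first.
  by rewrite -e addrC addKr.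
apply: (le_trans (ler_normB _ _)); rewrite mulrDl; apply: lerD.
  by apply: (le_trans fle); rewrite -mulrA mulrC.
by rewrite mulrC.
Qed.

(** The component of the current along the axis vanishes on test functions by
    [calS_pairing], hence on Borel sets by density. *)
Lemma calS_transverse sigma : calS cantor_line sigma ->
  {ae cantor_line, forall x, sigma x 0 i0 = 0}.
Proof.
move=> Ssigma; have [sL [lambda ac _]] := Ssigma.
have sf : sigma_finite setT cantor_line := finite_sigma_finite cantor_line_fin.
have [k [mk k1 lE kE]] := charge_integral_polar (lambda i0).
have l0 A : measurable A -> lambda i0 A = 0%E.
  move=> mA; suff h : \int[tv (lambda i0)]_x (\1_A x * k x) = 0.
    by rewrite lE// -Rint_setE ?h//; exact: (intR_bounded (total_variation_fin _) mk k1).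
  apply/eqP; rewrite -normr_le0; apply/ler_addgt0Pr => e e0; rewrite add0r.
  have [psi tpsi Hpsi] := indic_test_dense (fun _ : 'I_1 => total_variation_fin (lambda i0)) mA e0.
  have [B HB] := test_bounded tpsi.
  have mpsi := test_measurable tpsi.
  have z : \int[tv (lambda i0)]_x (k x * psi x) = 0.
    rewrite -(kE _ _ mpsi HB) (charge_integral_density sf (sL i0) (ac i0) mpsi HB).
    exact: calS_pairing.
  have tfin := total_variation_fin (lambda i0).
  have i1 : intR (tv (lambda i0)) (fun x => \1_A x * k x).
    by apply: intR_indicM => //; exact: (intR_bounded tfin mk k1).
  have i2 : intR (tv (lambda i0)) (fun x => k x * psi x).
    apply: (@intR_bounded _ _ _ _ _ B) => //; first exact: measurable_funM.
    by move=> x; rewrite normrM -[leRHS]mul1r ler_pM.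
  have i3 : intR (tv (lambda i0)) (fun x => \1_A x - psi x).
    apply: intRB; first by apply: (@intR_bounded _ _ _ _ _ 1) => //; exact: indic_bound.
    exact: (intR_bounded tfin mpsi HB).
  rewrite -[X in `|X|]subr0 -z -(RintegralB measurableT i1 i2).
  apply: (le_trans _ (ltW (Hpsi ord0))); apply: Rint_norm_le.
  - by apply: measurable_funB; apply: intR_measurable; [exact: i1|exact: i2].
  - exact: intR_norm.
  - by move=> x; rewrite mulrC -mulrBr normrM -[leRHS]mul1r ler_wpM2r.
have : ae_eq cantor_line setT (fun x : T => (sigma x 0 i0)%:E) (cst 0%E).
  apply: (integral_ae_eq measurableT (sL i0)) => // A _ mA.
  by rewrite -ac// l0// integral_cst// mul0e.
by apply: filterS => x /= /(_ I) [].
Qed.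

(** S stays in the hyperplane transverse to the axis, while T contains the
    direction of the axis. *)
Lemma cantor_line_strict : exists A : set T, [/\ measurable A, (0 < cantor_line A)%E &
  forall x, A x -> bundleS cantor_line x `<` bundleT cantor_line x].
Proof.
have sf : sigma_finite setT cantor_line := finite_sigma_finite cantor_line_fin.
pose W : E -> set E := fun=> [set v | v 0 i0 = 0].
have selW : closed_selectable cantor_line (calS cantor_line) W.
  split; last exact: calS_transverse.
    move=> x; apply: (@closed_comp _ _ (fun v : E => v 0 i0) [set 0]).
      by move=> v _; exact: coord_continuous.
    exact: closed_eq.
  move=> U oU; pose Z : set T := [set x | W x `&` U !=set0]; exists Z.
    have [->|->] : Z = setT \/ Z = set0; [|exact: measurableT|exact: measurable0].
    have [h|h] := pselect ([set v : E | v 0 i0 = 0] `&` U !=set0).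
      by left; apply/seteqP; split => // x _; exact: h.
    by right; apply/seteqP; split => // x /h.
  by rewrite setDv setU0; exact: negligible_set0.
have aeS : {ae cantor_line, forall x, bundleS cantor_line x `<=` W x}.
  apply: ess_union_sub => //; last exact: calS_measurable.
  by exists (fun=> 0); exact: calS0.
have aeT : {ae cantor_line, forall x, bundleT cantor_line x (delta_mx 0 i0)}.
  have [[_ _ selT] _] := bundleT_ess_union sf.
  exact: selT (calV_sub_calT sf direction_calV).
have [N [mN N0 HN]] : {ae cantor_line, forall x, bundleS cantor_line x `<` bundleT cantor_line x}.
  have := ae_combine (fun x (a : bundleS cantor_line x `<=` W x) b => conj a b) aeS aeT.
  apply: ae_combine (bundleS_sub_bundleT sf) => x ST [SW Td]; split => // TS.
  by have := SW _ (TS _ Td); rewrite /W /= mxE !eqxx => /eqP; rewrite oner_eq0.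
exists (~` N); split; first exact: measurableC.
  rewrite lt0e measure_ge0 andbT; apply/eqP => NC0.
  have mNC : measurable (~` N) by exact: measurableC.
  have muT : cantor_line setT = 0%E.
    rewrite -(setUv N); apply: (etrans (measureU cantor_line mN mNC (setICr N))).
    transitivity (0 + 0 : \bar R); last exact: addr0.
    by congr (_ + _); [exact: N0|exact: NC0].
  by have := cantor_line_gt0; rewrite muT ltxx.
by move=> x Nx; apply: contrapT => h; apply: Nx; exact: HN.
Qed.

End FatCantorLine.

Theorem proposition5p1 (R : realType) (d : nat) (d_gt0 : (0 < d)%N) :
  (forall mu : {measure set (borel R d) -> \bar R}, radon mu ->
    [/\ {ae mu, forall x, bundleV mu x = bundleT mu x},
        {ae mu, forall x, bundleS mu x `<=` bundleT mu x} &
        (mu [set: borel R d] < +oo)%E -> compact (msupport mu) ->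
          (forall p : R, 1 < p ->
             {ae mu, forall x, bundleTp p mu x `<=` bundleS mu x}) /\
          (forall p q : R, 1 < p -> p <= q ->
             {ae mu, forall x, bundleTp p mu x `<=` bundleTp q mu x})]) /\
  (exists2 mu : {measure set (borel R d) -> \bar R}, radon mu &
    exists A : set (borel R d),
      [/\ measurable A, (0 < mu A)%E &
          forall x, A x -> bundleS mu x `<` bundleT mu x]).
Proof.
split; last first.
  exists (cantor_line (Ordinal d_gt0)); first exact: cantor_line_radon.
  exact: cantor_line_strict.
move=> mu /radon_sigma_finite sf; split.
- exact: bundleV_eq_bundleT.
- exact: bundleS_sub_bundleT.
- move=> mufin cK; split; first by move=> p; exact: bundleTp_sub_bundleS.
  by move=> p q; exact: bundleTp_mono.
Qed.
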